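(* Let $f=f(w,z)$ be a complex-valued function holomorphic in both arguments on an open subset of $\mathbb C^2\cong\mathbb R^4$ with coordinates $w,z$, and consider the Riemannian metric $$g=2\Big({\rm d}w\,{\rm d}\bar w+\exp\big(f(w,z)+\bar f(\bar w,\bar z)\big)\,{\rm d}z\,{\rm d}\bar z\Big).$$ Let $m=\partial_{\bar w}$, $p=\partial_w$, $n={\rm e}^{-f}\partial_z$, $k={\rm e}^{-\bar f}\partial_{\bar z}$, let $\mathcal N={\rm Span}_{\mathbb C}(m,k)$, and choose the orientation for which $\mathcal N$ is selfdual. Then $\mathcal N$ is an integrable field of selfdual totally null 2-planes, the antiselfdual part of the Weyl tensor of $g$ vanishes identically, so that $g$ is Bach flat, and the only nonvanishing components of the Weyl tensor in the frame $(m,p,n,k)$ are $$\Psi_3=\overline{\Psi_1}=\tfrac14{\rm e}^{-f}f_{wz}.$$ Consequently, if $f_{wz}\neq0$, then $g$ is a Bach-flat Riemannian metric with nonvanishing selfdual part of the Weyl tensor, which is of general type G, and which admits an integrable hermitian structure agreeing with the orientation whose associated field of selfdual totally null 2-planes $\mathcal N$ is principal but not multiple principal; moreover such a $g$ is not conformal to an Einstein metric.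
   Context: ${\rm d}w\,{\rm d}\bar w$ denotes the symmetrized product $\tfrac12({\rm d}w\otimes{\rm d}\bar w+{\rm d}\bar w\otimes{\rm d}w)$; thus $g(m,p)=g(n,k)=1$ and all other products of the frame vectors vanish. $f_{wz}=\partial_w\partial_zf$. A totally null 2-plane is a complex 2-plane in ${\rm T}^{\mathbb C}\mathcal M$ on which $g$ (extended complex-bilinearly) vanishes; it is selfdual if $*(n_1\wedge n_2)=n_1\wedge n_2$ for its elements. Weyl conventions, with $(e_1,e_2,e_3,e_4)=(m,p,n,k)$: $R(e_c,e_d)e_b=R^a{}_{bcd}e_a$, $R_{ab}=R^c{}_{acb}$, $R=g^{ab}R_{ab}$, $\mathsf P_{ab}=\tfrac12R_{ab}-\tfrac1{12}Rg_{ab}$, $C_{abcd}=R_{abcd}+g_{ad}\mathsf P_{cb}-g_{ac}\mathsf P_{db}+g_{bc}\mathsf P_{da}-g_{bd}\mathsf P_{ca}$. The components of the selfdual part are $\Psi_0=C(m,k,m,k)$, $\Psi_1=C(m,k,n,k)$, $\Psi_2=C(m,k,p,n)$, $\Psi_3=C(p,n,m,p)$, $\Psi_4=C(p,n,p,n)$. The plane ${\rm Span}_{\mathbb C}(m+zn,k-zp)$ (or ${\rm Span}_{\mathbb C}(n,p)$ for $z=\infty$) is principal, resp. multiple principal, if $z\in\mathbb C\cup\{\infty\}$ is a root, resp. multiple root, of the quartic $\Psi_4z^4-4\Psi_3z^3+6\Psi_2z^2+4\Psi_1z+\Psi_0$. In Riemannian signature the selfdual part of the Weyl tensor is of general type G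 at a point if this quartic has four distinct roots in $\mathbb C\cup\{\infty\}$. The hermitian structure associated with $\mathcal N$ is the orthogonal complex structure with ${\rm T}^{(1,0)}=\mathcal N$. The Bach tensor is $B_{ab}=\nabla^c A_{abc}+\mathsf P^{dc}C_{dacb}$ up to sign conventions, where $A_{abc}=\nabla_b\mathsf P_{ca}-\nabla_c\mathsf P_{ba}$; Bach flat means it vanishes. *)

(* Defs.v *)
From HB Require Import structures.
From mathcomp Require Import all_boot all_order all_algebra.
From mathcomp Require Import complex.
From mathcomp Require Import boolp classical_sets reals topology normedtype.
From mathcomp Require Import sequences derive exp trigo.

Set Implicit Arguments.
Unset Strict Implicit.
Unset Printing Implicit Defensive.

Import Order.TTheory GRing.Theory Num.Theory.
Import numFieldNormedType.Exports.

Local Open Scope classical_set_scope.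
Local Open Scope ring_scope.
Local Open Scope complex_scope.

(* MathComp-Analysis.  Tensors on open subsets of R^4 are given by their
   components in the coordinate frame; tangent vectors are row vectors, and
   complexified tangent vectors are row vectors over R[i].  The copy R[i]^o of
   R[i] carries the norm, the topology and the complex derivatives. *)

Section Calculus.
Variable R : realType.
Local Notation pt := 'rV[R]_4.
Local Notation cvec := 'rV[R[i]]_4.

Definition pd (i : 'I_4) (F : pt -> R) : pt -> R := 'D_('e_i) F.

(* C^infinity on the open set V: every iterated partial derivative exists and
   is differentiable, at every point of V. *)
Definition smooth_on (V : set pt) (F : pt -> R) : Prop :=
  forall (s : seq 'I_4) (x : pt), V x -> differentiable (foldr pd F s) x.

Definition cpd (i : 'I_4) (F : pt -> R[i]) (x : pt) : R[i] :=
  pd i (fun y => complex.Re (F y)) x +i* pd i (fun y => complex.Im (F y)) x.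

Definition csmooth_on (V : set pt) (F : pt -> R[i]) : Prop :=
  smooth_on V (fun y => complex.Re (F y)) /\
  smooth_on V (fun y => complex.Im (F y)).

Definition smooth_cfield (V : set pt) (X : pt -> cvec) : Prop :=
  forall i : 'I_4, csmooth_on V (fun x => X x 0 i).

Definition lie_bracket (X Y : pt -> cvec) (x : pt) : cvec :=
  \row_(k < 4) \sum_(i < 4)
    (X x 0 i * cpd i (fun y => Y y 0 k) x - Y x 0 i * cpd i (fun y => X y 0 k) x).

(* A field of complex subspaces is given by a matrix at each point, whose row
   space is the subspace.  It is integrable when it is smooth (through every
   vector passes a smooth local section) and its smooth local sections are
   closed under the Lie bracket. *)
Definition section_of (V : set pt) (r : nat) (N : pt -> 'M[R[i]]_(r, 4))
    (X : pt -> cvec) : Prop :=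
  smooth_cfield V X /\ forall x, V x -> (X x <= N x)%MS.

Definition integrable_field (U : set pt) (r : nat)
    (N : pt -> 'M[R[i]]_(r, 4)) : Prop :=
  (forall (x : pt) (v : cvec), U x -> (v <= N x)%MS ->
     exists (V : set pt) (X : pt -> cvec),
       [/\ open V, V x, V `<=` U, section_of V N X & X x = v]) /\
  forall (V : set pt) (X Y : pt -> cvec), open V -> V `<=` U ->
    section_of V N X -> section_of V N Y ->
    forall x, V x -> (lie_bracket X Y x <= N x)%MS.

Definition cexp (z : R[i]) : R[i] :=
  (expR (complex.Re z))%:C * (cos (complex.Im z) +i* sin (complex.Im z)).

End Calculus.

Section Curvature.
Variable R : realType.
Local Notation pt := 'rV[R]_4.
Variable G : pt -> 'M[R]_4.

Definition riemannian_metric_on (U : set pt) : Prop :=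
  (forall i j, smooth_on U (fun x => G x i j)) /\
  forall x, U x -> (G x)^T = G x /\
    forall v : 'rV[R]_4, v != 0 -> 0 < (v *m G x *m v^T) 0 0.

Definition ginv (a b : 'I_4) (x : pt) : R := invmx (G x) a b.

(* Gamma^k_ij *)
Definition christoffel (k i j : 'I_4) (x : pt) : R :=
  2^-1 * \sum_(l < 4) ginv k l x *
    (pd i (fun y => G y j l) x + pd j (fun y => G y i l) x
     - pd l (fun y => G y i j) x).

(* R^a_bcd, where R(e_c, e_d) e_b = R^a_bcd e_a and
   R(X, Y) = [nabla_X, nabla_Y] - nabla_[X, Y] *)
Definition riemann_up (a b c d : 'I_4) (x : pt) : R :=
  pd c (christoffel a d b) x - pd d (christoffel a c b) x
  + \sum_(e < 4) (christoffel a c e x * christoffel e d b x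
                  - christoffel a d e x * christoffel e c b x).

Definition riemann (a b c d : 'I_4) (x : pt) : R :=
  \sum_(e < 4) G x a e * riemann_up e b c d x.

Definition ricci (a b : 'I_4) (x : pt) : R := \sum_(c < 4) riemann_up c a c b x.

Definition scalar_curvature (x : pt) : R :=
  \sum_(a < 4) \sum_(b < 4) ginv a b x * ricci a b x.

Definition schouten (a b : 'I_4) (x : pt) : R :=
  2^-1 * ricci a b x - 12^-1 * scalar_curvature x * G x a b.

Definition weyl (a b c d : 'I_4) (x : pt) : R :=
  riemann a b c d x + G x a d * schouten c b x - G x a c * schouten d b x
  + G x b c * schouten d a x - G x b d * schouten c a x.

(* nabla_c T_ab *)
Definition nabla2 (T : 'I_4 -> 'I_4 -> pt -> R) (c a b : 'I_4) (x : pt) : R :=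
  pd c (T a b) x - \sum_(e < 4) (christoffel e c a x * T e b x
                                 + christoffel e c b x * T a e x).

(* nabla_d T_abc *)
Definition nabla3 (T : 'I_4 -> 'I_4 -> 'I_4 -> pt -> R)
    (d a b c : 'I_4) (x : pt) : R :=
  pd d (T a b c) x - \sum_(e < 4) (christoffel e d a x * T e b c x
                                   + christoffel e d b x * T a e c x
                                   + christoffel e d c x * T a b e x).

(* A_abc = nabla_b P_ca - nabla_c P_ba *)
Definition cotton (a b c : 'I_4) (x : pt) : R :=
  nabla2 schouten b c a x - nabla2 schouten c b a x.

(* B_ab = nabla^c A_acb + P^dc C_dacb.  For the signs of A and C used here it
   is nabla^c A_acb = - nabla^c A_abc, not its opposite, that makes B
   conformally covariant. *)
Definition bach (a b : 'I_4) (x : pt) : R :=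
  \sum_(c < 4) \sum_(d < 4) ginv c d x * nabla3 cotton d a c b x
  + \sum_(c < 4) \sum_(d < 4)
      (\sum_(e < 4) \sum_(h < 4) ginv d e x * ginv c h x * schouten e h x)
      * weyl d a c b x.

Definition einstein_on (V : set pt) : Prop :=
  exists lam : R, forall x, V x -> forall a b, ricci a b x = lam * G x a b.

(* An orientation is a sign relative to the coordinate orientation; o = true
   is the opposite one. *)
Definition volume_form (o : bool) (a b c d : 'I_4) (x : pt) : R :=
  (-1) ^+ o * Num.sqrt (\det (G x)) *
  \det (\matrix_(i < 4, j < 4) (tnth [tuple a; b; c; d] i == j)%:R : 'M[R]_4).

Definition weyl_dual (o : bool) (a b c d : 'I_4) (x : pt) : R :=
  2^-1 * \sum_(e < 4) \sum_(h < 4) \sum_(e' < 4) \sum_(h' < 4)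
    volume_form o a b e h x * ginv e e' x * ginv h h' x * weyl e' h' c d x.

Definition weyl_sd (o : bool) (a b c d : 'I_4) (x : pt) : R :=
  2^-1 * (weyl a b c d x + weyl_dual o a b c d x).

Definition weyl_asd (o : bool) (a b c d : 'I_4) (x : pt) : R :=
  2^-1 * (weyl a b c d x - weyl_dual o a b c d x).

Definition cweyl (x : pt) (X Y Z W : 'rV[R[i]]_4) : R[i] :=
  \sum_(a < 4) \sum_(b < 4) \sum_(c < 4) \sum_(d < 4)
    (weyl a b c d x)%:C * X 0 a * Y 0 b * Z 0 c * W 0 d.

Definition cmetric (x : pt) (X Y : 'rV[R[i]]_4) : R[i] :=
  \sum_(a < 4) \sum_(b < 4) (G x a b)%:C * X 0 a * Y 0 b.

Definition wedge (u v : 'rV[R[i]]_4) : 'M[R[i]]_4 :=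
  \matrix_(a < 4, b < 4) (u 0 a * v 0 b - u 0 b * v 0 a).

(* Hodge star on complex bivectors beta^ab *)
Definition hodge (o : bool) (x : pt) (beta : 'M[R[i]]_4) : 'M[R[i]]_4 :=
  \matrix_(a < 4, b < 4)
    (2^-1 * \sum_(e < 4) \sum_(h < 4) \sum_(c < 4) \sum_(d < 4)
      (ginv a e x * ginv b h x * volume_form o e h c d x)%:C * beta c d).

Definition totally_null_plane (x : pt) (r : nat) (N : 'M[R[i]]_(r, 4)) : Prop :=
  \rank N = 2%N /\
  forall u v : 'rV[R[i]]_4, (u <= N)%MS -> (v <= N)%MS -> cmetric x u v = 0.

Definition selfdual_plane (o : bool) (x : pt) (r : nat)
    (N : 'M[R[i]]_(r, 4)) : Prop :=
  forall u v : 'rV[R[i]]_4, (u <= N)%MS -> (v <= N)%MS ->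
    hodge o x (wedge u v) = wedge u v.

(* J acts on a tangent row vector v by v *m J. *)
Definition hermitian_structure_on (U : set pt) (J : pt -> 'M[R]_4) : Prop :=
  (forall i j, smooth_on U (fun x => J x i j)) /\
  forall x, U x -> J x *m J x = - 1%:M /\
    forall u v : 'rV[R]_4,
      ((u *m J x) *m G x *m (v *m J x)^T) 0 0 = (u *m G x *m v^T) 0 0.

End Curvature.

Section ComplexStructures.
Variable R : realType.
Local Notation pt := 'rV[R]_4.

Definition T10 (J : 'M[R]_4) : 'M[R[i]]_4 :=
  eigenspace (map_mx (real_complex R) J) 'i.

(* The bases (u, J u, v, J v) are positively oriented. *)
Definition agrees_with_orientation (o : bool) (J : 'M[R]_4) : Prop :=
  forall u v : 'rV[R]_4,
    let d := \det (\matrix_(i < 4) tnth [tuple u; u *m J; v; v *m J] i) in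
    d != 0 -> 0 < (-1) ^+ o * d.

Definition conformally_einstein_on (V : set pt) (G : pt -> 'M[R]_4) : Prop :=
  exists Om : pt -> R, [/\ smooth_on V Om, forall x, V x -> 0 < Om x
    & einstein_on (fun x => (Om x) ^+ 2 *: G x) V].

End ComplexStructures.

Section Petrov.
Variable R : realType.
Local Notation pt := 'rV[R]_4.
Local Notation cvec := 'rV[R[i]]_4.
Variables (G : pt -> 'M[R]_4) (x : pt) (m p n k : cvec).

Definition Psi0 : R[i] := cweyl G x m k m k.
Definition Psi1 : R[i] := cweyl G x m k n k.
Definition Psi2 : R[i] := cweyl G x m k p n.
Definition Psi3 : R[i] := cweyl G x p n m p.
Definition Psi4 : R[i] := cweyl G x p n p n.

Definition weyl_quartic : {poly R[i]} :=
  Psi4 *: 'X^4 - (4 * Psi3) *: 'X^3 + (6 * Psi2) *: 'X^2 + (4 * Psi1) *: 'X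
  + Psi0%:P.

(* C u {infinity} is option R[i], with None for infinity; a polynomial of
   degree <= 4 is read as a form of degree 4, so that infinity is a root, resp.
   a multiple root, when the degree is at most 3, resp. at most 2. *)
Definition quartic_root (z : option R[i]) : bool :=
  if z is Some a then root weyl_quartic a else (size weyl_quartic <= 4)%N.

Definition quartic_multiple_root (z : option R[i]) : bool :=
  if z is Some a then ('X - a%:P) ^+ 2 %| weyl_quartic
  else (size weyl_quartic <= 3)%N.

Definition plane_at (z : option R[i]) : 'M[R[i]]_(1 + 1, 4) :=
  if z is Some a then col_mx (m + a *: n) (k - a *: p) else col_mx n p.

Definition principal_plane (N : 'M[R[i]]_(1 + 1, 4)) : Prop :=
  exists2 z, quartic_root z & (N == plane_at z)%MS.

Definition multiple_principal_plane (N : 'M[R[i]]_(1 + 1, 4)) : Prop :=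
  exists2 z, quartic_multiple_root z & (N == plane_at z)%MS.

Definition type_G : Prop :=
  exists s : seq (option R[i]),
    [/\ uniq s, size s = 4%N & forall z, quartic_root z = (z \in s)].

End Petrov.

Section HolomorphicFamily.
Variable R : realType.
Local Notation pt := 'rV[R]_4.
Local Notation cvec := 'rV[R[i]]_4.
Local Notation C2 := (R[i]^o * R[i]^o)%type.

(* (w, z) = (x0 + i x1, x2 + i x3) *)
Definition wz (x : pt) : C2 := (x 0 0 +i* x 0 1, x 0 2 +i* x 0 3).

Definition holomorphic_on (U : set C2) (f : C2 -> R[i]^o) : Prop :=
  forall q, U q -> differentiable f q.

Definition d_dw (f : C2 -> R[i]^o) : C2 -> R[i]^o :=
  'D_((1 : R[i]^o, 0 : R[i]^o)) f.
Definition d_dz (f : C2 -> R[i]^o) : C2 -> R[i]^o :=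
  'D_((0 : R[i]^o, 1 : R[i]^o)) f.

Definition dw (X : cvec) : R[i] := X 0 0 + 'i * X 0 1.
Definition dwb (X : cvec) : R[i] := X 0 0 - 'i * X 0 1.
Definition dz (X : cvec) : R[i] := X 0 2 + 'i * X 0 3.
Definition dzb (X : cvec) : R[i] := X 0 2 - 'i * X 0 3.

Definition vw : cvec := 2^-1 *: ('e_0 - 'i *: 'e_1).
Definition vwb : cvec := 2^-1 *: ('e_0 + 'i *: 'e_1).
Definition vz : cvec := 2^-1 *: ('e_2 - 'i *: 'e_3).
Definition vzb : cvec := 2^-1 *: ('e_2 + 'i *: 'e_3).

Definition symprod (al be : cvec -> R[i]) (X Y : cvec) : R[i] :=
  2^-1 * (al X * be Y + be X * al Y).

Variable f : C2 -> R[i]^o.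

Definition gform (x : pt) (X Y : cvec) : R[i] :=
  2 * (symprod dw dwb X Y
       + cexp (f (wz x) + conjc (f (wz x))) * symprod dz dzb X Y).

(* gform is real on real vectors. *)
Definition g_of (x : pt) : 'M[R]_4 :=
  \matrix_(i < 4, j < 4) complex.Re (gform x 'e_i 'e_j).

Definition m_of (x : pt) : cvec := vwb.
Definition p_of (x : pt) : cvec := vw.
Definition n_of (x : pt) : cvec := cexp (- f (wz x)) *: vz.
Definition k_of (x : pt) : cvec := cexp (- conjc (f (wz x))) *: vzb.

Definition N_of (x : pt) : 'M[R[i]]_(1 + 1, 4) := col_mx (m_of x) (k_of x).

End HolomorphicFamily.

(* Main.v *)
(** All curvature quantities of the metric, and of any conformal multiple
    [Om ^ 2 *: g], are Laurent polynomials in [E = expR (2 * Re f)] and [Om] with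
    coefficients polynomial in the derivatives of [Om] and the real and imaginary
    parts of the derivatives of [f], which are smooth by Cauchy's integral formula.
    The vanishing of the antiselfdual Weyl tensor and of the Bach tensor, and the
    values of the Psi's, are identities between such differential polynomials; the
    remaining Weyl component [Psi3 = conjc Psi1] gives the quartic
    [4 * z * (Psi1 - Psi3 * z ^ 2)], with the four distinct roots 0, infinity and
    two opposite numbers, of which 0 corresponds to [N].

    If [Om ^ 2 *: g] is Einstein, put [s = Om^-1] and let X, Y be d/d(conj w),
    d/d(conj z).  The (X, X), (X, Y), (Y, Y) components of the Einstein equation form
    an overdetermined linear system of second order for [s].  Cross-differentiating
    it twice, with [q = conjc f_wz], eliminates all derivatives of [s] and leaves
    [q ^ 3 * s = 0]. *)

(* The hypothesis on [f] is bare: a complex differential at each point, with nothing said about how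
   it depends on the point. The Bach tensor and the Einstein obstruction involve fourth derivatives,
   and [smooth_on] asks for all of them. Hence Goursat's argument, which needs no continuity of the
   derivative, and then the decisive closure property: both partial derivatives of a function
   differentiable in two complex variables are again jointly differentiable.

   Given this, [E], the conformal factor and the real and imaginary parts of the jets of [f]
   generate an algebra closed under the four coordinate derivations, by Cauchy-Riemann and Schwarz.
   Tensor components are evaluated once, formally, as normalized lists; soundness of evaluation and
   of the formal derivative then transfers any equality of lists to functions. A single set of
   curvature formulas serves [g] (factor 1, weight 0) and its conformal multiples (factor [Om],
   weight 2).

   The Einstein equation is used only on the totally null plane spanned by X and Y. There the metric
   vanishes, so the Einstein constant drops out. *)
Require Import Defs.
From HB Require Import structures.
From mathcomp Require Import all_boot all_order all_algebra.
From mathcomp Require Import complex.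
From mathcomp Require Import boolp classical_sets functions constructive_ereal reals topology normedtype.
From mathcomp Require Import sequences derive exp trigo measure.
From mathcomp Require Import lebesgue_measure lebesgue_integral ftc landau prodnormedzmodule.
From mathcomp Require Import ssrZ ring lra.
From Stdlib Require ZArith QArith_base Qreduction.

Set Implicit Arguments.
Unset Strict Implicit.
Unset Printing Implicit Defensive.

Import Order.TTheory GRing.Theory Num.Theory.
Import numFieldNormedType.Exports.

Local Open Scope classical_set_scope.
Local Open Scope ring_scope.
Local Open Scope complex_scope.

(** * Antiderivatives and mean value bounds on the real line *)

Section RealVariable.
Variable R : realType.
Implicit Types (F g : R -> R) (t d : R).

(** An explicit radius and remainder turn the later limit arguments into inequalities that [lra] can
    close. *)
Lemma is_derive_epsP F t d : is_derive t 1 F d <->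
  forall e, 0 < e -> exists2 dl, 0 < dl &
    forall h, `|h| < dl -> `|F (t + h) - F t - d * h| <= e * `|h|.
Proof.
split=> [[dF vF] e e0|H].
  have /derivable_nbhs/eqaddoP/(_ e e0) := dF.
  move=> /nbhs_ballP[dl /= dl0 Hd]; exists dl => // h hd.
  have := Hd h; rewrite /ball /= sub0r normrN => /(_ hd).
  rewrite /= vF.
  rewrite -[X in `|X| <= _ -> _]/(F (h%:A + t) - (F t + h *: d)) /GRing.scale /=.
  by rewrite mulr1 opprD addrA (addrC h t) (mulrC d).
have lim : (fun h => h^-1 *: ((F \o shift t) (h *: 1) - F t)) @ 0^' --> d.
  apply/cvgrPdist_le => e e0.
  have [dl dl0 Hd] := H e e0.
  near=> h.
  have hd : `|h| < dl.
    near: h; apply: dnbhs0_lt => //.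
  have h0 : h != 0 by near: h; exact: nbhs_dnbhs_neq.
  rewrite /= /GRing.scale /= mulr1.
  have := Hd h hd; rewrite (addrC h t) => Hh.
  have -> : d - h^-1 * (F (t + h) - F t) = - (h^-1 * (F (t + h) - F t - d * h)).
    by field.
  by rewrite normrN normrM normfV ler_pdivrMl ?normr_gt0// (mulrC `|h|).
split; first by apply/cvg_ex; exists d.
exact: cvg_lim.
Unshelve. all: by end_near. Qed.

Lemma is_derive_continuous F t d : is_derive t 1 F d -> {for t, continuous F}.
Proof.
by case=> dF _; apply: differentiable_continuous; exact/derivable1_diffP.
Qed.

Lemma derive_bound F g K a b : a <= b ->
  (forall t, a <= t <= b -> is_derive t 1 F (g t)) ->
  (forall t, a <= t <= b -> `|g t| <= K) -> `|F b - F a| <= K * (b - a).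
Proof.
move=> ab dF gK.
have [||c cab ->] := @MVT_segment R F g a b ab.
- move=> x /itvP xab; apply: dF; by rewrite !xab.
- apply: derivable_within_continuous => x /itvP xab.
  have : is_derive x 1 F (g x) by apply: dF; rewrite !xab.
  by case.
rewrite normrM (ger0_norm (x := b - a)) ?subr_ge0//.
by apply: ler_wpM2r; rewrite ?subr_ge0// gK// !(itvP cab).
Qed.

Lemma antiderivative_segment g N : 0 < N -> continuous g ->
  exists P : R -> R, forall t, - N < t < N -> is_derive t 1 P (g t).
Proof.
move=> N0 cg.
have gi : lebesgue_measure.-integrable `[- N, N] (EFin \o g).
  apply: continuous_compact_integrable; first exact: segment_compact.
  exact: continuous_subspaceT.
exists (fun x => (\int[lebesgue_measure]_(t in [set` `[(- N), x]]) g t)%R).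
move=> t /andP[t1 t2].
have [d1 d2] := continuous_FTC1_closed t2 gi t1 (cg t).
by split; [exact: d1|rewrite -derive1E; exact: d2].
Qed.

(** The fundamental theorem of calculus works on a segment. The antiderivatives on the intervals
    []-N, N[], normalized to vanish at 0, agree on overlaps because their difference has derivative
    0, so they glue. *)
Lemma antiderivative g : continuous g ->
  exists P : R -> R, forall t, is_derive t 1 P (g t).
Proof.
move=> cg.
have /choice[Q HQ] : forall N : R, exists P : R -> R, 0 < N ->
    P 0 = 0 /\ forall t, - N < t < N -> is_derive t 1 P (g t).
  move=> N; have [N0|N0] := ltP 0 N; last by exists (cst 0).
  have [P HP] := antiderivative_segment N0 cg.
  exists (fun x => P x - P 0) => _; rewrite subrr; split=> // t tN.
  have dP := HP t tN.
  have -> : g t = g t - 0 by rewrite subr0.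
  exact: is_deriveB.
have QQ M N y : 0 < M -> 0 < N -> `|y| < M -> `|y| < N -> Q M y = Q N y.
  move=> M0 N0; rewrite !ltr_norml => /andP[yM1 yM2] /andP[yN1 yN2].
  have [QM0 dM] := HQ M M0; have [QN0 dN] := HQ N N0.
  have dz t : - M < t < M -> - N < t < N -> is_derive t 1 (Q M - Q N) 0.
    move=> tM tN; have d1 := dM _ tM; have d2 := dN _ tN.
    by rewrite -(subrr (g t)); exact: is_deriveB.
  apply/eqP; rewrite -subr_eq0 -normr_le0.
  have z0 : (Q M - Q N) 0 = 0.
    by rewrite -[LHS]/(Q M 0 - Q N 0) QM0 QN0 subrr.
  have [y0|y0] := leP 0 y.
    have := @derive_bound (Q M - Q N) (cst 0) 0 0 y y0.
    rewrite z0 subr0 mul0r; apply => t.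
      by move=> /andP[t1 t2]; apply: dz; lra.
    by rewrite normr0.
  have := @derive_bound (Q M - Q N) (cst 0) 0 y 0 (ltW y0).
  rewrite z0 sub0r normrN mul0r; apply => t.
    by move=> /andP[t1 t2]; apply: dz; lra.
  by rewrite normr0.
(* The radius [|x| + 1] always covers [x], but it varies with [x]. Within distance 1 of [t] it can
   be traded for the fixed radius [|t| + 2]. *)
exists (fun x => Q (`|x| + 1) x) => t.
have N0 : 0 < `|t| + 2 by rewrite ltr_wpDl.
have [_ dN] := HQ _ N0.
have tN : - (`|t| + 2) < t < `|t| + 2.
  by have := ler_norm t; have := ler_norm (- t); rewrite normrN; lra.
have dt := dN _ tN.
apply: (near_eq_is_derive _ dt).
near=> y.
have yt : `|t - y| < 1 by near: y; apply/nbhs_ballP; exists 1; rewrite /=.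
have yt' : `|y| < `|t| + 1.
  have -> : y = t - (t - y) by ring.
  by rewrite (le_lt_trans (ler_normB _ _))// ltrD2l.
apply: QQ => //; try lra.
by rewrite ltr_wpDl.
Unshelve. all: by end_near. Qed.

End RealVariable.

(** * One complex variable *)

Section ComplexPath.
Variable R : realType.
Local Notation C := R[i].
Local Notation normc := (@Normc.normc R).
Local Notation Re := (@complex.Re R).
Local Notation Im := (@complex.Im R).
Implicit Types (P g : R -> C) (t : R) (d z : C) (f : C -> C).

(** Componentwise, so that calculus along a real path reduces to the real case; [cder] below is
    genuine complex differentiability. Both use the real-valued modulus [normc], to stay within real
    linear arithmetic. *)
Definition rder P t d :=
  is_derive t 1 (fun s => Re (P s)) (Re d) /\ is_derive t 1 (fun s => Im (P s)) (Im d).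

Definition rcts g := continuous (fun s => Re (g s)) /\ continuous (fun s => Im (g s)).

Definition ccts f z := forall e, 0 < e -> exists2 dl, 0 < dl &
  forall h, normc h < dl -> normc (f (z + h) - f z) <= e.

Definition cder f z d := forall e, 0 < e -> exists2 dl, 0 < dl &
  forall h, normc h < dl -> normc (f (z + h) - f z - d * h) <= e * normc h.

Lemma ReD (a b : C) : Re (a + b) = Re a + Re b. Proof. by case: a; case: b. Qed.
Lemma ImD (a b : C) : Im (a + b) = Im a + Im b. Proof. by case: a; case: b. Qed.
Lemma ReN (a : C) : Re (- a) = - Re a. Proof. by case: a. Qed.
Lemma ImN (a : C) : Im (- a) = - Im a. Proof. by case: a. Qed.
Lemma ReB (a b : C) : Re (a - b) = Re a - Re b. Proof. by case: a; case: b. Qed.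
Lemma ImB (a b : C) : Im (a - b) = Im a - Im b. Proof. by case: a; case: b. Qed.
Lemma ReM (a b : C) : Re (a * b) = Re a * Re b - Im a * Im b.
Proof. by case: a; case: b. Qed.
Lemma ImM (a b : C) : Im (a * b) = Re a * Im b + Im a * Re b.
Proof. by case: a; case: b. Qed.
Definition ReImE := (ReD, ImD, ReN, ImN, ReM, ImM).

Lemma eqC (a b : C) : Re a = Re b -> Im a = Im b -> a = b.
Proof. by case: a; case: b => /= ? ? ? ? -> ->. Qed.

Lemma normc_ge0 z : 0 <= normc z. Proof. by case: z => a b; exact: sqrtr_ge0. Qed.
Lemma Re_le_normc z : `|Re z| <= normc z.
Proof.
case: z => a b /=; rewrite -[leLHS]ger0_norm// -ler_sqr ?nnegrE ?sqrtr_ge0//.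
by rewrite sqr_sqrtr ?addr_ge0 ?sqr_ge0// normr_id real_normK ?num_real// lerDl sqr_ge0.
Qed.
Lemma Im_le_normc z : `|Im z| <= normc z.
Proof.
case: z => a b /=; rewrite -[leLHS]ger0_norm// -ler_sqr ?nnegrE ?sqrtr_ge0//.
by rewrite sqr_sqrtr ?addr_ge0 ?sqr_ge0// normr_id real_normK ?num_real// lerDr sqr_ge0.
Qed.
Lemma normcR (x : R) : normc (x%:C) = `|x|.
Proof. by rewrite /= expr0n addr0 sqrtr_sqr. Qed.
Lemma normcD (a b : C) : normc (a + b) <= normc a + normc b.
Proof. by rewrite -lecR rmorphD; exact: (@ler_normD _ R[i]). Qed.
Lemma normcNC (a : C) : normc (- a) = normc a.
Proof. by case: a => x y /=; rewrite !sqrrN. Qed.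
Lemma normc_leD z : normc z <= `|Re z| + `|Im z|.
Proof.
have -> : z = (Re z)%:C + (Im z)%:C * 'i.
  by case: z => a b; apply: eqC; rewrite !ReImE /=; ring.
apply: (le_trans (normcD _ _)).
rewrite Normc.normcM !normcR.
have -> : normc ('i : C) = 1 by rewrite /= expr0n expr1n add0r sqrtr1.
by rewrite mulr1 !ReImE /= !(mulr0, mul0r, mulr1, subr0, addr0, add0r).
Qed.
Lemma normcB a b : normc (a - b : C) <= normc a + normc b.
Proof. by rewrite (le_trans (normcD _ _))// normcNC. Qed.
Lemma normcMC (a b : C) : normc (a * b) = normc a * normc b.
Proof. exact: Normc.normcM. Qed.
Lemma normc_eq0 z : normc z <= 0 -> z = 0.
Proof. by move=> h; apply: Normc.eq0_normc; apply/eqP; rewrite eq_le h normc_ge0. Qed.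
Lemma normc_00 : normc (0 : C) = 0. Proof. by rewrite -[0]/(0%:C) normcR normr0. Qed.

Lemma rder_epsP P t d : rder P t d <-> forall e, 0 < e -> exists2 dl, 0 < dl &
  forall h : R, `|h| < dl -> normc (P (t + h) - P t - d * h%:C) <= e * `|h|.
Proof.
split=> [[/is_derive_epsP d1 /is_derive_epsP d2] e e0|H].
  have e20 : 0 < e / 2 by lra.
  have [l1 l10 H1] := d1 _ e20; have [l2 l20 H2] := d2 _ e20.
  exists (Num.min l1 l2); first by rewrite lt_min l10.
  move=> h; rewrite lt_min => /andP[h1 h2].
  apply: (le_trans (normc_leD _)).
  have := H1 _ h1; have := H2 _ h2.
  rewrite !ReImE /= !(mulr0, mul0r, oppr0, addr0, add0r); lra.
by split; apply/is_derive_epsP => e e0; have [l l0 Hl] := H _ e0; exists l => // h hl;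
  apply: le_trans (Hl _ hl);
  [apply: le_trans (Re_le_normc _)|apply: le_trans (Im_le_normc _)];
  rewrite !ReImE /= !(mulr0, mul0r, oppr0, addr0, add0r).
Qed.

Lemma rder_cts P t d : rder P t d -> forall e, 0 < e -> exists2 dl, 0 < dl &
  forall h : R, `|h| < dl -> normc (P (t + h) - P t) <= e.
Proof.
move=> /rder_epsP/(_ 1 ltr01)[l l0 H] e e0.
have k0 : 0 < normc d + 1 by have := normc_ge0 d; lra.
exists (Num.min l (e / (normc d + 1))); first by rewrite lt_min l0 divr_gt0.
move=> h; rewrite lt_min => /andP[hl]; rewrite ltr_pdivlMr// => he.
have -> : P (t + h) - P t = (P (t + h) - P t - d * h%:C) + d * h%:C by ring.
apply: (le_trans (normcD _ _)); rewrite normcMC normcR.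
by have := H _ hl; lra.
Qed.

Lemma rder_comp f P t d d' : rder P t d -> cder f (P t) d' ->
  rder (fun s => f (P s)) t (d' * d).
Proof.
move=> dP df; apply/rder_epsP => e e0.
(* The two errors add up to at most [e1 * K * |h|]: one is [e1] times the Lipschitz constant
   [normc d + 1] of the path (valid since [e1 <= 1]), the other is [normc d'] times the error of the
   path. *)
pose K := normc d + normc d' + 1.
have K0 : 0 < K by rewrite /K; have := normc_ge0 d; have := normc_ge0 d'; lra.
pose e1 := Num.min 1 (e / (2 * K)).
have e10 : 0 < e1 by rewrite lt_min ltr01 divr_gt0// mulr_gt0.
have e1K : e1 * K <= e / 2.
  have : e1 <= e / (2 * K) by rewrite ge_min lexx orbT.
  by rewrite -(ler_pM2r K0) => /le_trans; apply; rewrite le_eqVlt; apply/orP; left;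
    apply/eqP; field; rewrite gt_eqF.
have e11 : e1 <= 1 by rewrite ge_min lexx.
have [l1 l10 H1] := df _ e10.
have [l2 l20 H2] := (rder_epsP _ _ _).1 dP _ e10.
have l120 : 0 < l1 / 2 by lra.
have [l3 l30 H3] := rder_cts dP l120.
exists (Num.min l2 l3); first by rewrite lt_min l20.
move=> h; rewrite lt_min => /andP[h2 h3].
have A := H2 _ h2.
have B := H1 (P (t + h) - P t).
have {}B : normc (f (P (t + h)) - f (P t) - d' * (P (t + h) - P t))
   <= e1 * normc (P (t + h) - P t).
  have := B (le_lt_trans (H3 _ h3) _); rewrite (addrC (P t)) subrK; apply; lra.
have D : normc (P (t + h) - P t) <= (normc d + 1) * `|h|.
  have -> : P (t + h) - P t = (P (t + h) - P t - d * h%:C) + d * h%:C by ring.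
  apply: (le_trans (normcD _ _)); rewrite normcMC normcR mulrDl addrC lerD2l.
  by apply: (le_trans A); exact: ler_wpM2r.
have -> : f (P (t + h)) - f (P t) - d' * d * h%:C =
  (f (P (t + h)) - f (P t) - d' * (P (t + h) - P t)) +
  d' * (P (t + h) - P t - d * h%:C) by ring.
apply: (le_trans (normcD _ _)); rewrite normcMC.
have E1 : e1 * normc (P (t + h) - P t) <= e1 * ((normc d + 1) * `|h|).
  by apply: ler_wpM2l => //; exact: ltW.
have E2 : normc d' * normc (P (t + h) - P t - d * h%:C) <= normc d' * (e1 * `|h|).
  by apply: ler_wpM2l => //; exact: normc_ge0.
have E3 : e1 * K * `|h| <= e / 2 * `|h| by exact: ler_wpM2r.
have h0 := normr_ge0 h.
have : e / 2 * `|h| <= e * `|h| by apply: ler_wpM2r => //; lra.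
move: E3; rewrite /K; lra.
Qed.

Lemma rder_cst z t : rder (cst z) t 0.
Proof. by split; exact: is_derive_cst. Qed.

Lemma rderD P1 P2 t d1 d2 : rder P1 t d1 -> rder P2 t d2 ->
  rder (fun s => P1 s + P2 s) t (d1 + d2).
Proof.
move=> [a1 b1] [a2 b2]; split; rewrite !ReImE.
  have -> : (fun s => Re (P1 s + P2 s)) = (fun s => Re (P1 s)) + (fun s => Re (P2 s)).
    by apply/funext => s; rewrite ReD.
  exact: is_deriveD.
have -> : (fun s => Im (P1 s + P2 s)) = (fun s => Im (P1 s)) + (fun s => Im (P2 s)).
  by apply/funext => s; rewrite ImD.
exact: is_deriveD.
Qed.

Lemma rderM P1 P2 t d1 d2 : rder P1 t d1 -> rder P2 t d2 ->
  rder (fun s => P1 s * P2 s) t (d1 * P2 t + P1 t * d2).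
Proof.
move=> [a1 b1] [a2 b2]; split; rewrite !ReImE.
  have -> : (fun s => Re (P1 s * P2 s)) = (fun s => Re (P1 s)) * (fun s => Re (P2 s))
      - (fun s => Im (P1 s)) * (fun s => Im (P2 s)).
    by apply/funext => s; rewrite ReM.
  apply: is_derive_eq; rewrite /GRing.scale /=; ring.
have -> : (fun s => Im (P1 s * P2 s)) = (fun s => Re (P1 s)) * (fun s => Im (P2 s))
    + (fun s => Im (P1 s)) * (fun s => Re (P2 s)).
  by apply/funext => s; rewrite ImM.
apply: is_derive_eq; rewrite /GRing.scale /=; ring.
Qed.

Lemma rderZ z P t d : rder P t d -> rder (fun s => z * P s) t (z * d).
Proof. by move=> dP; have := rderM (rder_cst z t) dP; rewrite mul0r add0r. Qed.

Lemma rderN P t d : rder P t d -> rder (fun s => - P s) t (- d).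
Proof.
move=> dP; rewrite (_ : (fun s => - P s) = (fun s => -1 * P s)).
  by rewrite -(mulN1r d); exact: rderZ.
by apply/funext => s; rewrite mulN1r.
Qed.

Lemma rderB P1 P2 t d1 d2 : rder P1 t d1 -> rder P2 t d2 ->
  rder (fun s => P1 s - P2 s) t (d1 - d2).
Proof. by move=> h1 h2; exact: rderD h1 (rderN h2). Qed.

Lemma rder_real (F : R -> R) t (d : R) : is_derive t 1 F d ->
  rder (fun s => (F s)%:C) t d%:C.
Proof. by move=> dF; split => //=; exact: is_derive_cst. Qed.

Lemma rder_line z z' t : rder (fun s => z + s%:C * z') t z'.
Proof.
have D := rderM (rder_real (is_derive_id t 1)) (rder_cst z' t).
by have := rderD (rder_cst z t) D; rewrite add0r mul1r mulr0 addr0.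
Qed.

(** Real and imaginary parts are bounded separately by the mean value theorem. This costs the factor
    2 that recurs in all later constants. *)
Lemma rder_bound P g K a b : a <= b ->
  (forall t, a <= t <= b -> rder P t (g t)) ->
  (forall t, a <= t <= b -> normc (g t) <= K) -> normc (P b - P a) <= 2 * K * (b - a).
Proof.
move=> ab dP gK.
have A := @derive_bound R (fun s => Re (P s)) (fun s => Re (g s)) K a b ab
  (fun t h => (dP t h).1) (fun t h => le_trans (Re_le_normc _) (gK t h)).
have B := @derive_bound R (fun s => Im (P s)) (fun s => Im (g s)) K a b ab
  (fun t h => (dP t h).2) (fun t h => le_trans (Im_le_normc _) (gK t h)).
by apply: (le_trans (normc_leD _)); rewrite ReB ImB; lra.
Qed.

Lemma rcts_epsP g : rcts g <-> forall t e, 0 < e -> exists2 dl, 0 < dl &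
  forall h : R, `|h| < dl -> normc (g (t + h) - g t) <= e.
Proof.
have T (F : R -> R) : continuous F <-> forall t e, 0 < e -> exists2 dl, 0 < dl &
  forall h : R, `|h| < dl -> `|F (t + h) - F t| <= e.
  split=> [cF t e e0|H t].
    have /cvgrPdist_le/(_ e e0)/nbhs_ballP[dl /= dl0 Hd] := cF t.
    exists dl => // h hd; rewrite distrC; apply: Hd.
    by rewrite /ball /= opprD addrA subrr sub0r normrN.
  apply/cvgrPdist_le => e e0; have [dl dl0 Hd] := H t _ e0.
  apply/nbhs_ballP; exists dl => //= y; rewrite /ball /= distrC => ty.
  by have := Hd _ ty; rewrite distrC (addrC t) subrK.
split=> [[/T c1 /T c2] t e e0|H].
  have e20 : 0 < e / 2 by lra.
  have [l1 l10 H1] := c1 t _ e20; have [l2 l20 H2] := c2 t _ e20.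
  exists (Num.min l1 l2); first by rewrite lt_min l10.
  move=> h; rewrite lt_min => /andP[h1 h2].
  by apply: (le_trans (normc_leD _)); rewrite ReB ImB; have := H1 _ h1; have := H2 _ h2; lra.
by split; apply/T => t e e0; have [l l0 Hl] := H t _ e0; exists l => // h hl;
  apply: le_trans (Hl _ hl); rewrite -?ReB -?ImB;
  [exact: Re_le_normc|exact: Im_le_normc].
Qed.

Lemma antiderivativeC g : rcts g -> exists P, forall t, rder P t (g t).
Proof.
move=> [/antiderivative[P HP] /antiderivative[Q HQ]].
by exists (fun t => P t +i* Q t) => t; split; [exact: HP|exact: HQ].
Qed.

(** A chosen antiderivative, with the junk value 0 when none exists. Integrals of complex paths are
    its increments, so additivity over intervals and antisymmetry need no continuity. *)
Definition prim g : R -> C :=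
  if pselect (exists P, forall t, rder P t (g t)) is left H
  then projT1 (cid H) else cst 0.

Lemma primP g t : rcts g -> rder (prim g) t (g t).
Proof.
move=> cg; rewrite /prim; case: pselect => [H|/(_ (antiderivativeC cg))//].
by case: cid.
Qed.

Definition Int g (a b : R) : C := prim g b - prim g a.

Lemma Int_chasles g a b c : Int g a b + Int g b c = Int g a c.
Proof. by rewrite /Int addrC addrA subrK. Qed.

Lemma Int_sym g a b : Int g b a = - Int g a b.
Proof. by rewrite /Int opprB. Qed.

(** Unordered endpoints, because the rectangles below may have sides of either sign. *)
Definition between (a b t : R) := (Num.min a b <= t <= Num.max a b).

Lemma betweenC a b t : between a b t = between b a t.
Proof. by rewrite /between minC maxC. Qed.

Lemma between_le a b t : a <= b -> between a b t = (a <= t <= b).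
Proof. by move=> ab; rewrite /between min_l// max_r. Qed.

Lemma Int_FTC g P a b : rcts g -> (forall t, between a b t -> rder P t (g t)) ->
  Int g a b = P b - P a.
Proof.
move=> cg; wlog ab : a b / a <= b.
  move=> W; have [ab|ab] := leP a b; first exact: W.
  move=> H; rewrite Int_sym (W _ _ (ltW ab)) ?opprB// => t; rewrite betweenC.
  exact: H.
move=> H; apply/eqP; rewrite -subr_eq0; apply/eqP/normc_eq0.
have -> : Int g a b - (P b - P a) = (prim g b - P b) - (prim g a - P a).
  by rewrite /Int; ring.
have := @rder_bound (fun s => prim g s - P s) (cst 0) 0 a b ab.
rewrite mulr0 mul0r; apply => t tab; last by rewrite normc_00.
rewrite /cst -(subrr (g t)); apply: rderB; first exact: primP.
by apply: H; rewrite between_le.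
Qed.

Lemma Int_bound g K a b : rcts g -> (forall t, between a b t -> normc (g t) <= K) ->
  normc (Int g a b) <= 2 * K * `|b - a|.
Proof.
move=> cg; wlog ab : a b / a <= b.
  move=> W; have [ab|ab] := leP a b; first exact: W.
  move=> H; rewrite Int_sym normcNC distrC W ?(ltW ab)// => t; rewrite betweenC.
  exact: H.
move=> H; rewrite ger0_norm ?subr_ge0//; apply: (@rder_bound _ g) => // t tab.
  exact: primP.
by apply: H; rewrite between_le.
Qed.

Lemma rctsD g1 g2 : rcts g1 -> rcts g2 -> rcts (fun t => g1 t + g2 t).
Proof.
move=> /rcts_epsP c1 /rcts_epsP c2; apply/rcts_epsP => t e e0.
have e20 : 0 < e / 2 by lra.
have [l1 l10 H1] := c1 t _ e20; have [l2 l20 H2] := c2 t _ e20.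
exists (Num.min l1 l2); first by rewrite lt_min l10.
move=> h; rewrite lt_min => /andP[h1 h2].
have -> : g1 (t + h) + g2 (t + h) - (g1 t + g2 t) =
  (g1 (t + h) - g1 t) + (g2 (t + h) - g2 t) by ring.
by apply: (le_trans (normcD _ _)); have := H1 _ h1; have := H2 _ h2; lra.
Qed.

Lemma rctsM g1 g2 : rcts g1 -> rcts g2 -> rcts (fun t => g1 t * g2 t).
Proof.
move=> [a1 b1] [a2 b2]; split => t.
  rewrite (_ : (fun s => _) = (fun s => Re (g1 s)) * (fun s => Re (g2 s))
      - (fun s => Im (g1 s)) * (fun s => Im (g2 s))); last first.
    by apply/funext => s; rewrite ReM.
  by apply: continuousB; apply: continuousM; [exact: a1|exact: a2|exact: b1|exact: b2].
rewrite (_ : (fun s => _) = (fun s => Re (g1 s)) * (fun s => Im (g2 s))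
    + (fun s => Im (g1 s)) * (fun s => Re (g2 s))); last first.
  by apply/funext => s; rewrite ImM.
by apply: continuousD; apply: continuousM; [exact: a1|exact: b2|exact: b1|exact: a2].
Qed.

Lemma rcts_cst z : rcts (cst z).
Proof. by split => t; exact: cvg_cst. Qed.

Lemma rder_rcts P : (forall t, exists d, rder P t d) -> rcts P.
Proof. by move=> H; split => t; have [d [d1 d2]] := H t; [move: d1|move: d2] => /is_derive_continuous. Qed.

Lemma rctsB g1 g2 : rcts g1 -> rcts g2 -> rcts (fun t => g1 t - g2 t).
Proof.
move=> c1 c2; rewrite (_ : (fun t => _) = fun t => g1 t + (-1) * g2 t).
  by apply: rctsD => //; apply: rctsM => //; exact: rcts_cst.
by apply/funext => t; rewrite mulN1r.
Qed.

Lemma IntZ z g a b : rcts g -> Int (fun t => z * g t) a b = z * Int g a b.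
Proof.
move=> c; rewrite (@Int_FTC _ (fun t => z * prim g t)).
- by rewrite /Int; ring.
- by apply: rctsM => //; exact: rcts_cst.
- by move=> t _; apply: rderZ; exact: primP.
Qed.

Lemma IntB g1 g2 a b : rcts g1 -> rcts g2 ->
  Int (fun t => g1 t - g2 t) a b = Int g1 a b - Int g2 a b.
Proof.
move=> c1 c2; rewrite (@Int_FTC _ (fun t => prim g1 t - prim g2 t)).
- by rewrite /Int; ring.
- exact: rctsB.
- by move=> t _; apply: rderB; exact: primP.
Qed.

Lemma rcts_comp f P : (forall z, ccts f z) -> rcts P -> rcts (fun t => f (P t)).
Proof.
move=> cf /rcts_epsP cP; apply/rcts_epsP => t e e0.
have [l l0 H] := cf (P t) _ e0; have l20 : 0 < l / 2 by lra.
have [k k0 K] := cP t _ l20; exists k => // h hk.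
have := H (P (t + h) - P t); rewrite (addrC (P t)) subrK; apply.
by have := K _ hk; lra.
Qed.

Lemma cder_ccts f z d : cder f z d -> ccts f z.
Proof.
move=> /(_ 1 ltr01)[l l0 H] e e0.
have k0 : 0 < normc d + 1 by have := normc_ge0 d; lra.
exists (Num.min l (e / (normc d + 1))); first by rewrite lt_min l0 divr_gt0.
move=> h; rewrite lt_min => /andP[hl]; rewrite ltr_pdivlMr// => he.
have -> : f (z + h) - f z = (f (z + h) - f z - d * h) + d * h by ring.
apply: (le_trans (normcD _ _)); rewrite normcMC.
by have := H _ hl; lra.
Qed.

Lemma cder_uniq f z d d' : cder f z d -> cder f z d' -> d = d'.
Proof.
move=> D D'; apply/eqP; rewrite -subr_eq0; apply/eqP/normc_eq0.
rewrite leNgt; apply/negP => p0; have e0 : 0 < normc (d - d') / 3 by lra.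
have [l l0 H] := D _ e0; have [l' l0' H'] := D' _ e0.
pose m := Num.min l l' / 2.
have m0 : 0 < m by rewrite divr_gt0// lt_min l0.
have nm : normc (m%:C) = m by rewrite normcR gtr0_norm.
have ml : m < l /\ m < l'.
  have : Num.min l l' <= l by rewrite ge_min lexx.
  have : Num.min l l' <= l' by rewrite ge_min lexx orbT.
  by move: m0; rewrite /m; lra.
have A := H m%:C; have B := H' m%:C; rewrite !nm in A B.
have {}A := A ml.1; have {}B := B ml.2.
have : normc ((d - d') * m%:C) <= 2 / 3 * normc (d - d') * m.
  have -> : (d - d') * m%:C = (f (z + m%:C) - f z - d' * m%:C) -
     (f (z + m%:C) - f z - d * m%:C) by ring.
  by apply: (le_trans (normcB _ _)); lra.
rewrite normcMC nm.
have : 0 < normc (d - d') * m by rewrite mulr_gt0.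
lra.
Qed.

Lemma cder_loc f f' z d : (exists2 l, 0 < l & forall h, normc h < l -> f (z + h) = f' (z + h)) ->
  cder f z d -> cder f' z d.
Proof.
move=> [l l0 H] D e e0; have [k k0 K] := D _ e0.
exists (Num.min l k); first by rewrite lt_min l0.
move=> h; rewrite lt_min => /andP[hl hk].
by rewrite -H// -[z in f' z]addr0 -H ?normc_00// addr0; exact: K.
Qed.

End ComplexPath.

(** * Goursat's theorem and primitives on squares *)

Section Goursat.
Variable R : realType.
Local Notation C := R[i].
Local Notation normc := (@Normc.normc R).
Local Notation Re := (@complex.Re R).
Local Notation Im := (@complex.Im R).
Implicit Types (f F : C -> C) (x y a b c d r : R).

(** Squares replace discs: they suit integration along axis-parallel segments, and clamping each
    coordinate retracts the plane onto them. *)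
Definition Sq r (z : C) := (`|Re z| < r) && (`|Im z| < r).

Definition Hor f y a b := Int (fun t => f (t +i* y)) a b.
Definition Ver f x c d := Int (fun t => f (x +i* t)) c d.
Definition Rect f x x' y y' :=
  Hor f y x x' - Hor f y' x x' + 'i * Ver f x' y y' - 'i * Ver f x y y'.

Lemma rder_hor y t : rder (fun s => s +i* y : C) t 1.
Proof. by split => /=; [exact: is_derive_id|exact: is_derive_cst]. Qed.

Lemma rder_ver x t : rder (fun s => x +i* s : C) t 'i.
Proof. by split => /=; [exact: is_derive_cst|exact: is_derive_id]. Qed.

Lemma rcts_hor f y : (forall z, ccts f z) -> rcts (fun t => f (t +i* y)).
Proof. by move=> cf; apply: rcts_comp => //; apply: rder_rcts => t; exists 1; exact: rder_hor. Qed.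

Lemma rcts_ver f x : (forall z, ccts f z) -> rcts (fun t => f (x +i* t)).
Proof. by move=> cf; apply: rcts_comp => //; apply: rder_rcts => t; exists 'i; exact: rder_ver. Qed.

Lemma cctsB f F z : ccts f z -> ccts F z -> ccts (fun w => f w - F w) z.
Proof.
move=> cf cF e e0; have e20 : 0 < e / 2 by lra.
have [l l0 H] := cf _ e20; have [k k0 K] := cF _ e20.
exists (Num.min l k); first by rewrite lt_min l0.
move=> h; rewrite lt_min => /andP[/H hl /K hk].
have -> : f (z + h) - F (z + h) - (f z - F z) = f (z + h) - f z - (F (z + h) - F z) by ring.
by apply: (le_trans (normcB _ _)); lra.
Qed.

Lemma Hor_FTC f F y a b : (forall z, ccts f z) ->
  (forall t, between a b t -> cder F (t +i* y) (f (t +i* y))) ->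
  Hor f y a b = F (b +i* y) - F (a +i* y).
Proof.
move=> cf dF; rewrite /Hor (@Int_FTC _ _ (fun t => F (t +i* y)))//; first exact: rcts_hor.
by move=> t tab; rewrite -[f _]mulr1; apply: rder_comp; [exact: rder_hor|exact: dF].
Qed.

Lemma Ver_FTC f F x a b : (forall z, ccts f z) ->
  (forall t, between a b t -> cder F (x +i* t) (f (x +i* t))) ->
  'i * Ver f x a b = F (x +i* b) - F (x +i* a).
Proof.
move=> cf dF; rewrite /Ver -IntZ; last exact: rcts_ver.
rewrite (@Int_FTC _ _ (fun t => F (x +i* t)))//.
  by apply: rctsM; [exact: rcts_cst|exact: rcts_ver].
by move=> t tab; rewrite mulrC; apply: rder_comp; [exact: rder_ver|exact: dF].
Qed.

Lemma Rect_primitive f F x x' y y' : (forall z, ccts f z) ->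
  (forall z, cder F z (f z)) -> Rect f x x' y y' = 0.
Proof.
by move=> cf dF; rewrite /Rect !(@Hor_FTC _ F)// !(@Ver_FTC _ F)//; ring.
Qed.

Lemma cder_quad (c d z : C) : cder (fun w => c * w + d * w * w / 2) z (c + d * z).
Proof.
have n0 := normc_ge0 d => e e0.
exists (e / (normc d + 1)); first by rewrite divr_gt0//; lra.
move=> h; rewrite ltr_pdivlMr; last by lra.
move=> he.
have -> : c * (z + h) + d * (z + h) * (z + h) / 2 - (c * z + d * z * z / 2)
   - (c + d * z) * h = 2^-1 * (d * h) * h by field.
rewrite !normcMC; apply: ler_wpM2r; first exact: normc_ge0.
have -> : normc (2^-1 : C) = 2^-1.
  have -> : (2^-1 : C) = (2^-1)%:C by rewrite fmorphV rmorph_nat.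
  by rewrite normcR gtr0_norm// invr_gt0.
have nh := normc_ge0 h; have nn : 0 <= normc d * normc h by exact: mulr_ge0.
lra.
Qed.

(** An affine function has the quadratic primitive of [cder_quad]. In Goursat's argument this
    removes the first-order Taylor polynomial from a contour integral. *)
Lemma Rect_affine (c d : C) x x' y y' : Rect (fun z => c + d * z) x x' y y' = 0.
Proof.
apply: (@Rect_primitive (fun z => c + d * z) (fun w => c * w + d * w * w / 2)) => z;
  last exact: cder_quad.
apply: (@cder_ccts _ _ _ d) => e e0; exists 1 => // h _.
have -> : c + d * (z + h) - (c + d * z) - d * h = 0 by ring.
by rewrite normc_00 mulr_ge0// ?normc_ge0// ltW.
Qed.

Lemma RectB f F x x' y y' : (forall z, ccts f z) -> (forall z, ccts F z) ->
  Rect (fun z => f z - F z) x x' y y' = Rect f x x' y y' - Rect F x x' y y'.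
Proof.
move=> cf cF; rewrite /Rect /Hor /Ver !IntB; first by ring.
all: by [exact: rcts_hor|exact: rcts_ver].
Qed.

Lemma normci : normc ('i : C) = 1.
Proof. by rewrite /= expr0n expr1n add0r sqrtr1. Qed.

(** Each direction has two sides, and each side contributes the factor 2 of [Int_bound]. *)
Lemma Rect_bound f K x x' y y' : (forall z, ccts f z) ->
  (forall s t, between x x' s -> between y y' t -> normc (f (s +i* t)) <= K) ->
  normc (Rect f x x' y y') <= 4 * K * (`|x' - x| + `|y' - y|).
Proof.
move=> cf fK; rewrite /Rect.
have bl (p q : R) : between p q p by rewrite /between ge_min le_max lexx.
have br (p q : R) : between p q q by rewrite /between ge_min le_max lexx !orbT.
apply: (le_trans (normcB _ _)).
apply: le_trans; first by apply: lerD; [exact: normcD|exact: lexx].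
apply: le_trans; first by apply: lerD; [apply: lerD; [exact: normcB|exact: lexx]|exact: lexx].
rewrite !normcMC normci !mul1r.
have h1 := @Int_bound _ _ K x x' (rcts_hor y cf) (fun t h => fK t y h (bl _ _)).
have h2 := @Int_bound _ _ K x x' (rcts_hor y' cf) (fun t h => fK t y' h (br _ _)).
have h3 := @Int_bound _ _ K y y' (rcts_ver x cf) (fun t h => fK x t (bl _ _) h).
have h4 := @Int_bound _ _ K y y' (rcts_ver x' cf) (fun t h => fK x' t (br _ _) h).
rewrite -/(Hor f _ _ _) -/(Ver f _ _ _) in h1 h2 h3 h4.
lra.
Qed.

Lemma Rect_split f x x1 x' y y1 y' :
  Rect f x x' y y' = Rect f x x1 y y1 + Rect f x1 x' y y1 +
                     Rect f x x1 y1 y' + Rect f x1 x' y1 y'.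
Proof.
have H z a b c : Hor f z a c = Hor f z a b + Hor f z b c by rewrite /Hor Int_chasles.
have V z a b c : Ver f z a c = Ver f z a b + Ver f z b c by rewrite /Ver Int_chasles.
rewrite /Rect !(H _ x x1 x') !(V _ y y1 y'); ring.
Qed.

(* [(u, v, s)] stands for the square [u, u + s] x [v, v + s]. *)
Lemma nested_squares (bad : R * R * R -> bool) : bad (0, 0, 1) ->
  (forall u v s, bad (u, v, s) ->
     [|| bad (u, v, s / 2), bad (u + s / 2, v, s / 2), bad (u, v + s / 2, s / 2)
       | bad (u + s / 2, v + s / 2, s / 2)]) ->
  exists us vs : R, [/\ 0 <= us <= 1, 0 <= vs <= 1 & forall e, 0 < e ->
    exists u v s, [/\ 0 < s < e, u <= us <= u + s, v <= vs <= v + s & bad (u, v, s)]].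
Proof.
move=> bad0 badS.
pose next (p : R * R * R) := let: (u, v, s) := p in
  if bad (u, v, s / 2) then (u, v, s / 2) else
  if bad (u + s / 2, v, s / 2) then (u + s / 2, v, s / 2) else
  if bad (u, v + s / 2, s / 2) then (u, v + s / 2, s / 2) else
  (u + s / 2, v + s / 2, s / 2).
pose P n := iter n next (0, 0, 1).
pose U n := (P n).1.1; pose V n := (P n).1.2; pose S n := (P n).2.
have PE n : P n = (U n, V n, S n) by rewrite /U /V /S; case: (P n) => -[].
have badP n : bad (P n).
  elim: n => [//|n IH]; rewrite /P iterS -/(P n); move: IH; rewrite PE => /badS/=.
  by case: ifP => // _; case: ifP => // _; case: ifP => //= _.
have SE n : S n = 2^-1 ^+ n.
  elim: n => [//|n IH]; rewrite exprSr -IH /S /P iterS -/(P n) PE /=.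
  by do 3 case: ifP => // _.
have S0 n : 0 < S n by rewrite SE exprn_gt0// invr_gt0.
have US n : U n <= U n.+1 /\ U n.+1 + S n.+1 <= U n + S n.
  have s0 := S0 n; rewrite /U /S /P iterS -/(P n) PE /=.
  by do 3 (case: ifP => _ /=; first by split; lra); split; lra.
have VS n : V n <= V n.+1 /\ V n.+1 + S n.+1 <= V n + S n.
  have s0 := S0 n; rewrite /V /S /P iterS -/(P n) PE /=.
  by do 3 (case: ifP => _ /=; first by split; lra); split; lra.
(* Nested intervals, shared by both coordinates: the supremum of the left ends lies in every
   interval. *)
have T (W : nat -> R) : W 0%N = 0 ->
    (forall n, W n <= W n.+1 /\ W n.+1 + S n.+1 <= W n + S n) ->
    exists2 w, 0 <= w <= 1 & forall n, W n <= w <= W n + S n.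
  move=> W0 WS.
  have M1 n k : W n <= W (n + k)%N.
    by elim: k => [|k IH]; rewrite ?addn0// addnS (le_trans IH)//; exact: (WS _).1.
  have M2 n k : W (n + k)%N + S (n + k)%N <= W n + S n.
    by elim: k => [|k IH]; rewrite ?addn0// addnS (le_trans _ IH)//; exact: (WS _).2.
  have M n m : W n <= W m + S m.
    have [nm|/ltnW mn] := leqP n m.
      by apply: le_trans (M1 n (m - n)%N) _; rewrite subnKC// lerDl ltW.
    by apply: le_trans (M2 m (n - m)%N); rewrite subnKC// lerDl ltW.
  have hs : has_sup (range W).
    by split; [exists (W 0%N), 0%N|exists (W 0%N + S 0%N) => _ [n _ <-]].
  have H n : W n <= sup (range W) <= W n + S n.
    apply/andP; split; first by apply: sup_ubound; [exact: hs.2|exists n].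
    by apply: ge_sup; [exact: hs.1|move=> _ [m _ <-]].
  exists (sup (range W)) => //.
  by have := H 0%N; rewrite W0 SE expr0 add0r.
have [us us01 Hu] := T U erefl US; have [vs vs01 Hv] := T V erefl VS.
exists us, vs; split => // e e0.
have [n _ Hn] : \forall n \near \oo, 2^-1 ^+ n < e.
  have : (fun n => (2^-1 : R) ^+ n) @ \oo --> 0.
    by apply: cvg_expr; rewrite ger0_norm ?invr_ge0// invf_lt1// ltr1n.
  move=> /cvgrPdist_lt/(_ e e0); apply: filterS => n.
  by rewrite sub0r normrN ger0_norm// exprn_ge0// invr_ge0.
exists (U n), (V n), (S n); split => //; last by rewrite -PE.
by rewrite S0 SE Hn/=.
Qed.

(** Bisection: if the contour integral has modulus [K > 0], some quarter carries at least [K / 4],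
    and so on down to squares of parameter side [s] carrying [K * s ^ 2] around a limit point.
    Differentiability there makes the integral smaller than that. Parametrizing by the unit square
    lets [a] and [b] have any sign. *)
Lemma Goursat f (df : C -> C) x y a b :
  (forall z, ccts f z) ->
  (forall u v, 0 <= u <= 1 -> 0 <= v <= 1 -> let z := (x + a * u) +i* (y + b * v) in
     cder f z (df z)) ->
  Rect f x (x + a) y (y + b) = 0.
Proof.
move=> cf dfz; apply: (@normc_eq0 R); rewrite leNgt; apply/negP.
set K := normc _ => K0.
pose Q u v s := Rect f (x + a * u) (x + a * (u + s)) (y + b * v) (y + b * (v + s)).
pose bad (p : R * R * R) := let: (u, v, s) := p in K * s ^+ 2 <= normc (Q u v s).
have [||us [vs [us01 vs01 H]]] := @nested_squares bad.
- by rewrite /bad /Q !mulr0 !addr0 !add0r expr1n !mulr1.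
- move=> u v s; rewrite /bad; apply: contraTT.
  rewrite !negb_or -!ltNge => /and4P[b1 b2 b3 b4].
  rewrite {1}/Q (@Rect_split _ _ (x + a * (u + s / 2)) _ _ (y + b * (v + s / 2))).
  have -> : u + s = u + s / 2 + s / 2 by field.
  have -> : v + s = v + s / 2 + s / 2 by field.
  rewrite -/(Q u v (s / 2)) -/(Q (u + s / 2) v (s / 2)) -/(Q u (v + s / 2) (s / 2))
    -/(Q (u + s / 2) (v + s / 2) (s / 2)).
  have n1 := normcD (Q u v (s / 2) + Q (u + s / 2) v (s / 2) + Q u (v + s / 2) (s / 2))
    (Q (u + s / 2) (v + s / 2) (s / 2)).
  have n2 := normcD (Q u v (s / 2) + Q (u + s / 2) v (s / 2)) (Q u (v + s / 2) (s / 2)).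
  have n3 := normcD (Q u v (s / 2)) (Q (u + s / 2) v (s / 2)).
  have -> : K * s ^+ 2 = 4 * (K * (s / 2) ^+ 2) by field.
  lra.
pose zs := (x + a * us) +i* (y + b * vs).
pose L := `|a| + `|b|.
have L0 : 0 <= L by rewrite addr_ge0.
(* The contour bound will be [4 * e * L ^ 2 * s ^ 2], which this choice puts below [K * s ^ 2]; the
   summand 1 keeps the denominator positive when [L = 0]. *)
pose e := K / (8 * L ^+ 2 + 1).
have L20 : 0 < 8 * L ^+ 2 + 1 by have := sqr_ge0 L; lra.
have e0 : 0 < e by rewrite divr_gt0.
have [l l0 Hl] := dfz _ _ us01 vs01 e e0; rewrite -/zs in Hl.
have lL : 0 < l / (L + 1) by rewrite divr_gt0//; lra.
have [u [v [s [/andP[s0 sl] uu vv]]]] := H _ lL.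
rewrite /bad leNgt => /negP; apply.
(* The Taylor polynomial at the limit point; subtracting it leaves the contour integral
   unchanged. *)
pose A z := (f zs - df zs * zs) + df zs * z.
have cA z : ccts A z.
  apply: (@cder_ccts _ _ _ (df zs)) => e' e'0; exists 1 => // h _.
  rewrite /A (_ : _ - _ - _ = 0); last by ring.
  by rewrite normc_00 mulr_ge0// ?normc_ge0// ltW.
have -> : Q u v s = Rect (fun z => f z - A z)
    (x + a * u) (x + a * (u + s)) (y + b * v) (y + b * (v + s)).
  by rewrite RectB// /A Rect_affine subr0.
have bd (p q t w w' : R) : w <= w' <= w + s -> between (p + q * w) (p + q * (w + s)) t ->
    `|t - (p + q * w')| <= `|q| * s.
  move=> ww; rewrite /between ge_min le_max => tt.
  have [q0|q0] := leP 0 q.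
    rewrite (ger0_norm q0).
    have q1 : q * w <= q * w' by rewrite ler_wpM2l//; lra.
    have q2 : q * w' <= q * (w + s) by rewrite ler_wpM2l//; lra.
    by rewrite ler_norml; move: tt; rewrite mulrDr; lra.
  rewrite (ltr0_norm q0).
  have q1 : q * w' <= q * w by rewrite ler_wnM2l//; lra.
  have q2 : q * (w + s) <= q * w' by rewrite ler_wnM2l//; lra.
  by rewrite ler_norml; move: tt; rewrite mulrDr; lra.
have RB : normc (Rect (fun z => f z - A z)
    (x + a * u) (x + a * (u + s)) (y + b * v) (y + b * (v + s)))
   <= 4 * (e * (L * s)) * (`|x + a * (u + s) - (x + a * u)| + `|y + b * (v + s) - (y + b * v)|).
  apply: Rect_bound => [z|p q hp hq]; first exact: cctsB.
  have hD : normc (p +i* q - zs) <= L * s.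
    apply: (le_trans (normc_leD _)).
    by rewrite /L mulrDl; apply: lerD; [exact: bd hp|exact: bd hq].
  have hl : normc (p +i* q - zs) < l.
    apply: (le_lt_trans hD); move: sl; rewrite ltr_pdivlMr; last by lra.
    by move: s0; lra.
  have := Hl _ hl; rewrite (addrC zs) subrK => h1.
  rewrite (_ : f _ - A _ = f (p +i* q) - f zs - df zs * (p +i* q - zs)); last by rewrite /A; ring.
  apply: (le_trans h1); apply: ler_wpM2l => //; exact: ltW.
apply: (le_lt_trans RB).
have -> : x + a * (u + s) - (x + a * u) = a * s by ring.
have -> : y + b * (v + s) - (y + b * v) = b * s by ring.
rewrite !normrM (gtr0_norm s0) -mulrDl -/L.
have -> : 4 * (e * (L * s)) * (L * s) = e * (4 * L ^+ 2) * s ^+ 2 by ring.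
rewrite ltr_pM2r ?exprn_gt0// /e mulrAC ltr_pdivrMr// ltr_pM2l//.
by have := sqr_ge0 L; lra.
Qed.

(** The primitive integrates [f] from 0 horizontally to [Re z], then vertically to [z]. Goursat lets
    the increment from [z] to [z + h] be computed along two short segments starting at [z]. *)
Lemma holomorphic_primitive f (df : C -> C) r : (forall z, ccts f z) ->
  (forall z, Sq r z -> cder f z (df z)) ->
  exists F, forall z, Sq r z -> cder F z (f z).
Proof.
move=> cf dfz.
have R0 x x' y y' : `|x| < r -> `|x'| < r -> `|y| < r -> `|y'| < r -> Rect f x x' y y' = 0.
  move=> x1 x2 y1 y2.
  have -> : x' = x + (x' - x) by ring.
  have -> : y' = y + (y' - y) by ring.
  apply: (@Goursat _ df) => // u v u01 v01; apply: dfz.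
  have cv p q w : `|p| < r -> `|q| < r -> 0 <= w <= 1 -> `|p + (q - p) * w| < r.
    move=> hp hq /andP[w0 w1].
    have -> : p + (q - p) * w = (1 - w) * p + w * q by ring.
    apply: (le_lt_trans (ler_normD _ _)); rewrite !normrM (ger0_norm w0) ger0_norm ?subr_ge0//.
    have h1 : w * `|q| <= w * r by rewrite ler_wpM2l// ltW.
    have [w10|w1'] := ltP 0 (1 - w).
      have : (1 - w) * `|p| < (1 - w) * r by rewrite ltr_pM2l.
      lra.
    have -> : w = 1 by lra.
    by rewrite subrr mul0r add0r mul1r.
  by rewrite /Sq /= !cv.
exists (fun z => Hor f 0 0 (Re z) + 'i * Ver f (Re z) 0 (Im z)) => -[x y] /= /andP[/= xr yr].
move=> e e0; have e40 : 0 < e / 4 by lra.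
have [l l0 Hl] := cf (x +i* y) _ e40.
pose k := Num.min l (r - `|x|).
have k0 : 0 < k by rewrite lt_min l0 subr_gt0.
exists (k / 2); first by rewrite divr_gt0.
move=> [h1 h2] hk /=.
have n1 := Re_le_normc (h1 +i* h2); have n2 := Im_le_normc (h1 +i* h2); rewrite /= in n1 n2.
have hl : normc (h1 +i* h2) < l / 2.
  have : k <= l by rewrite /k ge_min lexx.
  by move: hk; lra.
have hr : normc (h1 +i* h2) < r - `|x|.
  have : k <= r - `|x| by rewrite /k ge_min lexx orbT.
  by move: hk; lra.
have xr' : `|x + h1| < r.
  by apply: (le_lt_trans (ler_normD _ _)); rewrite /= in hr; lra.
have r0 : 0 < r by apply: le_lt_trans xr.
have := R0 x (x + h1) 0 y xr xr'; rewrite normr0 => /(_ r0 yr) Q0.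
(* The two L-shaped paths differ by the boundary of the rectangle with corners [x] and
   [x + h1 +i* y], plus the horizontal segment at height [y] and the vertical one at [x + h1]. *)
have -> : Hor f 0 0 (x + h1) + 'i * Ver f (x + h1) 0 (y + h2) -
    (Hor f 0 0 x + 'i * Ver f x 0 y) - f (x +i* y) * (h1 +i* h2) =
   Rect f x (x + h1) 0 y +
   ((Hor f y x (x + h1) - f (x +i* y) * h1%:C) +
    'i * (Ver f (x + h1) y (y + h2) - f (x +i* y) * h2%:C)).
  rewrite /Rect /Hor /Ver -(Int_chasles _ 0 x (x + h1)) -(Int_chasles _ 0 y (y + h2)).
  have -> : h1 +i* h2 = h1%:C + 'i * h2%:C by apply: eqC; rewrite !ReImE /=; ring.
  ring.
rewrite Q0 add0r; apply: (le_trans (normcD _ _)); rewrite normcMC normci mul1r.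
have IC (c : C) p q : Int (cst c) p (p + q) = c * q%:C.
  rewrite (@Int_FTC _ _ (fun t => c * t%:C)).
  - by rewrite rmorphD; ring.
  - exact: rcts_cst.
  - move=> t _; rewrite /cst -[c in rder _ _ c]mulr1.
    by apply: rderZ; split => /=; [exact: is_derive_id|exact: is_derive_cst].
rewrite -(IC _ x h1) -(IC _ y h2) /Hor /Ver -!IntB; try exact: rcts_cst; try exact: rcts_hor; try exact: rcts_ver.
have near_h s t : `|s| <= `|h1| -> `|t| <= `|h2| ->
    normc (f ((x + s) +i* (y + t)) - f (x +i* y)) <= e / 4.
  move=> sh th.
  have -> : (x + s) +i* (y + t) = (x +i* y) + (s +i* t) by [].
  by apply: Hl; apply: (le_lt_trans (normc_leD _)) => /=; rewrite /= in hl; lra.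
have bt (p q t : R) : between p (p + q) t -> `|t - p| <= `|q|.
  rewrite /between ge_min le_max => tt; have [q0|q0] := leP 0 q.
    by rewrite (ger0_norm q0) ler_norml; move: tt; lra.
  by rewrite (ltr0_norm q0) ler_norml; move: tt; lra.
have B1 : normc (Int (fun t => f (t +i* y) - cst (f (x +i* y)) t) x (x + h1)) <= 2 * (e / 4) * `|x + h1 - x|.
  apply: Int_bound; first by apply: rctsB; [exact: rcts_hor|exact: rcts_cst].
  move=> t /bt tb; have := near_h (t - x) 0 tb; rewrite normr0 addr0 (addrC x) subrK.
  by apply; exact: normr_ge0.
have B2 : normc (Int (fun t => f ((x + h1) +i* t) - cst (f (x +i* y)) t) y (y + h2)) <= 2 * (e / 4) * `|y + h2 - y|.
  apply: Int_bound; first by apply: rctsB; [exact: rcts_ver|exact: rcts_cst].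
  move=> t /bt tb; have := near_h h1 (t - y) (lexx _) tb.
  by rewrite (addrC y) subrK.
rewrite (addrC x h1) addrK (addrC h1 x) in B1; rewrite (addrC y h2) addrK (addrC h2 y) in B2.
apply: (le_trans (lerD B1 B2)).
have : e / 2 * `|h1| <= e / 2 * normc (h1 +i* h2) by apply: ler_wpM2l => //; lra.
have : e / 2 * `|h2| <= e / 2 * normc (h1 +i* h2) by apply: ler_wpM2l => //; lra.
rewrite /=; lra.
Qed.

End Goursat.

(** * Differentiation under the integral sign and circles *)

Section CauchyCircle.
Variable R : realType.
Local Notation C := R[i].
Local Notation normc := (@Normc.normc R).
Local Notation Re := (@complex.Re R).
Local Notation Im := (@complex.Im R).
Implicit Types (f F : C -> C) (r : R) (w s z : C) (t : R).

Definition jcts (G : C -> R -> C) s t := forall e, 0 < e -> exists2 dl, 0 < dl &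
  forall s' t', normc (s' - s) < dl -> `|t' - t| < dl -> normc (G s' t' - G s t) <= e.

(** Compactness of [[a, b]] makes the radius uniform. Near [t], both [G s' t'] and [G s t'] are
    compared with [G s t], hence the [e / 2]. *)
Lemma jcts_uniform (G : C -> R -> C) s a b : (forall t, a <= t <= b -> jcts G s t) ->
  forall e, 0 < e -> exists2 dl, 0 < dl & forall s', normc (s' - s) < dl ->
    forall t, a <= t <= b -> normc (G s' t - G s t) <= e.
Proof.
move=> jG e e0.
pose P (dl t : R) := forall s', normc (s' - s) < dl -> normc (G s' t - G s t) <= e.
have : \forall dl \near (0 : R)^'+, `[a, b]%classic `<=` P dl.
  have /compact_near_coveringP cp := @segment_compact R a b.
  apply: (cp R (0^'+) P) => t tab.
  have e20 : 0 < e / 2 by lra.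
  have tab' : a <= t <= b by move: tab; rewrite /= in_itv.
  have [l l0 H] := jG t tab' _ e20.
  exists (ball t l, [set d | 0 < d < l]) => /=.
    split; first exact: nbhsx_ballx.
    by near=> d; apply/andP; split; near: d; [exact: nbhs_right_gt|exact: nbhs_right_lt].
  move=> [t' d] /= [tt' /andP[d0 dl]] s' hs.
  have ht' : `|t' - t| < l by move: tt'; rewrite /ball /= distrC.
  have A := H s' t' (lt_trans hs dl) ht'.
  have B : normc (G s t' - G s t) <= e / 2 by apply: H => //; rewrite subrr normc_00.
  have -> : G s' t' - G s t' = (G s' t' - G s t) - (G s t' - G s t) by ring.
  by apply: (le_trans (normcB _ _)); lra.
move=> H.
have [d [d0 Hd]] : exists d : R, 0 < d /\ `[a, b]%classic `<=` P d.
  near (0 : R)^'+ => d; exists d; split; last by near: d.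
  by near: d; exact: nbhs_right_gt.
exists d => // s' hs t tab; apply: Hd => //=; by rewrite in_itv.
Unshelve. all: by end_near. Qed.

(** For fixed [t], the mean value bound along the segment from [s] to [s + h] controls the remainder
    of [H] by the oscillation of [H']. The last hypothesis makes this uniform in [t], so the
    remainder can be integrated. *)
Lemma diff_under (H H' : C -> R -> C) s a b q : a <= b -> 0 < q ->
  (forall s', normc (s' - s) < q -> rcts (H s') /\ rcts (H' s')) ->
  (forall s' t, normc (s' - s) < q -> a <= t <= b -> cder (H^~ t) s' (H' s' t)) ->
  (forall e, 0 < e -> exists2 dl, 0 < dl & forall s', normc (s' - s) < dl ->
    forall t, a <= t <= b -> normc (H' s' t - H' s t) <= e) ->
  cder (fun s' => Int (H s') a b) s (Int (H' s) a b).
Proof.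
move=> ab q0 cH dH uH e e0.
(* The 4 is the product of the factors 2 of [rder_bound] and [Int_bound]; the 1 covers [a = b]. *)
pose e1 := e / (4 * (b - a) + 1).
have ba : 0 < 4 * (b - a) + 1 by lra.
have e10 : 0 < e1 by rewrite divr_gt0.
have [l l0 Hl] := uH _ e10.
exists (Num.min l q); first by rewrite lt_min l0.
move=> h; rewrite lt_min => /andP[hl hq].
have hq' : normc (s + h - s) < q by rewrite addrC addKr.
have hq0 : normc (s - s) < q by rewrite subrr normc_00.
have [c1 _] := cH _ hq'; have [c2 c3] := cH _ hq0.
rewrite mulrC -IntZ// -IntB// -IntB//; last 2 first.
- exact: rctsB.
- by apply: rctsM => //; exact: rcts_cst.
have B t : between a b t -> normc (H (s + h) t - H s t - h * H' s t) <= 2 * (e1 * normc h).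
  rewrite between_le// => tab.
  have := @rder_bound R (fun x => H (s + x%:C * h) t - x%:C * (h * H' s t))
     (fun x => H' (s + x%:C * h) t * h - h * H' s t) (e1 * normc h) 0 1 ler01.
  rewrite rmorph1 rmorph0 !mul0r !mul1r addr0 !subr0 mulr1.
  rewrite (_ : H (s + h) t - h * H' s t - H s t = H (s + h) t - H s t - h * H' s t); last by ring.
  have xh x : 0 <= x <= 1 -> normc (s + x%:C * h - s) <= normc h.
    move=> /andP[x0 x1]; rewrite addrC addKr normcMC normcR ger0_norm//.
    by rewrite ler_piMl// normc_ge0.
  apply => x x01.
    apply: rderB; last by have := rder_line 0 (h * H' s t) x; under eq_fun do rewrite add0r.
    apply: (@rder_comp _ (H^~ t) (fun y => s + y%:C * h)); first exact: rder_line.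
    by apply: dH => //; apply: le_lt_trans (xh _ x01) _.
  rewrite (mulrC h) -mulrBl normcMC ler_wpM2r ?normc_ge0//.
  by apply: Hl => //; apply: le_lt_trans (xh _ x01) _.
have := @Int_bound R _ _ a b _ B; rewrite ger0_norm ?subr_ge0//.
move=> /(_ _)/le_trans; apply.
  by apply: rctsB; [exact: rctsB|apply: rctsM => //; exact: rcts_cst].
have -> : 2 * (2 * (e1 * normc h)) * (b - a) = e1 * (4 * (b - a)) * normc h by ring.
apply: ler_wpM2r; first exact: normc_ge0.
by rewrite /e1 mulrAC ler_pdivrMr// ler_pM2l//; lra.
Qed.

(** The unit circle; [ecN] is its inverse, kept as a separate function to avoid divisions. *)
Definition ec t : C := cos t +i* sin t.
Definition ecN t : C := cos t -i* sin t.

Lemma ecK t : ec t * ecN t = 1.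
Proof.
by apply: eqC; rewrite !ReImE /=; [rewrite mulrN opprK -!expr2 cos2Dsin2|ring].
Qed.
Lemma normc_ec t : normc (ec t) = 1.
Proof. by rewrite /= cos2Dsin2 sqrtr1. Qed.
Lemma normc_ecN t : normc (ecN t) = 1.
Proof. by rewrite /= sqrrN cos2Dsin2 sqrtr1. Qed.
Lemma rder_ec t : rder ec t ('i * ec t).
Proof.
split; rewrite !ReImE /= !(mul0r, mul1r, sub0r, add0r); [exact: is_derive_cos|].
exact: is_derive_sin.
Qed.
Lemma rder_ecN t : rder ecN t (- 'i * ecN t).
Proof.
split; rewrite !ReImE /= !(mul0r, mul1r, sub0r, add0r, oppr0, mulN1r, addr0, mulrN, opprK).
  exact: is_derive_cos.
exact: (is_deriveN (is_derive_sin t)).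
Qed.
Lemma rcts_ec : rcts ec. Proof. by apply: rder_rcts => t; exists ('i * ec t); exact: rder_ec. Qed.
Lemma rcts_ecN : rcts ecN. Proof. by apply: rder_rcts => t; exists (- 'i * ecN t); exact: rder_ecN. Qed.
Lemma ec_2pi : ec (pi *+ 2) = ec 0.
Proof. by rewrite /ec -[pi *+ 2]add0r cosD2pi sinD2pi. Qed.
Lemma ecN_2pi : ecN (pi *+ 2) = ecN 0.
Proof. by rewrite /ecN -[pi *+ 2]add0r cosD2pi sinD2pi. Qed.

Lemma Sq_add r1 r2 z h : Sq r1 z -> normc h <= r2 -> Sq (r1 + r2) (z + h).
Proof.
move=> /andP[z1 z2] hr; rewrite /Sq ReD ImD; apply/andP.
have := Re_le_normc h; have := Im_le_normc h.
by split; apply: (le_lt_trans (ler_normD _ _)); lra.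
Qed.

End CauchyCircle.

(** * Cauchy's integral formula, estimates and regularity of derivatives *)

Section CauchyFormula.
Variable R : realType.
Local Notation C := R[i].
Local Notation normc := (@Normc.normc R).
Local Notation Re := (@complex.Re R).
Local Notation Im := (@complex.Im R).
Local Notation ec := (@ec R).
Local Notation ecN := (@ecN R).
Local Notation tau := (pi *+ 2 : R).
Implicit Types (f F : C -> C) (r : R) (w s z : C) (t : R).

Lemma Int_cst (c : C) a b : Int (cst c) a b = c * (b - a)%:C.
Proof.
rewrite (@Int_FTC _ _ (fun t => c * t%:C)).
- by rewrite rmorphB; ring.
- exact: rcts_cst.
- move=> t _; rewrite /cst -[c in rder _ _ c]mulr1.
  by apply: rderZ; split => /=; [exact: is_derive_id|exact: is_derive_cst].
Qed.

Lemma tau_gt0 : 0 < tau. Proof. by rewrite pmulrn_lgt0// pi_gt0. Qed.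

Lemma rcts_circle f w s : (forall z, ccts f z) -> rcts (fun t => f (w + s * ec t)).
Proof.
move=> cf; apply: rcts_comp => //; apply: rctsD; first exact: rcts_cst.
by apply: rctsM; [exact: rcts_cst|exact: rcts_ec].
Qed.

Lemma jcts_circle f w s t : ccts f (w + s * ec t) -> jcts (fun s t => f (w + s * ec t)) s t.
Proof.
move=> cf e e0; have [l l0 Hl] := cf _ e0.
have k0 : 0 < normc s + 1 by have := normc_ge0 s; lra.
have l20 : 0 < l / 2 / (normc s + 1) by rewrite divr_gt0//; lra.
have [k kk Hk] := rder_cts (rder_ec t) l20.
exists (Num.min (l / 2) k); first by rewrite lt_min kk; apply/andP; split; lra.
move=> s' t'; rewrite !lt_min => /andP[hs _] /andP[_ ht].
have -> : w + s' * ec t' = w + s * ec t + (s' * ec t' - s * ec t) by ring.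
apply: Hl; have -> : s' * ec t' - s * ec t = (s' - s) * ec t' + s * (ec t' - ec t) by ring.
have := Hk _ ht; rewrite (addrC t) subrK ler_pdivlMr// => h1.
apply: (le_lt_trans (normcD _ _)); rewrite !normcMC normc_ec mulr1.
by have := normc_ge0 (ec t' - ec t); lra.
Qed.

Lemma jcts_center f w s t : ccts f (w + s * ec t) ->
  jcts (fun w t => f (w + s * ec t)) w t.
Proof.
move=> cf e e0; have [l l0 Hl] := cf _ e0.
have k0 : 0 < normc s + 1 by have := normc_ge0 s; lra.
have l20 : 0 < l / 2 / (normc s + 1) by rewrite divr_gt0//; lra.
have [k kk Hk] := rder_cts (rder_ec t) l20.
exists (Num.min (l / 2) k); first by rewrite lt_min kk; apply/andP; split; lra.
move=> w' t'; rewrite !lt_min => /andP[hs _] /andP[_ ht].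
have -> : w' + s * ec t' = w + s * ec t + ((w' - w) + s * (ec t' - ec t)) by ring.
apply: Hl.
have := Hk _ ht; rewrite (addrC t) subrK ler_pdivlMr// => h1.
apply: (le_lt_trans (normcD _ _)); rewrite !normcMC.
by have := normc_ge0 (ec t' - ec t); lra.
Qed.

Lemma cder_circle F (d : C) w s t : cder F (w + s * ec t) d ->
  cder (fun s => F (w + s * ec t) * ecN t) s d.
Proof.
move=> dF e e0; have [l l0 Hl] := dF _ e0; exists l => // h hl.
have nh : normc (h * ec t) = normc h by rewrite normcMC normc_ec mulr1.
have := Hl (h * ec t); rewrite nh => /(_ hl).
have -> : F (w + (s + h) * ec t) * ecN t - F (w + s * ec t) * ecN t - d * h =
  (F (w + s * ec t + h * ec t) - F (w + s * ec t) - d * (h * ec t)) * ecN t.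
  rewrite mulrBl -!mulrA ecK mulr1.
  by rewrite (_ : w + (s + h) * ec t = w + s * ec t + h * ec t); ring.
by rewrite normcMC normc_ecN mulr1.
Qed.

Lemma cder_center F (d : C) w s t : cder F (w + s * ec t) d ->
  cder (fun w => F (w + s * ec t) * ecN t) w (d * ecN t).
Proof.
move=> dF e e0; have [l l0 Hl] := dF _ e0; exists l => // h hl.
have := Hl h hl.
have -> : F (w + h + s * ec t) * ecN t - F (w + s * ec t) * ecN t - d * ecN t * h =
  (F (w + s * ec t + h) - F (w + s * ec t) - d * h) * ecN t.
  by rewrite (_ : w + h + s * ec t = w + s * ec t + h); ring.
by rewrite normcMC normc_ecN mulr1.
Qed.

Section C1.
Variables (F f : C -> C) (r : R).
Hypothesis cf : forall z, ccts f z.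
Hypothesis dF : forall z, Sq r z -> cder F z (f z).

Lemma Sq_circle w s t : Sq (r / 2) w -> normc s < r / 2 -> Sq r (w + s * ec t).
Proof.
move=> hw hs; have -> : r = r / 2 + r / 2 by field.
by apply: Sq_add => //; rewrite normcMC normc_ec mulr1 ltW.
Qed.

(** [M] is the circular mean of [f] up to the factor [tau], and [L] the corresponding Cauchy
    integral of the primitive [F]. Integrating the [t]-derivative over a period gives [L = s * M];
    differentiating in [s] under the integral gives [L' = M]. Together they make [M] independent of
    the radius. *)
Let L w s := Int (fun t => F (w + s * ec t) * ecN t) 0 tau.
Let M w s := Int (fun t => f (w + s * ec t)) 0 tau.

Lemma rder_circle w s t : Sq (r / 2) w -> normc s < r / 2 ->
  rder (fun t => F (w + s * ec t) * ecN t) t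
    ('i * s * f (w + s * ec t) - 'i * (F (w + s * ec t) * ecN t)).
Proof.
move=> hw hs.
have D1 : rder (fun t => w + s * ec t) t (s * ('i * ec t)).
  by rewrite -[s * _]add0r; apply: rderD; [exact: rder_cst|apply: rderZ; exact: rder_ec].
have := rderM (rder_comp D1 (dF (Sq_circle t hw hs))) (rder_ecN t).
congr (rder _ _ _).
have -> : f (w + s * ec t) * (s * ('i * ec t)) * ecN t =
  'i * s * f (w + s * ec t) * (ec t * ecN t) by ring.
rewrite ecK; ring.
Qed.

Lemma rcts_circleF w s : Sq (r / 2) w -> normc s < r / 2 ->
  rcts (fun t => F (w + s * ec t) * ecN t).
Proof. by move=> hw hs; apply: rder_rcts => t; eexists; exact: rder_circle. Qed.

Lemma circle_parts w s : Sq (r / 2) w -> normc s < r / 2 -> L w s = s * M w s.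
Proof.
move=> hw hs.
have c1 := rcts_circle w s cf; have c2 := rcts_circleF hw hs.
have ci (z : C) g : rcts g -> rcts (fun t => z * g t).
  by move=> cg; apply: rctsM => //; exact: rcts_cst.
have := @Int_FTC _ (fun t => 'i * s * f (w + s * ec t) - 'i * (F (w + s * ec t) * ecN t))
  (fun t => F (w + s * ec t) * ecN t) 0 tau.
rewrite IntB ?IntZ//; try exact: ci.
rewrite -/(L w s) -/(M w s) ec_2pi ecN_2pi subrr => H.
have /eqP : 'i * s * M w s - 'i * L w s = 0.
  by apply: H => [|t _]; [apply: rctsB; exact: ci|exact: rder_circle].
rewrite -mulrA -mulrBr mulf_eq0 => /orP[|].
  by rewrite -normr_eq0 normc_def /= expr0n expr1n add0r sqrtr1 oner_eq0.
by rewrite subr_eq0 => /eqP.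
Qed.

Lemma cder_L w s : Sq (r / 2) w -> normc s < r / 2 -> cder (L w) s (M w s).
Proof.
move=> hw hs; rewrite /L /M.
have near_s s' : normc (s' - s) < r / 2 - normc s -> normc s' < r / 2.
  move=> h; have -> : s' = (s' - s) + s by ring.
  by apply: (le_lt_trans (normcD _ _)); lra.
apply: (@diff_under _ (fun s t => F (w + s * ec t) * ecN t) (fun s t => f (w + s * ec t))
  s 0 tau (r / 2 - normc s)).
- exact: ltW tau_gt0.
- by rewrite subr_gt0.
- by move=> s' /near_s hs'; split; [exact: rcts_circleF|exact: rcts_circle].
- by move=> s' t /near_s hs' _; apply: cder_circle; apply: dF; exact: Sq_circle.
- by apply: jcts_uniform => t _; exact: jcts_circle.
Qed.

(** The mean value property of [f], rewritten through [L = rho * M]. It expresses [f] by its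
    primitive alone, which [cauchy_derivative] exploits. *)
Lemma cauchy_circle w rho : Sq (r / 2) w -> 0 < rho < r / 2 ->
  L w rho%:C = (rho * tau)%:C * f w.
Proof.
move=> hw /andP[rho0 rhor].
have nn t : 0 < t <= rho -> normc t%:C < r / 2.
  by move=> /andP[t0 tr]; rewrite normcR gtr0_norm//; lra.
have constN t : 0 < t <= rho -> M w rho%:C = M w t%:C.
  move=> ht; have t0 : 0 < t by lra.
  have LM x : 0 < x <= rho -> (x^-1)%:C * L w x%:C = M w x%:C.
    move=> hx; rewrite circle_parts//; last exact: nn.
    by rewrite mulrA -rmorphM mulVf ?rmorph1 ?mul1r//; rewrite gt_eqF//; lra.
  rewrite -LM ?rho0 ?lexx// -LM//; apply/eqP; rewrite -subr_eq0; apply/eqP/normc_eq0.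
  have tr : t <= rho by lra.
  (* The derivative of [L / x] is [- L / x ^ 2 + M / x], which vanishes because [L = x * M]. *)
  have := @rder_bound R (fun x => (x^-1)%:C * L w x%:C) (cst 0) 0 _ _ tr.
  rewrite mulr0 mul0r; apply => x hx; last by rewrite /cst normc_00.
  have x0 : 0 < x by lra.
  have xr : 0 < x <= rho by lra.
  have xn0 : x != 0 by rewrite gt_eqF.
  have D1 : rder (fun x => (x^-1)%:C : C) x (- (x^-1 ^+ 2))%:C.
    apply: rder_real.
    have di : derivable (id : R -> R) x 1 by exact: derivable_id.
    have -> : - x^-1 ^+ 2 = 'D_1 (fun y : R => y^-1) x.
      by rewrite (@deriveV _ _ id)// derive_id /GRing.scale /= mulr1 exprVn.
    exact/derivableP/(@derivableV _ _ id).
  have D2 : rder (fun x => L w x%:C) x (M w x%:C * 1).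
    by apply: (@rder_comp _ (L w) (fun x => x%:C)); [split => /=; [exact: is_derive_id|exact: is_derive_cst]|apply: cder_L => //; exact: nn].
  have := rderM D1 D2; congr (rder _ _ _).
  rewrite circle_parts//; last exact: nn.
  rewrite /cst mulr1 mulrA -mulrDl -!rmorphM -rmorphD /=.
  have -> : - x^-1 ^+ 2 * x + x^-1 = 0 by field.
  by rewrite rmorph0 mul0r.
have M0 : M w 0 = f w * tau%:C.
  rewrite /M (_ : (fun t => _) = cst (f w)); first by rewrite Int_cst subr0.
  by apply/funext => t; rewrite mul0r addr0.
(* Constancy is known for positive radii only. Radius 0 is reached by uniform continuity: a nonzero
   difference [N] would satisfy [N <= N / 2]. *)
have Mrho : M w rho%:C = M w 0.
  apply/eqP; rewrite -subr_eq0; apply/eqP/normc_eq0; rewrite leNgt; apply/negP => n0.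
  set N := normc _ in n0.
  have e0 : 0 < N / (4 * tau) by rewrite divr_gt0// mulr_gt0// tau_gt0.
  have [l l0 Hl] := @jcts_uniform R (fun s t => f (w + s * ec t)) 0 0 tau
     (fun t _ => jcts_circle (cf _)) _ e0.
  pose t := Num.min rho (l / 2).
  have t0 : 0 < t by rewrite lt_min rho0; lra.
  have tr : t <= rho by rewrite /t ge_min lexx.
  have tl : t <= l / 2 by rewrite /t ge_min lexx orbT.
  have := @Int_bound R (fun x => f (w + t%:C * ec x) - f (w + 0 * ec x)) (N / (4 * tau)) 0 tau.
  rewrite IntB; try exact: rcts_circle.
  rewrite -/(M w t%:C) -/(M w 0) -constN ?t0// -/N subr0 gtr0_norm ?tau_gt0//.
  have -> : 2 * (N / (4 * tau)) * tau = N / 2.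
    by move: (tau_gt0) => /gt_eqF/negbT; move: tau => T T0; field.
  move=> H; have : N <= N / 2; last by lra.
  apply: H => [|x]; first by apply: rctsB; exact: rcts_circle.
  rewrite between_le; last exact: ltW tau_gt0.
  by move=> hx; apply: Hl => //; rewrite subr0 normcR gtr0_norm//; lra.
rewrite circle_parts//; last by rewrite normcR gtr0_norm//; lra.
by rewrite Mrho M0 rmorphM; ring.
Qed.

(** [cauchy_circle] is differentiated in the center [w] under the integral. The integrand involves
    only [F], whose derivative [f] is continuous, so differentiability of [f] comes out without
    being put in. *)
Lemma cauchy_derivative w rho : Sq (r / 2) w -> 0 < rho < r / 2 ->
  cder f w ((rho * tau)^-1%:C * Int (fun t => f (w + rho%:C * ec t) * ecN t) 0 tau).
Proof.
move=> hw hrho; have [rho0 rhor] := andP hrho.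
have k0 : rho * tau != 0 by rewrite mulf_neq0 ?gt_eqF// tau_gt0.
have nrho : normc rho%:C < r / 2 by rewrite normcR gtr0_norm.
pose q := r / 2 - Num.max `|Re w| `|Im w|.
have q0 : 0 < q by rewrite subr_gt0 gt_max; move: hw => /andP[-> ->].
have near_w w' : normc (w' - w) < q -> Sq (r / 2) w'.
  have n1 := Re_le_normc (w' - w); have n2 := Im_le_normc (w' - w).
  rewrite /q => hq; have m1 : `|Re w| <= Num.max `|Re w| `|Im w| by rewrite le_max lexx.
  have m2 : `|Im w| <= Num.max `|Re w| `|Im w| by rewrite le_max lexx orbT.
  have -> : w' = w + (w' - w) by ring.
  rewrite /Sq ReD ImD; apply/andP.
  by split; apply: (le_lt_trans (ler_normD _ _)); lra.
have D : cder (fun w => L w rho%:C) w (Int (fun t => f (w + rho%:C * ec t) * ecN t) 0 tau).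
  apply: (@diff_under _ (fun w t => F (w + rho%:C * ec t) * ecN t)
    (fun w t => f (w + rho%:C * ec t) * ecN t) w 0 tau q) => //.
  - exact: ltW tau_gt0.
  - move=> w' /near_w hw'; split; first exact: rcts_circleF.
    by apply: rctsM; [exact: rcts_circle|exact: rcts_ecN].
  - by move=> w' t /near_w hw' _; apply: cder_center; apply: dF; exact: Sq_circle.
  - move=> e e0.
    have [l l0 Hl] := @jcts_uniform R (fun w t => f (w + rho%:C * ec t)) w 0 tau
      (fun t _ => jcts_center (cf _)) _ e0.
    exists l => // w' hw' t ht; rewrite -mulrBl normcMC normc_ecN mulr1; exact: Hl.
move=> e e0.
have e10 : 0 < e * (rho * tau) by rewrite !mulr_gt0// tau_gt0.
have [l l0 Hl] := D _ e10.
exists (Num.min l q); first by rewrite lt_min l0.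
move=> h; rewrite lt_min => /andP[hl hq].
have hw' : Sq (r / 2) (w + h) by apply: near_w; rewrite addrC addKr.
have fE w' : Sq (r / 2) w' -> f w' = (rho * tau)^-1%:C * L w' rho%:C.
  by move=> h'; rewrite cauchy_circle// mulrA -rmorphM mulVf// rmorph1 mul1r.
rewrite (fE w)// (fE (w + h))// -mulrA -!mulrBr normcMC normcR.
rewrite ger0_norm; last by rewrite invr_ge0 mulr_ge0// ltW// tau_gt0.
rewrite ler_pdivrMl; last by rewrite mulr_gt0// tau_gt0.
by apply: le_trans (Hl _ hl) _; rewrite le_eqVlt; apply/orP; left; apply/eqP; ring.
Qed.

End C1.

Lemma Sq_le r r' z : r <= r' -> Sq r z -> Sq r' z.
Proof. by move=> rr /andP[h1 h2]; apply/andP; split; apply: lt_le_trans rr. Qed.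

Lemma Sq_open r z : Sq r z -> exists2 q, 0 < q & forall h, normc h < q -> Sq r (z + h).
Proof.
move=> hz; exists (r - Num.max `|Re z| `|Im z|).
  by rewrite subr_gt0 gt_max; move: hz => /andP[-> ->].
move=> h hq; have n1 := Re_le_normc h; have n2 := Im_le_normc h.
have m1 : `|Re z| <= Num.max `|Re z| `|Im z| by rewrite le_max lexx.
have m2 : `|Im z| <= Num.max `|Re z| `|Im z| by rewrite le_max lexx orbT.
rewrite /Sq ReD ImD; apply/andP.
by split; apply: (le_lt_trans (ler_normD _ _)); lra.
Qed.

(** Composing with this retraction onto a closed square extends a function known near the square to
    one continuous on the whole plane, as the integration lemmas require. *)
Definition clampR r x : R := Num.max (- r) (Num.min r x).
Definition clamp r z : C := clampR r (Re z) +i* clampR r (Im z).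

Lemma clampR_id r x : `|x| <= r -> clampR r x = x.
Proof.
rewrite ler_norml => /andP[h1 h2].
by rewrite /clampR (min_r h2) max_r.
Qed.

Lemma clamp_id r z : Sq r z -> clamp r z = z.
Proof. by move=> /andP[h1 h2]; rewrite /clamp !clampR_id ?ltW//; case: z h1 h2. Qed.

Lemma clampR_norm r x : 0 <= r -> `|clampR r x| <= r.
Proof.
move=> r0; rewrite ler_norml /clampR le_max lexx/= ge_max ge_min lexx/= andbT; lra.
Qed.

Lemma clampR_lip r x y : `|clampR r x - clampR r y| <= `|x - y|.
Proof.
have mono u v : u <= v -> clampR r u <= clampR r v /\ clampR r v - clampR r u <= v - u.
  by move=> uv; rewrite /clampR; case: (leP r u) => ?; case: (leP r v) => ?;
    rewrite !maxEle; do !(case: ifP => [|/negbT]; rewrite -?ltNge => ?); split; lra.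
have [xy|/ltW yx] := leP x y.
  by have [m1 m2] := mono _ _ xy; rewrite distrC (distrC x) !ger0_norm ?subr_ge0.
by have [m1 m2] := mono _ _ yx; rewrite !ger0_norm ?subr_ge0.
Qed.

Lemma clamp_ccts f r r' z : 0 <= r < r' -> (forall z, Sq r' z -> ccts f z) ->
  ccts (fun z => f (clamp r z)) z.
Proof.
move=> /andP[r0 rr] cf e e0.
have hz : Sq r' (clamp r z).
  by apply/andP; split; apply: le_lt_trans rr; exact: clampR_norm.
have [l l0 Hl] := cf _ hz _ e0.
exists (l / 2); first lra.
move=> h hl; have -> : clamp r (z + h) = clamp r z + (clamp r (z + h) - clamp r z) by ring.
apply: Hl; apply: (le_lt_trans (normc_leD _)); rewrite ReB ImB /=.
have := clampR_lip r (Re (z + h)) (Re z); have := clampR_lip r (Im (z + h)) (Im z).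
rewrite ReD ImD (addrC (Re z)) (addrC (Im z)) !addrK.
have := Re_le_normc h; have := Im_le_normc h; lra.
Qed.

Lemma cder_clamp f (d : C) r z : Sq r z -> cder f z d -> cder (fun z => f (clamp r z)) z d.
Proof.
move=> hz; apply: cder_loc; have [q q0 Hq] := Sq_open hz.
by exists q => // h hh; rewrite clamp_id//; exact: Hq.
Qed.

(** The radii fit: circles of radius [r / 8] about points of [Sq (r / 4)] stay in [Sq (r / 2)],
    where the clamp is the identity, and the closed square of that size still lies in [Sq r]. *)
Lemma derivative_formula f (df : C -> C) r : 0 < r ->
  (forall z, Sq r z -> cder f z (df z)) ->
  forall z, Sq (r / 4) z -> df z = (r / 8 * tau)^-1%:C *
     Int (fun t => f (clamp (r / 2) (z + (r / 8)%:C * ec t)) * ecN t) 0 tau.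
Proof.
move=> r0 dfz z hz.
pose g z := f (clamp (r / 2) z).
have cg y : ccts g y.
  by apply: (@clamp_ccts _ _ r); [lra|move=> x hx; apply: cder_ccts; exact: dfz].
have dg y : Sq (r / 2) y -> cder g y (df y).
  by move=> hy; apply: cder_clamp => //; apply: dfz; apply: Sq_le hy; lra.
have [F HF] := holomorphic_primitive cg dg.
have hz' : Sq (r / 2 / 2) z by apply: Sq_le hz; lra.
apply: (cder_uniq (dg _ (Sq_le _ hz'))); first lra.
by apply: (cauchy_derivative cg HF) => //; lra.
Qed.

(** Cauchy's estimate; 16 is the factor 2 of [Int_bound] times the 8 of the circle radius
    [r / 8]. *)
Lemma derivative_bound f (df : C -> C) r K : 0 < r ->
  (forall z, Sq r z -> cder f z (df z)) -> (forall z, Sq r z -> normc (f z) <= K) ->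
  forall z, Sq (r / 4) z -> normc (df z) <= 16 * K / r.
Proof.
move=> r0 dfz fK z hz; rewrite (derivative_formula r0 dfz hz) normcMC normcR.
have t0 := tau_gt0; have p0 := pi_gt0 R.
have k0 : 0 < r / 8 * tau by rewrite mulr_gt0//; lra.
rewrite ger0_norm; last by rewrite invr_ge0 ltW.
rewrite ler_pdivrMl//.
have hK x : Sq r (clamp (r / 2) x).
  by apply/andP; split; (apply: (@le_lt_trans _ _ (r / 2)); [apply: clampR_norm; lra|lra]).
have cg y : ccts (fun z => f (clamp (r / 2) z)) y.
  by apply: (@clamp_ccts _ _ r); [lra|move=> x hx; apply: cder_ccts; exact: dfz].
have := @Int_bound R (fun t => f (clamp (r / 2) (z + (r / 8)%:C * ec t)) * ecN t) K 0 tau.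
rewrite subr0 gtr0_norm// => /(_ _ _)/le_trans; apply.
- apply: rctsM; last exact: rcts_ecN.
  exact: (@rcts_circle (fun z => f (clamp (r / 2) z))).
- by move=> t _; rewrite normcMC normc_ecN mulr1 fK.
- by rewrite le_eqVlt; apply/orP; left; apply/eqP; move: (gt_eqF r0) => /negbT; move: tau => T T0; field.
Qed.

(** [derivative_formula] makes [df] continuous. Then [f] itself serves as the primitive of [df], and
    [cauchy_derivative] applies to the clamped [df] on a smaller square. *)
Lemma derivative_differentiable f (df : C -> C) r : 0 < r ->
  (forall z, Sq r z -> cder f z (df z)) ->
  exists ddf : C -> C, forall z, Sq (r / 16) z -> cder df z (ddf z).
Proof.
move=> r0 dfz.
have t0 := tau_gt0; have p0 := pi_gt0 R.
have cg y : ccts (fun z => f (clamp (r / 2) z)) y.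
  by apply: (@clamp_ccts _ _ r); [lra|move=> x hx; apply: cder_ccts; exact: dfz].
have cdf z : Sq (r / 4) z -> ccts df z.
  move=> hz e e0.
  have [q q0 Hq] := Sq_open hz.
  pose c := (r / 8 * tau)^-1.
  have c0 : 0 < c by rewrite invr_gt0 mulr_gt0//; lra.
  have e10 : 0 < e / (2 * c * tau) by rewrite divr_gt0// !mulr_gt0//.
  have [l l0 Hl] := @jcts_uniform R (fun w t => f (clamp (r / 2) (w + (r / 8)%:C * ec t))) z 0 tau
      (fun t _ => jcts_center (cg _)) _ e10.
  exists (Num.min l q); first by rewrite lt_min l0.
  move=> h; rewrite lt_min => /andP[hl hq].
  have cI w : rcts (fun t => f (clamp (r / 2) (w + (r / 8)%:C * ec t)) * ecN t).
    apply: rctsM; last exact: rcts_ecN.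
    exact: (@rcts_circle (fun z => f (clamp (r / 2) z))).
  rewrite (derivative_formula r0 dfz hz) (derivative_formula r0 dfz (Hq _ hq)).
  rewrite -mulrBr normcMC normcR -/c gtr0_norm// -IntB//.
  have B := @Int_bound R (fun t => f (clamp (r / 2) (z + h + (r / 8)%:C * ec t)) * ecN t -
     f (clamp (r / 2) (z + (r / 8)%:C * ec t)) * ecN t) (e / (2 * c * tau)) 0 tau.
  rewrite subr0 gtr0_norm// in B.
  have {}B := B (rctsB (cI _) (cI _)).
  rewrite -ler_pdivlMl//.
  apply: (le_trans (B _)).
    move=> t; rewrite between_le; last exact: ltW.
    move=> ht; rewrite -mulrBl normcMC normc_ecN mulr1; apply: Hl => //.
    by rewrite addrC addKr.
  rewrite le_eqVlt; apply/orP; left; apply/eqP.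
  by move: (gt_eqF t0) (gt_eqF c0) => /negbT + /negbT; move: (c) tau => b T T0 b0; field; rewrite T0 b0.
pose g z := df (clamp (r / 8) z).
have cG z : ccts g z by apply: (@clamp_ccts _ _ (r / 4)) => //; lra.
have dG z : Sq (r / 8) z -> cder f z (g z).
  by move=> hz; rewrite /g clamp_id//; apply: dfz; apply: Sq_le hz; lra.
eexists => z hz.
have hz' : Sq (r / 8 / 2) z by apply: Sq_le hz; lra.
have hr : 0 < r / 32 < r / 8 / 2 by lra.
have := cauchy_derivative cG dG hz' hr.
apply: cder_loc.
have [q q0 Hq] := Sq_open hz.
by exists q => // h /Hq hh; rewrite /g clamp_id//; apply: Sq_le hh; lra.
Qed.

End CauchyFormula.

(** * Two complex variables *)

Section TwoVariables.
Variable R : realType.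
Local Notation C := R[i].
Local Notation normc := (@Normc.normc R).
Local Notation Re := (@complex.Re R).
Local Notation Im := (@complex.Im R).
Local Notation ec := (@ec R).
Local Notation ecN := (@ecN R).
Local Notation tau := (pi *+ 2 : R).
Implicit Types (r e : R) (w z h k A B : C) (f : C -> C -> C).

Definition cder2 f w z A B := forall e, 0 < e -> exists2 dl, 0 < dl &
  forall h k, normc h < dl -> normc k < dl ->
    normc (f (w + h) (z + k) - f w z - A * h - B * k) <= e * (normc h + normc k).

Lemma cder2_l f w z A B : cder2 f w z A B -> cder (f^~ z) w A.
Proof.
move=> D e e0; have [l l0 Hl] := D e e0; exists l => // h hl.
by have := Hl h 0 hl; rewrite normc_00 !addr0 mulr0 subr0; exact.
Qed.

Lemma cder2_r f w z A B : cder2 f w z A B -> cder (f w) z B.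
Proof.
move=> D e e0; have [l l0 Hl] := D e e0; exists l => // h hl.
by have := Hl 0 h; rewrite normc_00 !(addr0, add0r) mulr0 subr0; apply.
Qed.

Lemma cder2_sym f w z A B : cder2 f w z A B -> cder2 (fun z w => f w z) z w B A.
Proof.
move=> D e e0; have [l l0 Hl] := D e e0; exists l => // h k hl kl.
by rewrite addrAC (addrC (normc h)); exact: Hl.
Qed.

Lemma cder_sub (g1 g2 : C -> C) z d1 d2 : cder g1 z d1 -> cder g2 z d2 ->
  cder (fun z => g1 z - g2 z) z (d1 - d2).
Proof.
move=> D1 D2 e e0; have e20 : 0 < e / 2 by lra.
have [l l0 Hl] := D1 _ e20; have [k k0 Hk] := D2 _ e20.
exists (Num.min l k); first by rewrite lt_min l0.
move=> h; rewrite lt_min => /andP[hl hk].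
have -> : g1 (z + h) - g2 (z + h) - (g1 z - g2 z) - (d1 - d2) * h =
  (g1 (z + h) - g1 z - d1 * h) - (g2 (z + h) - g2 z - d2 * h) by ring.
by apply: (le_trans (normcB _ _)); have := Hl _ hl; have := Hk _ hk; lra.
Qed.

Lemma cder_scale (g : C -> C) z d c : cder g z d -> cder (fun z => c * g z) z (c * d).
Proof.
move=> D e e0; have n0 := normc_ge0 c.
have e1 : 0 < e / (normc c + 1) by rewrite divr_gt0//; lra.
have [l l0 Hl] := D _ e1; exists l => // h hl.
rewrite -mulrA -!mulrBr normcMC.
have : normc c * normc (g (z + h) - g z - d * h) <= (normc c + 1) * (e / (normc c + 1) * normc h).
  by apply: ler_pM => //; [exact: normc_ge0|lra|exact: Hl].
rewrite mulrA mulrCA divff ?mulr1//; rewrite gt_eqF//; lra.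
Qed.

Lemma cder_lip (g dg : C -> C) r K z z' :
  (forall z, Sq r z -> cder g z (dg z)) -> (forall z, Sq r z -> normc (dg z) <= K) ->
  Sq r z -> Sq r z' -> normc (g z' - g z) <= 2 * K * normc (z' - z).
Proof.
move=> D B hz hz'.
have S t : 0 <= t <= 1 -> Sq r (z + t%:C * (z' - z)).
  move=> /andP[t0 t1].
  have cv p q : `|p| < r -> `|q| < r -> `|p + t * (q - p)| < r.
    rewrite !ltr_norml => /andP[p1 p2] /andP[q1 q2].
    have -> : p + t * (q - p) = (1 - t) * p + t * q by ring.
    have [t10|t10] := ltP 0 (1 - t).
      have : (1 - t) * p < (1 - t) * r by rewrite ltr_pM2l.
      have : (1 - t) * (- r) < (1 - t) * p by rewrite ltr_pM2l.
      have : t * q <= t * r by rewrite ler_wpM2l// ltW.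
      have : t * (- r) <= t * q by rewrite ler_wpM2l// ltW.
      by move=> *; apply/andP; split; lra.
    have -> : t = 1 by lra.
    by apply/andP; split; lra.
  by move: hz hz' => /andP[? ?] /andP[? ?]; rewrite /Sq !ReImE /= !mul0r subr0 addr0 !cv.
have := @rder_bound R (fun t => g (z + t%:C * (z' - z)))
  (fun t => dg (z + t%:C * (z' - z)) * (z' - z)) (K * normc (z' - z)) 0 1 ler01.
rewrite rmorph0 rmorph1 mul0r mul1r addr0 (addrC z) subrK subr0 mulr1 mulrA; apply => t /S hS.
  by apply: (rder_comp (rder_line z (z' - z) t)); exact: D.
by rewrite normcMC ler_wpM2r ?normc_ge0// B.
Qed.

Section Center.
Variables (f fw fz : C -> C -> C) (r K : R).
Hypothesis r0 : 0 < r.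
Hypothesis Df : forall w z, Sq r w -> Sq r z -> cder2 f w z (fw w z) (fz w z).
Hypothesis Bf : forall w z, Sq r w -> Sq r z -> normc (f w z) <= K.

(** A Cauchy estimate in [w] bounds [fw], so [f w' - f w] is of order [w' - w] uniformly in [z]; a
    second Cauchy estimate, in [z], passes to the difference of the [fz]. *)
Lemma partial_lipschitz w w' z : Sq (r / 4) w -> Sq (r / 4) w' -> Sq (r / 4) z ->
  normc (fz w' z - fz w z) <= 16 * (2 * (16 * K / r) * normc (w' - w)) / r.
Proof.
move=> hw hw' hz.
have r0' := r0; have rr x : Sq (r / 4) x -> Sq r x by apply: Sq_le; lra.
apply: (@derivative_bound _ (fun z => f w' z - f w z) (fun z => fz w' z - fz w z)) hz => // x hx.
  by apply: cder_sub; apply: cder2_r; apply: Df => //; exact: rr.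
apply: (@cder_lip (f^~ x) (fw^~ x) (r / 4)) => // y hy.
  by apply: cder2_l; apply: Df => //; exact: rr.
apply: (@derivative_bound _ (f^~ x) (fw^~ x)) hy => // v hv.
  by apply: cder2_l; apply: Df.
exact: Bf.
Qed.

Lemma Sq0 q : 0 < q -> Sq q (0 : C).
Proof. by move=> q0; rewrite /Sq normr0 q0. Qed.

(** [fw 0 z] is a Cauchy integral in the first variable of [f (c t) z], and can be differentiated in
    [z] under the integral. This produces the mixed second derivative. *)
Lemma partial_cder_cross : exists B, cder (fw 0) 0 B.
Proof.
have tau0 := tau_gt0 R.
have r0' := r0; have rr x : Sq (r / 4) x -> Sq r x by apply: Sq_le; lra.
pose q := r / 4; pose rho := q / 8.
have q0 : 0 < q by rewrite /q; lra.
pose c t := clamp (q / 2) (0 + rho%:C * ec t).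
have hc t : Sq q (c t).
  by apply/andP; split; (apply: (@le_lt_trans _ _ (q / 2)); [apply: clampR_norm; lra|lra]).
have E z : Sq q z -> fw 0 z = (rho * tau)^-1%:C * Int (fun t => f (c t) z * ecN t) 0 tau.
  move=> hz; apply: (@derivative_formula _ (f^~ z) (fw^~ z)) => //.
    by move=> w hw; apply: cder2_l; apply: Df; exact: rr.
  by apply: Sq0; lra.
have r40 : 0 < r / 16 by lra.
have S0 : Sq (r / 16) (0 : C) by exact: Sq0.
suff : exists B, cder (fun z => Int (fun t => f (c t) z * ecN t) 0 tau) 0 B.
  case=> B DB; exists ((rho * tau)^-1%:C * B).
  have [p p0 Hp] := Sq_open (Sq0 q0).
  apply: cder_loc (cder_scale _ DB); exists p => // h /Hp hh; rewrite E//.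
eexists; apply: (@diff_under _ (fun z t => f (c t) z * ecN t)
  (fun z t => fz (c t) z * ecN t) 0 0 tau (r / 64)).
- exact: ltW.
- lra.
- move=> z; rewrite subr0 => hz.
  have hz4 : Sq q z by apply/andP; split; rewrite /q; have := Re_le_normc z; have := Im_le_normc z; lra.
  split; apply: rctsM; try exact: rcts_ecN.
    apply: (@rcts_circle _ (fun w => f (clamp (q / 2) w) z)) => w.
    apply: (@clamp_ccts _ (f^~ z) _ q); first lra.
    by move=> x hx; apply: (@cder_ccts _ _ _ (fw x z)); apply: cder2_l; apply: Df; exact: rr.
  apply: (@rcts_circle _ (fun w => fz (clamp (q / 2) w) z)) => w.
  apply: (@clamp_ccts _ (fz^~ z) _ q); first lra.
  move=> x hx e e0.
  pose L := 16 * (2 * (16 * K / r)) / r.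
  have L0 : 0 < `|L| + 1 by rewrite ltr_wpDl.
  have [p p0 Hp] := Sq_open hx.
  exists (Num.min p (e / (`|L| + 1))); first by rewrite lt_min p0 divr_gt0.
  move=> h; rewrite lt_min => /andP[/Hp hh]; rewrite ltr_pdivlMr// => he.
  have := @partial_lipschitz _ _ _ hx hh hz4; rewrite (addrC x) addrK.
  have -> : 16 * (2 * (16 * K / r) * normc h) / r = L * normc h by rewrite /L; ring.
  have : L * normc h <= (`|L| + 1) * normc h.
    by apply: ler_wpM2r; [exact: normc_ge0|have := ler_norm L; lra].
  lra.
- move=> z t; rewrite subr0 => hz _.
  have hz4 : Sq q z by apply/andP; split; rewrite /q; have := Re_le_normc z; have := Im_le_normc z; lra.
  rewrite mulrC (_ : (fun _ => _) = (fun z => ecN t * f (c t) z)).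
    by apply: cder_scale; apply: cder2_r; apply: Df; exact: rr.
  by apply/funext => x; rewrite mulrC.
- move=> e e0.
  (* Two successive Cauchy estimates: [K1] bounds [fz (c t)], and [K2] bounds its derivative in [z],
     both uniformly in [t]. Hence the required equicontinuity at 0. *)
  pose K1 := 16 * K / r; pose K2 := 16 * K1 / (r / 16).
  have L0 : 0 < `|2 * K2| + 1 by rewrite ltr_wpDl.
  exists (Num.min (r / 64) (e / (`|2 * K2| + 1))).
    by rewrite lt_min; apply/andP; split; [lra|exact: divr_gt0].
  move=> z; rewrite subr0 lt_min => /andP[hz]; rewrite ltr_pdivlMr// => he t _.
  have hz4 : Sq (r / 16 / 4) z.
    by apply/andP; split; have := Re_le_normc z; have := Im_le_normc z; lra.
  rewrite -mulrBl normcMC normc_ecN mulr1.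
  have D1 x : Sq r x -> cder (f (c t)) x (fz (c t) x).
    by move=> hx; apply: cder2_r; apply: Df => //; exact: rr.
  have [ddf Hd] := derivative_differentiable r0 D1.
  have B1 x : Sq (r / 16) x -> normc (fz (c t) x) <= K1.
    move=> hx; apply: (derivative_bound r0 D1) => [y hy|]; first by apply: Bf => //; exact: rr.
    by apply: Sq_le hx; lra.
  have S04 : Sq (r / 16 / 4) (0 : C) by apply: Sq0; lra.
  have := @cder_lip (fz (c t)) ddf (r / 16 / 4) K2 0 z _ _ S04 hz4.
  rewrite subr0 => H.
  have : 2 * K2 * normc z <= (`|2 * K2| + 1) * normc z.
    by apply: ler_wpM2r; [exact: normc_ge0|have := ler_norm (2 * K2); lra].
  have : normc (fz (c t) z - fz (c t) 0) <= 2 * K2 * normc z.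
    apply: H => x hx; first by apply: Hd; apply: Sq_le hx; lra.
    by apply: (derivative_bound r40 Hd B1).
  lra.
Qed.

End Center.

(** The increment of [fw] splits into the increments along the two axes and a mixed second
    difference. Separate derivatives handle the first two; Cauchy estimates make the third of order
    [normc h * normc j], hence negligible. Separate differentiability alone would not suffice. *)
Lemma partial_cder2 f fw fz r K : 0 < r ->
  (forall w z, Sq r w -> Sq r z -> cder2 f w z (fw w z) (fz w z)) ->
  (forall w z, Sq r w -> Sq r z -> normc (f w z) <= K) ->
  exists A B, cder2 fw 0 0 A B.
Proof.
move=> r0 Df Bf.
have [B DB] := partial_cder_cross r0 Df Bf.
have Df' z w : Sq r z -> Sq r w -> cder2 (fun z w => f w z) z w (fz w z) (fw w z).
  by move=> hz hw; apply: cder2_sym; exact: Df.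
have Bf' z w : Sq r z -> Sq r w -> normc (f w z) <= K by move=> hz hw; exact: Bf.
have r160 : 0 < r / 16 by lra.
have Dl z w : Sq r z -> Sq r w -> cder (f^~ z) w (fw w z).
  by move=> hz hw; apply: cder2_l; exact: Df.
have /choice[fww Hww] : forall z, exists ddf, Sq r z ->
    forall w, Sq (r / 16) w -> cder (fw^~ z) w (ddf w).
  move=> z; have [hz|hz] := boolP (Sq r z); last by exists (cst 0).
  have [ddf H] := derivative_differentiable r0 (Dl _ ^~ hz).
  by exists ddf.
exists (fww 0 0), B.
have S0 q : 0 < q -> Sq q (0 : C) by exact: Sq0.
pose L := 16 * (2 * (16 * K / r)) / r.
pose L2 := 16 * L / (r / 16).
have Lw z w : Sq (r / 4) z -> Sq (r / 4) w -> normc (fw w z - fw w 0) <= L * normc z.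
  move=> hz hw; have S4 : Sq (r / 4) (0 : C) by apply: S0; lra.
  have := partial_lipschitz r0 Df' Bf' S4 hz hw.
  by rewrite subr0 (_ : 16 * (2 * (16 * K / r) * normc z) / r = L * normc z)//; rewrite /L; ring.
have Lww z w : Sq (r / 4) z -> Sq (r / 16 / 4) w -> normc (fww z w - fww 0 w) <= L2 * normc z.
  move=> hz hw.
  rewrite (_ : L2 * normc z = 16 * (L * normc z) / (r / 16)); last by rewrite /L2; ring.
  apply: (@derivative_bound _ (fun w => fw w z - fw w 0) (fun w => fww z w - fww 0 w)) hw => // x hx.
    by apply: cder_sub; apply: Hww => //; [apply: Sq_le hz; lra|exact: S0].
  by apply: Lw => //; apply: Sq_le hx; lra.
have Cr z w : Sq (r / 4) z -> Sq (r / 16 / 4) w ->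
    normc (fw w z - fw w 0 - (fw 0 z - fw 0 0)) <= 2 * L2 * normc z * normc w.
  move=> hz hw; have S4 : Sq (r / 16 / 4) (0 : C) by apply: S0; lra.
  have := @cder_lip (fun w => fw w z - fw w 0) (fun w => fww z w - fww 0 w)
    (r / 16 / 4) (L2 * normc z) 0 w _ _ S4 hw.
  rewrite subr0 mulrA; apply => x hx; last exact: Lww.
  by apply: cder_sub; apply: Hww; [apply: Sq_le hz; lra|apply: Sq_le hx; lra|exact: S0|apply: Sq_le hx; lra].
move=> e e0; have e30 : 0 < e / 3 by lra.
have [l l0 Hl] := DB _ e30.
have [k k0 Hk] := Hww 0 (S0 _ r0) 0 (S0 _ r160) _ e30.
pose M := `|2 * L2| + 1.
have M0 : 0 < M by rewrite /M ltr_wpDl.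
pose d := Num.min (Num.min l k) (Num.min (r / 64) (e / 3 / M)).
have d0 : 0 < d.
  by rewrite !lt_min l0 k0 /=; apply/andP; split; [lra|exact: divr_gt0].
exists d => // h j; rewrite /d !lt_min => /andP[/andP[_ hk] /andP[h64 _]] /andP[/andP[jl _] /andP[j64 jM]].
have small (x : C) : normc x < r / 64 -> Sq (r / 16 / 4) x.
  by move=> hx; apply/andP; split; have := Re_le_normc x; have := Im_le_normc x; lra.
have c1 : normc (fw h j - fw h 0 - (fw 0 j - fw 0 0)) <= 2 * L2 * normc j * normc h.
  by apply: Cr; [apply: Sq_le (small _ j64); lra|exact: small].
have c2 := Hl _ jl; have c3 := Hk _ hk; rewrite !add0r in c2 c3 *.
have -> : fw h j - fw 0 0 - fww 0 0 * h - B * j =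
  (fw h j - fw h 0 - (fw 0 j - fw 0 0)) + (fw 0 j - fw 0 0 - B * j) +
  (fw h 0 - fw 0 0 - fww 0 0 * h) by ring.
have c4 : 2 * L2 * normc j * normc h <= e / 3 * normc h.
  apply: ler_wpM2r; first exact: normc_ge0.
  move: jM; rewrite ltr_pdivlMr// => jM.
  have : 2 * L2 * normc j <= M * normc j.
    by apply: ler_wpM2r; [exact: normc_ge0|rewrite /M; have := ler_norm (2 * L2); lra].
  lra.
have n1 := normc_ge0 h; have n2 := normc_ge0 j.
have m1 : 0 <= e * normc h by rewrite mulr_ge0// ltW.
have m2 : 0 <= e * normc j by rewrite mulr_ge0// ltW.
apply: (le_trans (normcD _ _)).
apply: le_trans; first by apply: lerD; [exact: normcD|exact: lexx].
lra.
Qed.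

Lemma cder2_shift f a b w z A B :
  cder2 (fun w z => f (a + w) (b + z)) w z A B <-> cder2 f (a + w) (b + z) A B.
Proof.
by split=> D e e0; have [l l0 Hl] := D e e0; exists l => // h k hl kl;
  have := Hl h k hl kl; rewrite !addrA.
Qed.

Lemma cder2_partial (V : C -> C -> Prop) f fw fz a b :
  (forall w z, V w z -> exists2 d, 0 < d &
     forall h k, normc h < d -> normc k < d -> V (w + h) (z + k)) ->
  (forall w z, V w z -> cder2 f w z (fw w z) (fz w z)) -> V a b ->
  exists A B, cder2 fw a b A B.
Proof.
move=> oV Df Vab.
have [d d0 Hd] := oV _ _ Vab.
have [l l0 Hl] := Df _ _ Vab 1 ltr01.
pose r := Num.min d l / 2.
have m0 : 0 < Num.min d l by rewrite lt_min d0.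
have r0 : 0 < r by rewrite divr_gt0.
have mn x : Sq r x -> normc x < d /\ normc x < l.
  move=> /andP[h1 h2].
  have : normc x < Num.min d l by have := normc_leD x; rewrite /r in h1 h2 *; lra.
  by rewrite lt_min => /andP[].
(* The local bound on [f] comes from its differentiability at the center with error constant 1. *)
pose K := normc (f a b) + normc (fw a b) * l + normc (fz a b) * l + (l + l).
have [||A [B D]] := @partial_cder2 (fun w z => f (a + w) (b + z)) (fun w z => fw (a + w) (b + z))
   (fun w z => fz (a + w) (b + z)) r K r0.
- move=> w z /mn[w1 _] /mn[z1 _]; apply/cder2_shift; apply: Df; exact: Hd.
- move=> w z /mn[_ w1] /mn[_ z1].
  have := Hl _ _ w1 z1; rewrite mul1r => H.
  have -> : f (a + w) (b + z) = (f (a + w) (b + z) - f a b - fw a b * w - fz a b * z)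
     + (f a b + (fw a b * w + fz a b * z)) by ring.
  apply: (le_trans (normcD _ _)).
  have n1 := normcD (f a b) (fw a b * w + fz a b * z).
  have n2 := normcD (fw a b * w) (fz a b * z).
  rewrite !normcMC in n2.
  have n3 : normc (fw a b) * normc w <= normc (fw a b) * l.
    by apply: ler_wpM2l; [exact: normc_ge0|exact: ltW].
  have n4 : normc (fz a b) * normc z <= normc (fz a b) * l.
    by apply: ler_wpM2l; [exact: normc_ge0|exact: ltW].
  rewrite /K; lra.
- exists A, B; rewrite -[a]addr0 -[b]addr0; exact/cder2_shift.
Qed.

End TwoVariables.

(** * Fréchet differentials as remainder estimates *)

Section Frechet.
Context {K : numFieldType} {V W : normedModType K}.

Lemma differentiable_eps (f : V -> W) x : differentiable f x ->
  forall e, 0 < e -> exists2 d, 0 < d & forall h, `|h| < d ->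
    `|f (x + h) - f x - 'd f x h| <= e * `|h|.
Proof.
move=> /diff_locally/eqaddoP H e e0; have := H e e0.
move=> /nbhs_norm0P[d /= d0 Hd]; exists d => // h /Hd /=.
rewrite -[X in `|X| <= _ -> _]/(f (h + x) - (f x + 'd f x h)).
by rewrite opprD addrA (addrC h).
Qed.

Lemma eps_differentiable (f : V -> W) (df : {linear V -> W}) x : continuous df ->
  (forall e, 0 < e -> exists2 d, 0 < d & forall h, `|h| < d ->
    `|f (x + h) - f x - df h| <= e * `|h|) ->
  differentiable f x /\ 'd f x = df :> (V -> W).
Proof.
move=> cdf H.
have E : f \o shift x = cst (f x) + df +o_ 0 id.
  apply/eqaddoP => e e0; have [d d0 Hd] := H e e0.
  apply/nbhs_norm0P; exists d => //= h /Hd.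
  rewrite -[X in _ -> `|X| <= _]/(f (h + x) - (f x + df h)).
  by rewrite opprD addrA (addrC h).
have D := diff_unique cdf E.
by split => //; apply/diff_locallyP; rewrite D.
Qed.

End Frechet.

(** * From complex differentials on C^2 to real partial derivatives on R^4 *)

Section Interface.
Variable R : realType.
Local Notation C := R[i].
Local Notation normc := (@Normc.normc R).
Local Notation C2 := (R[i]^o * R[i]^o)%type.
Local Notation nC2 := ((R[i]^o * R[i]^o)%type : normedModType R[i]).
Local Notation pt := 'rV[R]_4.
Implicit Types (f : C2 -> R[i]^o).

Lemma normCE (z : C) : `|z| = (normc z)%:C. Proof. by []. Qed.

Lemma gt0C (e : C) : 0 < e -> exists2 r : R, 0 < r & e = r%:C.
Proof.
by case: e => a b; rewrite ltcE /= => /andP[/eqP -> a0]; exists a.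
Qed.

Lemma normC2E (h : nC2) : `|h| = (Num.max (normc h.1) (normc h.2))%:C.
Proof. by rewrite prod_normE !normCE /Num.max ltcR /Num.max; case: ifP. Qed.

Lemma normC2_lt (h : nC2) (d : R) : (`|h| < d%:C) = (normc h.1 < d) && (normc h.2 < d).
Proof. by rewrite normC2E ltcR gt_max. Qed.

Definition lin2 (A B : C) (q : C2) : R[i]^o := A * q.1 + B * q.2.

Lemma lin2_linear A B : linear (lin2 A B).
Proof.
by move=> c p q; rewrite /lin2 /= /GRing.scale /=; ring.
Qed.

HB.instance Definition _ A B := GRing.isLinear.Build R[i] C2 R[i]^o _ (lin2 A B) (lin2_linear A B).

Lemma lin2_continuous A B : continuous (lin2 A B).
Proof.
move=> q; apply: (@continuousD _ _ _ (fun q : C2 => A * q.1 : R[i]^o) (fun q : C2 => B * q.2 : R[i]^o)).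
  by apply: (@continuousM _ _ (fun=> A : R[i]^o) (fun q : C2 => q.1)); [exact: cvg_cst|exact: cvg_fst].
by apply: (@continuousM _ _ (fun=> B : R[i]^o) (fun q : C2 => q.2)); [exact: cvg_cst|exact: cvg_snd].
Qed.

Lemma cder2_diff f a b A B : cder2 (fun w z => f (w, z)) a b A B ->
  [/\ differentiable f ((a, b) : nC2), d_dw f (a, b) = A & d_dz f (a, b) = B].
Proof.
move=> D.
have [] := @eps_differentiable _ _ _ f (lin2 A B) (a, b) (@lin2_continuous A B).
  move=> _ /gt0C[e e0 ->]; have e20 : 0 < e / 2 by lra.
  have [d d0 Hd] := D _ e20; exists d%:C; first by rewrite ltcR.
  move=> -[h k]; rewrite normC2_lt => /andP[/= hd kd].
  have := Hd _ _ hd kd.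
  rewrite normCE normC2E /= -rmorphM lecR opprD addrA => /le_trans; apply.
  have hm : normc h <= Num.max (normc h) (normc k) by rewrite le_max lexx.
  have km : normc k <= Num.max (normc h) (normc k) by rewrite le_max lexx orbT.
  have := @ler_wpM2l _ (e / 2) (ltW e20) _ _ (lerD hm km); lra.
move=> df dE; split => //.
  by rewrite /d_dw deriveE// dE /= /lin2 /= mulr1 mulr0 addr0.
by rewrite /d_dz deriveE// dE /= /lin2 /= mulr1 mulr0 add0r.
Qed.

Lemma diff_cder2 f a b : differentiable f (a, b) ->
  cder2 (fun w z => f (w, z)) a b (d_dw f (a, b)) (d_dz f (a, b)).
Proof.
move=> df e e0.
have e0C : 0 < e%:C :> C by rewrite ltcR.
have [_ /gt0C[d d0 ->] Hd] := differentiable_eps df e0C.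
exists d => // h k hd kd.
have hk : `|(h, k) : nC2| < d%:C by rewrite normC2_lt /= hd kd.
have := Hd _ hk.
have -> : 'd f (a, b) (h, k) = d_dw f (a, b) * h + d_dz f (a, b) * k.
  have -> : (h, k) = h *: ((1, 0) : C2) + k *: ((0, 1) : C2).
    by rewrite /GRing.scale /= /scale_pair /GRing.scale /=; congr (_, _);
      rewrite !(mulr1, mulr0, addr0, add0r).
  rewrite linearD !linearZ /d_dw /d_dz !deriveE//=.
  by congr (_ + _); exact: mulrC.
rewrite opprD addrA normCE normC2E /= -rmorphM lecR => /le_trans; apply.
by apply: ler_wpM2l; [exact: ltW|rewrite ge_max lerDl lerDr !normc_ge0].
Qed.

(** This closure is what makes jets of every order exist. [cder2_partial] treats the first variable
    only; the second is reached by exchanging the two. *)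
Lemma holomorphic_partials (U : set C2) f : open U -> holomorphic_on U f ->
  holomorphic_on U (d_dw f) /\ holomorphic_on U (d_dz f).
Proof.
move=> oU hf.
pose P (w z : C) := U (w, z).
have oP w z : P w z -> exists2 d, 0 < d &
     forall h k, normc h < d -> normc k < d -> P (w + h) (z + k).
  move=> Uwz; have /nbhs_normP[_ /gt0C[d d0 ->] Hd] : nbhs ((w, z) : C2) U by exact: open_nbhs_nbhs.
  exists d => // h k hd kd; apply: Hd => /=.
  by rewrite normC2_lt /= !opprD !addrA !subrr !sub0r !normcNC hd.
have D w z : P w z -> cder2 (fun w z => f (w, z)) w z (d_dw f (w, z)) (d_dz f (w, z)).
  by move=> Uwz; exact/diff_cder2/hf.
split=> -[a b] Uab.
  have [A [B]] := cder2_partial oP D Uab.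
  by move=> /(@cder2_diff (d_dw f))[].
have [||//|A [B]] := @cder2_partial R (fun z w => P w z) (fun z w => f (w, z))
   (fun z w => d_dz f (w, z)) (fun z w => d_dw f (w, z)) b a.
- by move=> z w /oP[d d0 Hd]; exists d => // h k hd kd; exact: Hd.
- by move=> z w /D/cder2_sym.
- by move=> /cder2_sym /(@cder2_diff (d_dz f))[].
Qed.

Lemma sum4 (V : nmodType) (F : 'I_4 -> V) : \sum_i F i = F 0 + F 1 + F 2%:R + F 3%:R.
Proof.
rewrite !big_ord_recl big_ord0 addr0 !addrA.
by congr (_ + _ + _ + _); congr (F _); apply/val_inj.
Qed.

Definition lin4 (A : 'I_4 -> R) (x : pt) : R := \sum_i A i * x 0 i.

Lemma lin4_linear A : linear (lin4 A).
Proof.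
move=> c p q; rewrite /lin4 scaler_sumr -big_split/=; apply: eq_bigr => i _.
by rewrite !mxE /GRing.scale /=; ring.
Qed.

HB.instance Definition _ A := GRing.isLinear.Build R pt R _ (lin4 A) (lin4_linear A).

Lemma lin4_continuous A : continuous (lin4 A).
Proof.
have cc i : continuous (fun x : pt => A i * x 0 i).
  by move=> x; apply: (@continuousM _ _ (fun=> A i) (fun x : pt => x 0 i)); [exact: cst_continuous|exact: coord_continuous].
rewrite (_ : lin4 A = fun x : pt => A 0 * x 0 0 + A 1 * x 0 1 + A 2%:R * x 0 2%:R + A 3%:R * x 0 3%:R).
  move=> x; exact: (continuousD (continuousD (continuousD (cc 0 x) (cc 1 x)) (cc 2%:R x)) (cc 3%:R x)).
by apply/funext => x; rewrite /lin4 sum4.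
Qed.

Lemma eps_differentiable4 (F : pt -> R) (A : 'I_4 -> R) x :
  (forall e, 0 < e -> exists2 d, 0 < d & forall h : pt, `|h| < d ->
    `|F (x + h) - F x - \sum_i A i * h 0 i| <= e * `|h|) ->
  differentiable F x /\ forall i, pd i F x = A i.
Proof.
move=> H.
have [d1 dE] := @eps_differentiable _ _ _ F (lin4 A) x (@lin4_continuous A) H.
split => // i; rewrite /pd deriveE// dE /= /lin4 (bigD1 i)//= big1 ?addr0.
  by rewrite mxE !eqxx mulr1.
by move=> j ji; rewrite mxE (negPf ji) andbF mulr0.
Qed.

Lemma coord_le_norm (h : pt) i : `|h 0 i| <= `|h|.
Proof. by rewrite [leRHS]mx_normrE; apply: (le_bigmax _ (fun i => `|h i.1 i.2|) (0, i)). Qed.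

Definition row4 (a b c d : R) (i : 'I_4) : R := nth 0 [:: a; b; c; d] i.

Lemma sum_row4 (a b c d : R) (h : pt) : \sum_i row4 a b c d i * h 0 i =
  a * h 0 0 + b * h 0 1 + c * h 0 2%:R + d * h 0 3%:R.
Proof. by rewrite sum4. Qed.

Lemma Re_affine (p q A B : C) a b c d : complex.Re q - complex.Re p -
    (complex.Re A * a + - complex.Im A * b + complex.Re B * c + - complex.Im B * d) =
  complex.Re (q - p - A * (a +i* b) - B * (c +i* d)).
Proof. by case: p q A B => [? ?] [? ?] [? ?] [? ?] /=; ring. Qed.

Lemma Im_affine (p q A B : C) a b c d : complex.Im q - complex.Im p -
    (complex.Im A * a + complex.Re A * b + complex.Im B * c + complex.Re B * d) =
  complex.Im (q - p - A * (a +i* b) - B * (c +i* d)).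
Proof. by case: p q A B => [? ?] [? ?] [? ?] [? ?] /=; ring. Qed.

(** The Cauchy-Riemann equations in each variable: the four real partials of each part are, up to
    sign, parts of the two complex derivatives. Differentiation therefore never leaves the jets of
    [f]. *)
Lemma holomorphic_wz f x : differentiable f (wz x) ->
  let A := d_dw f (wz x) in let B := d_dz f (wz x) in
  [/\ differentiable (fun y => complex.Re (f (wz y))) x,
      differentiable (fun y => complex.Im (f (wz y))) x,
      forall i, pd i (fun y => complex.Re (f (wz y))) x =
        row4 (complex.Re A) (- complex.Im A) (complex.Re B) (- complex.Im B) i &
      forall i, pd i (fun y => complex.Im (f (wz y))) x =
        row4 (complex.Im A) (complex.Re A) (complex.Im B) (complex.Re B) i].
Proof.
move=> /diff_cder2 D A B.
have H e : 0 < e -> exists2 d, 0 < d & forall h : pt, `|h| < d ->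
   normc (f (wz (x + h)) - f (wz x) - A * (h 0 0 +i* h 0 1) - B * (h 0 2%:R +i* h 0 3%:R)) <= e * `|h|.
  move=> e0; have e40 : 0 < e / 4 by lra.
  have [d d0 Hd] := D _ e40; exists (d / 2); first lra.
  move=> h hd.
  have c0 := coord_le_norm h 0; have c1 := coord_le_norm h 1.
  have c2 := coord_le_norm h 2%:R; have c3 := coord_le_norm h 3%:R.
  have n1 : normc (h 0 0 +i* h 0 1) <= 2 * `|h| by apply: (le_trans (normc_leD _)) => /=; lra.
  have n2 : normc (h 0 2%:R +i* h 0 3%:R) <= 2 * `|h| by apply: (le_trans (normc_leD _)) => /=; lra.
  have -> : wz (x + h) = (x 0 0 +i* x 0 1 + (h 0 0 +i* h 0 1),
     x 0 2%:R +i* x 0 3%:R + (h 0 2%:R +i* h 0 3%:R)) by rewrite /wz !mxE.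
  apply: le_trans (Hd _ _ _ _) _; [lra|lra|].
  have := @ler_wpM2l _ (e / 4) (ltW e40) _ _ (lerD n1 n2); lra.
have [|d1 e1] := @eps_differentiable4 (fun y => complex.Re (f (wz y)))
  (row4 (complex.Re A) (- complex.Im A) (complex.Re B) (- complex.Im B)) x.
  move=> e e0; have [d d0 Hd] := H _ e0; exists d => // h /Hd; apply: le_trans.
  by apply: le_trans (Re_le_normc _); rewrite sum_row4 Re_affine.
have [|d2 e2] := @eps_differentiable4 (fun y => complex.Im (f (wz y)))
  (row4 (complex.Im A) (complex.Re A) (complex.Im B) (complex.Re B)) x.
  move=> e e0; have [d d0 Hd] := H _ e0; exists d => // h /Hd; apply: le_trans.
  by apply: le_trans (Im_le_normc _); rewrite sum_row4 Im_affine.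
by split.
Qed.

End Interface.

(** * Symmetry of second partial derivatives *)

Section Schwarz.
Variable R : realType.
Local Notation pt := 'rV[R]_4.
Implicit Types (F : pt -> R) (x y : pt) (i j : 'I_4).

Lemma norm_unit_row i : `|('e_i : pt)| <= 1.
Proof.
rewrite [leLHS]mx_normrE; apply: bigmax_le => // -[a b] _ /=.
by rewrite mxE; case: (_ && _); rewrite ?normr1 ?normr0.
Qed.

Lemma is_derive_line F y i t : differentiable F (y + t *: 'e_i) ->
  is_derive t 1 (fun s => F (y + s *: 'e_i)) (pd i F (y + t *: 'e_i)).
Proof.
move=> dF; apply/is_derive_epsP => e e0; have [d d0 Hd] := differentiable_eps dF e0.
exists d => // h hd.
have nh : `|h *: ('e_i : pt)| <= `|h|.
  by rewrite normrZ ler_piMr// norm_unit_row.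
have := Hd (h *: 'e_i) (le_lt_trans nh hd).
rewrite linearZ /= -deriveE// -/(pd i F _) scalerDl addrA => /le_trans.
by rewrite /GRing.scale /= (mulrC h); apply; apply: ler_wpM2l => //; exact: ltW.
Qed.

Definition second_difference F x i j (s : R) :=
  F (x + s *: 'e_i + s *: 'e_j) - F (x + s *: 'e_i) - F (x + s *: 'e_j) + F x.

Lemma second_difference_sym F x i j s :
  second_difference F x i j s = second_difference F x j i s.
Proof. by rewrite /second_difference (addrAC x (s *: 'e_j)); ring. Qed.

(** The mean value theorem in direction [i] reduces to a difference of two values of [pd i F], each
    expanded at [x] by differentiability there. The displacements are at most [2 * s] and [s],
    whence the 3. *)
Lemma second_difference_le F x i j (r : R) : 0 < r ->
  (forall h : pt, `|h| < r -> differentiable F (x + h)) ->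
  differentiable (pd i F) x ->
  forall e, 0 < e -> exists2 d, 0 < d & forall s, 0 < s < d ->
    `|second_difference F x i j s - s ^+ 2 * pd j (pd i F) x| <= 3 * e * s ^+ 2.
Proof.
move=> r0 dF dG e e0; have [d d0 Hd] := differentiable_eps dG e0.
exists (Num.min (d / 2) (r / 2)); first by rewrite lt_min !divr_gt0.
move=> s; rewrite lt_min => /andP[s0 /andP[sd sr]].
have nb c : 0 <= c <= s -> `|c *: ('e_i : pt)| <= s.
  move=> /andP[c0 cs]; rewrite normrZ ger0_norm//; apply: le_trans cs.
  by rewrite ler_piMr// norm_unit_row.
have nbj : `|s *: ('e_j : pt)| <= s.
  by rewrite normrZ gtr0_norm// ler_piMr ?norm_unit_row// ltW.
have nbij c : 0 <= c <= s -> `|c *: ('e_i : pt) + s *: 'e_j| <= 2 * s.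
  by move=> /nb h; apply: (le_trans (ler_normD _ _)); have := nbj; lra.
pose phi c := F ((x + s *: 'e_j) + c *: 'e_i) - F (x + c *: 'e_i).
pose dphi c := pd i F ((x + s *: 'e_j) + c *: 'e_i) - pd i F (x + c *: 'e_i).
have Dphi c : 0 <= c <= s -> is_derive c 1 phi (dphi c).
  move=> cs; apply: is_deriveB; apply: is_derive_line.
    rewrite -addrA; apply: dF; rewrite addrC; apply: (le_lt_trans (nbij _ cs)); lra.
  by apply: dF; apply: (le_lt_trans (nb _ cs)); lra.
have [||c cs E] := @MVT_segment R phi dphi 0 s (ltW s0).
- by move=> c /itvP cs; apply: Dphi; rewrite !cs.
- apply: derivable_within_continuous => c /itvP cs.
  by have [] : is_derive c 1 phi (dphi c) by apply: Dphi; rewrite !cs.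
have {}cs : 0 <= c <= s by rewrite !(itvP cs).
have -> : second_difference F x i j s = dphi c * s.
  rewrite -[s in RHS](subr0 s) -E /phi /second_difference !scale0r !addr0.
  by rewrite (addrAC x); ring.
have H1 := Hd _ (le_lt_trans (nb _ cs) (lt_trans (lt_le_trans sd (lexx _)) _)).
have {}H1 : `|pd i F (x + c *: 'e_i) - pd i F x - 'd (pd i F) x (c *: 'e_i)| <= e * s.
  apply: (le_trans (H1 _)); first lra.
  by apply: ler_wpM2l; [exact: ltW|exact: nb].
have H2 : `|pd i F (x + (c *: 'e_i + s *: 'e_j)) - pd i F x - 'd (pd i F) x (c *: 'e_i + s *: 'e_j)| <= e * (2 * s).
  apply: (le_trans (Hd _ _)); first by apply: (le_lt_trans (nbij _ cs)); lra.
  by apply: ler_wpM2l; [exact: ltW|exact: nbij].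
have -> : dphi c * s - s ^+ 2 * pd j (pd i F) x = (dphi c - s * pd j (pd i F) x) * s by ring.
rewrite normrM (gtr0_norm s0) expr2 mulrA; apply: ler_wpM2r; first exact: ltW.
have -> : dphi c - s * pd j (pd i F) x =
  (pd i F (x + (c *: 'e_i + s *: 'e_j)) - pd i F x - 'd (pd i F) x (c *: 'e_i + s *: 'e_j))
  - (pd i F (x + c *: 'e_i) - pd i F x - 'd (pd i F) x (c *: 'e_i)).
  rewrite linearD !linearZ /= -(@deriveE _ _ _ _ _ 'e_j dG) -/(pd j _ _) /dphi.
  rewrite (_ : x + (c *: 'e_i + s *: 'e_j) = x + s *: 'e_j + c *: 'e_i).
    rewrite /GRing.scale /=; ring.
  by rewrite (addrC (c *: _)) addrA.
by apply: (le_trans (ler_normB _ _)); lra.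
Qed.

Lemma quadratic_coefficient_unique (D : R -> R) b c :
  (forall e, 0 < e -> exists2 d, 0 < d & forall s, 0 < s < d ->
    `|D s - s ^+ 2 * b| <= 3 * e * s ^+ 2) ->
  (forall e, 0 < e -> exists2 d, 0 < d & forall s, 0 < s < d ->
    `|D s - s ^+ 2 * c| <= 3 * e * s ^+ 2) -> b = c.
Proof.
move=> Hb Hc; apply/eqP; rewrite -subr_eq0 -normr_le0 leNgt; apply/negP.
set N := `|_| => N0.
have e0 : 0 < N / 12 by lra.
have [d1 d10 H1] := Hb _ e0; have [d2 d20 H2] := Hc _ e0.
pose s := Num.min d1 d2 / 2.
have m0 : 0 < Num.min d1 d2 by rewrite lt_min d10.
have m1 : Num.min d1 d2 <= d1 by rewrite ge_min lexx.
have m2 : Num.min d1 d2 <= d2 by rewrite ge_min lexx orbT.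
have s0 : 0 < s by rewrite /s; lra.
have {}H1 : `|D s - s ^+ 2 * b| <= 3 * (N / 12) * s ^+ 2 by apply: H1; rewrite s0 /s; lra.
have {}H2 : `|D s - s ^+ 2 * c| <= 3 * (N / 12) * s ^+ 2 by apply: H2; rewrite s0 /s; lra.
have : N * s ^+ 2 <= N / 2 * s ^+ 2.
  rewrite {1}/N -[s ^+ 2 in leLHS]ger0_norm ?sqr_ge0// -normrM.
  have -> : (b - c) * s ^+ 2 = (D s - s ^+ 2 * c) - (D s - s ^+ 2 * b) by ring.
  by apply: (le_trans (ler_normB _ _)); lra.
have s20 : 0 < s ^+ 2 by rewrite exprn_gt0.
by rewrite ler_pM2r//; lra.
Qed.

(** Both mixed derivatives are the coefficient of [s ^ 2] in the same second difference, which is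
    symmetric in [i] and [j]. *)
Lemma schwarz F x i j (r : R) : 0 < r ->
  (forall h : pt, `|h| < r -> differentiable F (x + h)) ->
  differentiable (pd i F) x -> differentiable (pd j F) x ->
  pd i (pd j F) x = pd j (pd i F) x.
Proof.
move=> r0 dF di dj.
apply: (@quadratic_coefficient_unique (second_difference F x j i)).
  exact: second_difference_le r0 dF dj.
move=> e e0; have [d d0 Hd] := second_difference_le j r0 dF di e0.
by exists d => // s /Hd; rewrite (second_difference_sym F x j i).
Qed.

End Schwarz.

Notation Q := QArith_base.Q.
Notation Z := BinNums.Z.
Notation positive := BinNums.positive.

(** * Formal differential polynomials *)

(* [JR a b] and [JI a b] stand for the real and imaginary parts of d_w^a d_z^b f, and
   [JS a b c d] for the partial derivative of the conformal factor of multiindex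
   (a, b, c, d). *)
Inductive jvar := JR of nat & nat | JI of nat & nat | JS of nat & nat & nat & nat.

Definition jcode (v : jvar) : seq nat := match v with
  | JR a b => [:: 0; a; b]%N | JI a b => [:: 1; a; b]%N
  | JS a b c d => [:: 2; a; b; c; d]%N end.

Fixpoint seqcmp (s t : seq nat) : comparison :=
  match s, t with
  | [::], [::] => Eq | [::], _ => Lt | _, [::] => Gt
  | a :: s, b :: t => match PeanoNat.Nat.compare a b with Eq => seqcmp s t | c => c end
  end.

Definition jcmp v w := seqcmp (jcode v) (jcode w).

Fixpoint lcmp (s t : seq jvar) : comparison :=
  match s, t with
  | [::], [::] => Eq | [::], _ => Lt | _, [::] => Gt
  | a :: s, b :: t => match jcmp a b with Eq => lcmp s t | c => c end
  end.

(* [(e, s, l)] stands for E^e S^s times the product of l, where E = expR (2 * Re f) and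
   S is the conformal factor. *)
Definition mono := (Z * Z * seq jvar)%type.

Definition mcmp (m n : mono) := match BinInt.Z.compare m.1.1 n.1.1 with
  | Eq => match BinInt.Z.compare m.1.2 n.1.2 with Eq => lcmp m.2 n.2 | c => c end
  | c => c end.

Fixpoint jins (v : jvar) (s : seq jvar) := match s with
  | [::] => [:: v] | w :: t => if jcmp v w is Gt then w :: jins v t else v :: s end.

Definition mmul (m n : mono) : mono :=
  (BinInt.Z.add m.1.1 n.1.1, BinInt.Z.add m.1.2 n.1.2, foldr jins n.2 m.2).

(* Kept sorted by monomials, without zero coefficients, so that identities between
   differential polynomials become equalities of lists. *)
Definition dpoly := seq (Q * mono).

Fixpoint padd1 (c : Q) (m : mono) (p : dpoly) : dpoly := match p with
  | [::] => [:: (c, m)]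
  | (d, n) :: q => match mcmp m n with
      | Eq => let e := Qreduction.Qred (QArith_base.Qplus c d) in
              if QArith_base.Qnum e is BinNums.Z0 then q else (e, n) :: q
      | Lt => (c, m) :: p
      | Gt => (d, n) :: padd1 c m q end
  end.

Definition padd (p q : dpoly) := foldr (fun t r => padd1 t.1 t.2 r) q p.

Definition pmul1 (c : Q) (m : mono) (p : dpoly) : dpoly :=
  foldr (fun t r => padd1 (Qreduction.Qred (QArith_base.Qmult c t.1)) (mmul m t.2) r) [::] p.

Definition pmul (p q : dpoly) := foldr (fun t r => padd (pmul1 t.1 t.2 q) r) [::] p.

Definition pscal (c : Q) (p : dpoly) : dpoly := if QArith_base.Qnum c is BinNums.Z0 then [::] else
  [seq (Qreduction.Qred (QArith_base.Qmult c t.1), t.2) | t <- p].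

Definition qfrac (a : int) (b : nat) : Q :=
  QArith_base.Qmake (Z_of_int a) (BinPos.Pos.of_nat b).
Definition q1 := qfrac 1 1.
Definition qN1 := qfrac (- 1) 1.

Definition psub p q := padd p (pscal qN1 q).

Local Arguments Qreduction.Qred : simpl never.
Local Arguments QArith_base.Qplus : simpl never.
Local Arguments QArith_base.Qmult : simpl never.

(** * Soundness of the polynomial operations *)

Section Evaluation.
Variable F : numFieldType.
Variables (vE vS : F) (ev : jvar -> F).
Hypotheses (vE0 : vE != 0) (vS0 : vS != 0).

Definition zr (z : Z) : F := (int_of_Z z)%:~R.
Definition qr (q : Q) : F :=
  zr (QArith_base.Qnum q) / zr (BinNums.Zpos (QArith_base.Qden q)).
Definition evall (s : seq jvar) : F := \prod_(v <- s) ev v.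
Definition evalm (m : mono) : F :=
  vE ^ int_of_Z m.1.1 * vS ^ int_of_Z m.1.2 * evall m.2.
Definition evalp (p : dpoly) : F := \sum_(t <- p) qr t.1 * evalm t.2.

Lemma zrD a b : zr (BinInt.Z.add a b) = zr a + zr b.
Proof. by rewrite /zr -rmorphD; congr (_%:~R); exact: (rmorphD int_of_Z). Qed.
Lemma zrM a b : zr (BinInt.Z.mul a b) = zr a * zr b.
Proof. by rewrite /zr -rmorphM; congr (_%:~R); exact: (rmorphM int_of_Z). Qed.
Lemma zrpos p : zr (BinNums.Zpos p) != 0.
Proof.
rewrite /zr intr_eq0 -(inj_eq (can_inj Z_of_intK)) int_of_ZK.
by apply/eqP.
Qed.

Lemma qr_eq a b : QArith_base.Qeq a b -> qr a = qr b.
Proof.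
move=> /(congr1 zr); rewrite !zrM /qr => E.
by apply/eqP; rewrite eqr_div ?zrpos// E.
Qed.

Lemma qrD a b : qr (QArith_base.Qplus a b) = qr a + qr b.
Proof.
rewrite /qr /QArith_base.Qplus /= zrD !zrM -[BinNums.Zpos (BinPos.Pos.mul _ _)]/(BinInt.Z.mul (BinNums.Zpos _) (BinNums.Zpos _)) zrM.
by rewrite addf_div ?zrpos.
Qed.

Lemma qrM a b : qr (QArith_base.Qmult a b) = qr a * qr b.
Proof.
rewrite /qr /QArith_base.Qmult /= !zrM -[BinNums.Zpos (BinPos.Pos.mul _ _)]/(BinInt.Z.mul (BinNums.Zpos _) (BinNums.Zpos _)) zrM.
by rewrite mulf_div.
Qed.

Lemma qr_red a : qr (Qreduction.Qred a) = qr a.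
Proof. exact/qr_eq/Qreduction.Qred_correct. Qed.

Lemma qr_num0 q : QArith_base.Qnum q = BinNums.Z0 -> qr q = 0.
Proof. by rewrite /qr => ->; rewrite /zr /= mul0r. Qed.

(** Soundness of merging like monomials rests on this implication, for each of the comparisons; the
    order itself only shapes the normal form. *)
Lemma seqcmp_eq s t : seqcmp s t = Eq -> s = t.
Proof.
elim: s t => [|a s IH] [|b t]//=.
by case E: PeanoNat.Nat.compare => // /IH ->; rewrite (PeanoNat.Nat.compare_eq _ _ E).
Qed.

Lemma jcmp_eq v w : jcmp v w = Eq -> v = w.
Proof.
move=> /seqcmp_eq; case: v => [a b|a b|a b c d]; case: w => [a' b'|a' b'|a' b' c' d'] //=;
  by case=> *; subst.
Qed.

Lemma lcmp_eq s t : lcmp s t = Eq -> s = t.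
Proof.
elim: s t => [|a s IH] [|b t]//=.
by case E: jcmp => // /IH ->; rewrite (jcmp_eq E).
Qed.

Lemma mcmp_eq m n : mcmp m n = Eq -> m = n.
Proof.
case: m n => [[a b] s] [[c d] t]; rewrite /mcmp /=.
case E1: BinInt.Z.compare => //; case E2: BinInt.Z.compare => // /lcmp_eq ->.
by rewrite (BinInt.Z.compare_eq _ _ E1) (BinInt.Z.compare_eq _ _ E2).
Qed.

Lemma evall_jins v s : evall (jins v s) = ev v * evall s.
Proof.
rewrite /evall; elim: s => [|w s IH] /=; first by rewrite big_cons.
by case: jcmp; rewrite !big_cons// IH mulrCA.
Qed.

Lemma evalm_mul m n : evalm (mmul m n) = evalm m * evalm n.
Proof.
case: m n => [[a b] s] [[c d] t]; rewrite /evalm /mmul /=.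
rewrite -[int_of_Z (BinInt.Z.add a c)]/(int_of_Z (a + c)) rmorphD.
rewrite -[int_of_Z (BinInt.Z.add b d)]/(int_of_Z (b + d)) rmorphD !expfzDr//.
have -> : evall (foldr jins t s) = evall s * evall t.
  by elim: s => [|v s IH] /=; rewrite ?evall_jins ?IH /evall ?big_nil ?mul1r// big_cons mulrA.
ring.
Qed.

Lemma evalp_padd1 c m p : evalp (padd1 c m p) = qr c * evalm m + evalp p.
Proof.
rewrite /evalp; elim: p => [|[d n] q IH] /=; first by rewrite big_cons.
case E: mcmp; rewrite ?big_cons//=; last by rewrite IH addrCA.
set e := Qreduction.Qred _.
have qe : qr e = qr c + qr d by rewrite /e qr_red qrD.
rewrite -(mcmp_eq E) addrA -mulrDl -qe.
case N: (QArith_base.Qnum e) => [|z|z]; rewrite ?big_cons//.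
by rewrite (qr_num0 N) mul0r add0r.
Qed.

Lemma evalp_padd p q : evalp (padd p q) = evalp p + evalp q.
Proof.
rewrite /padd; elim: p => [|t p IH] /=; first by rewrite [evalp [::]]/evalp big_nil add0r.
by rewrite evalp_padd1 IH addrA; congr (_ + _); rewrite /evalp big_cons.
Qed.

Lemma evalp_pmul1 c m p : evalp (pmul1 c m p) = qr c * evalm m * evalp p.
Proof.
rewrite /pmul1; elim: p => [|t p IH] /=; first by rewrite /evalp !big_nil mulr0.
by rewrite evalp_padd1 IH qr_red qrM evalm_mul /evalp big_cons; ring.
Qed.

Lemma evalp_pmul p q : evalp (pmul p q) = evalp p * evalp q.
Proof.
rewrite /pmul; elim: p => [|t p IH] /=; first by rewrite /evalp !big_nil mul0r.
by rewrite evalp_padd IH evalp_pmul1 -mulrDl; congr (_ * _); rewrite /evalp big_cons.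
Qed.

Lemma evalp_pscal c p : evalp (pscal c p) = qr c * evalp p.
Proof.
rewrite /pscal; case N: (QArith_base.Qnum c) => [|z|z].
- by rewrite (qr_num0 N) mul0r /evalp big_nil.
- rewrite /evalp big_map mulr_sumr; apply: eq_bigr => t _ /=.
  by rewrite qr_red qrM mulrA.
- rewrite /evalp big_map mulr_sumr; apply: eq_bigr => t _ /=.
  by rewrite qr_red qrM mulrA.
Qed.

Lemma qr_qfrac a b : qr (qfrac a b.+1) = a%:~R / b.+1%:R.
Proof.
rewrite /qr -[QArith_base.Qnum _]/(Z_of_int a) -[QArith_base.Qden _]/(BinPos.Pos.of_nat b.+1).
rewrite /zr Z_of_intK -[int_of_Z (BinNums.Zpos _)]/(Posz (BinPos.Pos.to_nat (BinPos.Pos.of_nat b.+1))).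
by rewrite Pnat.Nat2Pos.id.
Qed.

Lemma qrN1 : qr qN1 = -1.
Proof. by rewrite /qr /zr /= divr1. Qed.

Lemma evalp_psub p q : evalp (psub p q) = evalp p - evalp q.
Proof. by rewrite /psub evalp_padd evalp_pscal qrN1 mulN1r. Qed.

End Evaluation.

Definition zq (z : Z) : Q := QArith_base.Qmake z BinNums.xH.

(* By the Cauchy-Riemann equations, the derivative of a variable along a coordinate is
   again a variable, up to sign. *)
Definition jder (i : nat) (v : jvar) : Q * jvar := match v, i with
  | JR a b, 0 => (q1, JR a.+1 b) | JI a b, 0 => (q1, JI a.+1 b)
  | JR a b, 1 => (qN1, JI a.+1 b) | JI a b, 1 => (q1, JR a.+1 b)
  | JR a b, 2 => (q1, JR a b.+1) | JI a b, 2 => (q1, JI a b.+1)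
  | JR a b, _ => (qN1, JI a b.+1) | JI a b, _ => (q1, JR a b.+1)
  | JS a b c d, 0 => (q1, JS a.+1 b c d)
  | JS a b c d, 1 => (q1, JS a b.+1 c d)
  | JS a b c d, 2 => (q1, JS a b c.+1 d)
  | JS a b c d, _ => (q1, JS a b c d.+1) end%N.

Definition mono0 (s : seq jvar) : mono := (BinNums.Z0, BinNums.Z0, s).

Fixpoint lder (i : nat) (s : seq jvar) : dpoly := match s with
  | [::] => [::]
  | v :: t => let d := jder i v in
      padd1 d.1 (mono0 (jins d.2 t)) (pmul1 q1 (mono0 [:: v]) (lder i t)) end.

(** As [E = expR (2 * Re f)], deriving [E ^ e] keeps the power and gives the factor [2 * e] times a
    derivative of [Re f], hence [e + e]. Deriving [S ^ s] lowers the power by one and gives a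
    derivative of [S]. *)
Definition mder (i : nat) (m : mono) : dpoly :=
  let: (e, s, l) := m in
  let dE := jder i (JR 0 0) in let dS := jder i (JS 0 0 0 0) in
  padd (pscal (QArith_base.Qmult (zq (BinInt.Z.add e e)) dE.1) [:: (q1, (e, s, jins dE.2 l))])
  (padd (pscal (QArith_base.Qmult (zq s) dS.1) [:: (q1, (e, BinInt.Z.pred s, jins dS.2 l))])
        (pmul1 q1 (e, s, [::]) (lder i l))).

Lemma mderE i e s l : mder i (e, s, l) =
  padd (pscal (QArith_base.Qmult (zq (BinInt.Z.add e e)) (jder i (JR 0 0)).1)
          [:: (q1, (e, s, jins (jder i (JR 0 0)).2 l))])
  (padd (pscal (QArith_base.Qmult (zq s) (jder i (JS 0 0 0 0)).1)
          [:: (q1, (e, BinInt.Z.pred s, jins (jder i (JS 0 0 0 0)).2 l))])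
        (pmul1 q1 (e, s, [::]) (lder i l))).
Proof. by []. Qed.

Definition pder (i : nat) (p : dpoly) : dpoly :=
  foldr (fun t r => padd (pscal t.1 (mder i t.2)) r) [::] p.

(** * Differentiation rules and soundness of the formal derivative *)

Section PartialDerivatives.
Variable R : realType.
Local Notation pt := 'rV[R]_4.
Implicit Types (F G : pt -> R) (x : pt) (g h : 'I_4 -> R).

(** Differentiability travels with the partials, because the product, inverse and exponential rules
    consume it. *)
Definition has_pd F x g := differentiable F x /\ forall i, pd i F x = g i.

Lemma has_pd_ext F x g h : has_pd F x g -> g =1 h -> has_pd F x h.
Proof. by move=> [dF pF] gh; split => // i; rewrite pF gh. Qed.

Lemma has_pd_cst (c : R) x : has_pd (cst c) x (fun=> 0).
Proof. by split => [|i]; [exact: differentiable_cst|exact: derive_cst]. Qed.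

Lemma has_pdD F G x g h : has_pd F x g -> has_pd G x h ->
  has_pd (fun y => F y + G y) x (fun i => g i + h i).
Proof.
move=> [dF pF] [dG pG]; split; first exact: (@differentiableD _ _ _ F G).
by move=> i; rewrite -pF -pG /pd -(@deriveD _ _ _ F G)//; exact: diff_derivable.
Qed.

Lemma has_pdM F G x g h : has_pd F x g -> has_pd G x h ->
  has_pd (fun y => F y * G y) x (fun i => g i * G x + F x * h i).
Proof.
move=> [dF pF] [dG pG]; split; first exact: (@differentiableM _ _ F G).
move=> i; rewrite -pF -pG /pd (@deriveM _ _ F G); try exact: diff_derivable.
by rewrite /GRing.scale /= addrC mulrC.
Qed.

Lemma has_pdZ (c : R) F x g : has_pd F x g -> has_pd (fun y => c * F y) x (fun i => c * g i).
Proof.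
move=> H; apply: has_pd_ext (has_pdM (has_pd_cst c x) H) _ => i.
by rewrite mul0r add0r.
Qed.

Lemma has_pdX F x g n : has_pd F x g ->
  has_pd (fun y => F y ^+ n) x (fun i => n%:R * F x ^+ n.-1 * g i).
Proof.
move=> H; elim: n => [|n IH].
  by apply: has_pd_ext (has_pd_cst 1 x) _ => i; rewrite !mul0r.
rewrite (_ : (fun y => F y ^+ n.+1) = (fun y => F y * F y ^+ n)); last first.
  by apply/funext => y; rewrite exprS.
apply: has_pd_ext (has_pdM H IH) _ => i /=.
case: n {IH} => [|n] /=; first by rewrite expr0; ring.
by rewrite exprS -[n.+2%:R]natr1; ring.
Qed.

Lemma has_pdV F x g : F x != 0 -> has_pd F x g ->
  has_pd (fun y => (F y)^-1) x (fun i => - (F x) ^- 2 * g i).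
Proof.
move=> F0 [dF pF]; split; first exact: (@differentiableV _ _ F).
by move=> i; rewrite -pF /pd (@deriveV _ _ F)//; exact: diff_derivable.
Qed.

Lemma has_pd_exprz F x g (z : int) : F x != 0 -> has_pd F x g ->
  has_pd (fun y => F y ^ z) x (fun i => z%:~R * F x ^ (z - 1) * g i).
Proof.
move=> F0 H; case: z => n.
  apply: has_pd_ext (has_pdX n H) _ => i.
  case: n => [|n]; first by rewrite !mul0r.
  have -> : Posz n.+1 - 1 = n by rewrite intS addrC addKr.
  by [].
have Fn : F x ^+ n.+1 != 0 by rewrite expf_neq0.
apply: has_pd_ext (@has_pdV (fun y => F y ^+ n.+1) _ _ Fn (has_pdX n.+1 H)) _ => i /=.
rewrite NegzE mulrNz -opprD -PoszD addn1 -!exprnN.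
have -> : (n.+1 : int)%:~R = n.+1%:R :> R by [].
rewrite !exprS; field.
by rewrite F0 expf_neq0.
Qed.

Lemma has_pd_expR F x g : has_pd F x g ->
  has_pd (fun y => expR (F y)) x (fun i => expR (F x) * g i).
Proof.
move=> [dF pF].
have dE : differentiable (@expR R) (F x) by exact/derivable1_diffP/derivable_expR.
split; first exact: (@differentiable_comp _ _ _ _ F expR).
move=> i; rewrite -pF /pd !deriveE//; last exact: (@differentiable_comp _ _ _ _ F expR).
rewrite (@diff_comp _ _ _ _ F expR)//=.
rewrite (deriv1E _); last exact: derivable_expR.
have [_ h] := is_derive_expR (F x).
by rewrite derive1E h /GRing.scale /= mulrC.
Qed.

Lemma pd_near (V : set pt) F G x i : open V -> V x -> (forall y, V y -> F y = G y) ->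
  pd i F x = pd i G x.
Proof.
move=> oV Vx FG; apply: near_eq_derive.
by move: (open_nbhs_nbhs (conj oV Vx)); apply: filterS.
Qed.

Lemma differentiable_near (V : set pt) F G x : open V -> V x ->
  (forall y, V y -> F y = G y) -> differentiable F x -> differentiable G x.
Proof.
move=> oV Vx FG dF.
have /nbhs_normP[d /= d0 Hd] := open_nbhs_nbhs (conj oV Vx).
have [] // := @eps_differentiable _ _ _ G ('d F x) x (diff_continuous dF).
move=> e e0; have [l l0 Hl] := differentiable_eps dF e0.
exists (Num.min d l); first by rewrite lt_min d0.
move=> k; rewrite lt_min => /andP[kd kl]; rewrite -FG; last first.
  by apply: Hd => /=; rewrite opprD addrA subrr sub0r normrN.
by rewrite -FG//; exact: Hl.
Qed.

Section Formal.
Variables (vE vS : pt -> R) (ev : pt -> jvar -> R) (x : pt).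
Hypotheses (E0 : vE x != 0) (S0 : vS x != 0).
Let evp y := evalp (vE y) (vS y) (ev y).
Let dj i v := qr R (jder i v).1 * ev x (jder i v).2.
Hypothesis HE : has_pd vE x (fun i => 2 * vE x * dj i (JR 0 0)).
Hypothesis HS : has_pd vS x (fun i => dj i (JS 0 0 0 0)).
Hypothesis Hv : forall v, has_pd (ev^~ v) x (fun i => dj i v).

Lemma qr_q1 : qr R q1 = 1. Proof. by rewrite /qr /zr /= divr1. Qed.
Lemma qr_zq z : qr R (zq z) = zr R z. Proof. by rewrite /qr /zq /= /zr /= divr1. Qed.

Lemma has_pd_evall s : has_pd (fun y => evall (ev y) s) x (fun i => evp x (lder i s)).
Proof.
elim: s => [|v s IH].
  rewrite (_ : (fun y => _) = cst 1); last by apply/funext => y; rewrite /evall big_nil.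
  by apply: has_pd_ext (has_pd_cst 1 x) _ => i; rewrite /evp /evalp big_nil.
rewrite (_ : (fun y => _) = (fun y => ev y v * evall (ev y) s)); last first.
  by apply/funext => y; rewrite /evall big_cons.
apply: has_pd_ext (has_pdM (Hv v) IH) _ => i.
rewrite /evp /= evalp_padd1 evalp_pmul1// /evalm /= !expr0z !mul1r evall_jins qr_q1 mul1r.
by rewrite (_ : evall _ [:: v] = ev x v) ?mulrA// /evall big_seq1.
Qed.

Lemma has_pd_evalm m : has_pd (fun y => evalm (vE y) (vS y) (ev y) m) x
  (fun i => evp x (mder i m)).
Proof.
case: m => [[e s] l].
have H1 := has_pd_exprz (int_of_Z e) E0 HE.
have H2 := has_pd_exprz (int_of_Z s) S0 HS.
apply: has_pd_ext (has_pdM (has_pdM H1 H2) (has_pd_evall l)) _ => i.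
rewrite /evp mderE !evalp_padd !evalp_pscal evalp_pmul1// qr_q1 !qrM !qr_zq !mul1r.
have e1 c m : evalp (vE x) (vS x) (ev x) [:: (c, m)] = qr R c * evalm (vE x) (vS x) (ev x) m.
  by rewrite /evalp big_seq1.
rewrite !e1 qr_q1 !mul1r /evalm /= !evall_jins /dj zrD.
have -> : int_of_Z (BinInt.Z.pred s) = int_of_Z s - 1.
  by rewrite -[BinInt.Z.pred s]/(s + (-1))%R rmorphD.
rewrite -/(zr R e) -/(zr R s) (_ : evall _ [::] = 1) ?mulr1; last by rewrite /evall big_nil.
have -> : vE x ^ int_of_Z e = vE x ^ (int_of_Z e - 1) * vE x.
  by rewrite -[in RHS](expr1z (vE x)) -[in RHS]expfzDr ?expr1z// subrK.
move: (qr R (jder i (JR 0 0)).1) (ev x (jder i (JR 0 0)).2) => J1 J2.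
move: (qr R (jder i (JS 0 0 0 0)).1) (ev x (jder i (JS 0 0 0 0)).2) => J3 J4.
move: (vE x ^ _) (evalp _ _ _ _) (vS x ^ _) (vS x ^ _) (evall _ _) (zr R e) (zr R s).
by move=> X L Y T W p q; ring.
Qed.

Lemma has_pd_evalp p : has_pd (fun y => evp y p) x (fun i => evp x (pder i p)).
Proof.
elim: p => [|t p IH].
  rewrite (_ : (fun y => _) = cst 0); last by apply/funext => y; rewrite /evp /evalp big_nil.
  by apply: has_pd_ext (has_pd_cst 0 x) _ => i; rewrite /evp /evalp big_nil.
rewrite (_ : (fun y => _) = (fun y => qr R t.1 * evalm (vE y) (vS y) (ev y) t.2 + evp y p)); last first.
  by apply/funext => y; rewrite /evp /evalp big_cons.
apply: has_pd_ext (has_pdD (has_pdZ _ (has_pd_evalm t.2)) IH) _ => i.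
by rewrite /evp /= evalp_padd evalp_pscal.
Qed.

End Formal.
End PartialDerivatives.

(** * Jets of [f] and of the conformal factor *)

Section Jets.
Variable R : realType.
Local Notation C2 := (R[i]^o * R[i]^o)%type.
Local Notation pt := 'rV[R]_4.
Implicit Types (f g : C2 -> R[i]^o) (U : set C2) (V : set pt) (x y : pt).

Lemma wz_open U : open U -> open (@wz R @^-1` U).
Proof.
move=> oU; rewrite openE => x Ux.
have /nbhs_normP[_ /gt0C[d d0 ->] Hd] : nbhs (wz x) U by exact: open_nbhs_nbhs.
suff : nbhs x (@wz R @^-1` U) by [].
apply: (nbhs_normP x _).2; exists (d / 2); first by rewrite /= divr_gt0.
move=> y /= xy; apply: Hd => /=; rewrite normC2_lt.
have c i : `|x 0 i - y 0 i| <= `|x - y|.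
  by have := coord_le_norm (x - y) i; rewrite !mxE.
have c0 := c 0; have c1 := c 1; have c2 := c 2%:R; have c3 := c 3%:R.
by apply/andP; split; apply: (le_lt_trans (normc_leD _)) => /=; lra.
Qed.

Lemma wz_surj (q : C2) : exists x, wz x = q.
Proof.
case: q => -[a b] [c d]; exists (\row_i row4 a b c d i).
by rewrite /wz !mxE.
Qed.

Definition Re_at g x := complex.Re (g (wz x)).
Definition Im_at g x := complex.Im (g (wz x)).

Lemma has_pd_Re U g x : holomorphic_on U g -> U (wz x) -> has_pd (Re_at g) x
  (row4 (Re_at (d_dw g) x) (- Im_at (d_dw g) x) (Re_at (d_dz g) x) (- Im_at (d_dz g) x)).
Proof. by move=> hg Ux; have [d1 _ p1 _] := holomorphic_wz (hg _ Ux). Qed.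

Lemma has_pd_Im U g x : holomorphic_on U g -> U (wz x) -> has_pd (Im_at g) x
  (row4 (Im_at (d_dw g) x) (Re_at (d_dw g) x) (Im_at (d_dz g) x) (Re_at (d_dz g) x)).
Proof. by move=> hg Ux; have [_ d1 _ p1] := holomorphic_wz (hg _ Ux). Qed.

Lemma pd0_Re U g x : holomorphic_on U g -> U (wz x) -> pd 0 (Re_at g) x = Re_at (d_dw g) x.
Proof. by move=> hg Ux; exact: (has_pd_Re hg Ux).2. Qed.
Lemma pd2_Re U g x : holomorphic_on U g -> U (wz x) -> pd 2%:R (Re_at g) x = Re_at (d_dz g) x.
Proof. by move=> hg Ux; exact: (has_pd_Re hg Ux).2. Qed.
Lemma pd0_Im U g x : holomorphic_on U g -> U (wz x) -> pd 0 (Im_at g) x = Im_at (d_dw g) x.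
Proof. by move=> hg Ux; exact: (has_pd_Im hg Ux).2. Qed.
Lemma pd2_Im U g x : holomorphic_on U g -> U (wz x) -> pd 2%:R (Im_at g) x = Im_at (d_dz g) x.
Proof. by move=> hg Ux; exact: (has_pd_Im hg Ux).2. Qed.

Lemma schwarz_open V (F : pt -> R) i j x : open V -> V x ->
  (forall y, V y -> differentiable F y) ->
  differentiable (pd i F) x -> differentiable (pd j F) x ->
  pd i (pd j F) x = pd j (pd i F) x.
Proof.
move=> oV Vx dF; have /nbhs_normP[d /= d0 Hd] := open_nbhs_nbhs (conj oV Vx).
apply: schwarz d0 _ => h hd; apply: dF; apply: Hd => /=.
by rewrite opprD addrA subrr sub0r normrN.
Qed.

(** Real Schwarz for the coordinates 0 and 2, along which the partials of the parts of [g] are the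
    parts of [d_dw g] and [d_dz g]. *)
Lemma partials_commute U g q : open U -> holomorphic_on U g -> U q ->
  d_dz (d_dw g) q = d_dw (d_dz g) q.
Proof.
move=> oU hg; have [x <-] := wz_surj q => Ux.
have oM := wz_open oU; have [hw hz] := holomorphic_partials oU hg.
pose M := @wz R @^-1` U.
have pR i j (G H : C2 -> R[i]^o) : holomorphic_on U G -> holomorphic_on U H ->
    (forall y, M y -> pd i (Re_at g) y = Re_at G y) ->
    (forall y, M y -> pd j (Re_at g) y = Re_at H y) ->
    pd j (Re_at G) x = pd i (Re_at H) x.
  move=> hG hH eG eH.
  rewrite -(pd_near j oM Ux eG) -(pd_near i oM Ux eH).
  apply: (schwarz_open oM Ux) => [y My||]; first exact: (has_pd_Re hg My).1.
    apply: (differentiable_near oM Ux) (has_pd_Re hH Ux).1 => y My; exact/esym/eH.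
  apply: (differentiable_near oM Ux) (has_pd_Re hG Ux).1 => y My; exact/esym/eG.
have pI i j (G H : C2 -> R[i]^o) : holomorphic_on U G -> holomorphic_on U H ->
    (forall y, M y -> pd i (Im_at g) y = Im_at G y) ->
    (forall y, M y -> pd j (Im_at g) y = Im_at H y) ->
    pd j (Im_at G) x = pd i (Im_at H) x.
  move=> hG hH eG eH.
  rewrite -(pd_near j oM Ux eG) -(pd_near i oM Ux eH).
  apply: (schwarz_open oM Ux) => [y My||]; first exact: (has_pd_Im hg My).1.
    apply: (differentiable_near oM Ux) (has_pd_Im hH Ux).1 => y My; exact/esym/eH.
  apply: (differentiable_near oM Ux) (has_pd_Im hG Ux).1 => y My; exact/esym/eG.
have A : pd 2%:R (Re_at (d_dw g)) x = pd 0 (Re_at (d_dz g)) x.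
  exact: (pR 0 2%:R _ _ hw hz (fun y My => pd0_Re hg My) (fun y My => pd2_Re hg My)).
have B : pd 2%:R (Im_at (d_dw g)) x = pd 0 (Im_at (d_dz g)) x.
  exact: (pI 0 2%:R _ _ hw hz (fun y My => pd0_Im hg My) (fun y My => pd2_Im hg My)).
apply: eqC; first exact: eq_trans (esym (pd2_Re hw Ux)) (eq_trans A (pd0_Re hz Ux)).
exact: eq_trans (esym (pd2_Im hw Ux)) (eq_trans B (pd0_Im hz Ux)).
Qed.

(** With the [w]-derivatives outermost, [d_dw] raises [a] by definition; [d_dz] has to be moved
    inside, which is [d_dz_jet]. *)
Definition jet f a b := iter a (@d_dw R) (iter b (@d_dz R) f).

Lemma jet_holomorphic U f a b : open U -> holomorphic_on U f -> holomorphic_on U (jet f a b).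
Proof.
move=> oU hf; elim: a => [|a IH].
  by elim: b => [//|b IH]; exact: (holomorphic_partials oU IH).2.
exact: (holomorphic_partials oU IH).1.
Qed.

Lemma d_dw_near U f g q : open U -> U q -> (forall q, U q -> f q = g q) -> d_dw f q = d_dw g q.
Proof.
move=> oU Uq fg; apply: near_eq_derive.
by move: (open_nbhs_nbhs (conj oU Uq)); apply: filterS.
Qed.

Lemma d_dz_jet U f a b q : open U -> holomorphic_on U f -> U q ->
  d_dz (jet f a b) q = jet f a b.+1 q.
Proof.
move=> oU hf; elim: a q => [//|a IH] q Uq.
apply: (eq_trans (partials_commute oU (@jet_holomorphic U f a b oU hf) Uq)).
exact: (d_dw_near oU Uq (fun p Up => IH p Up)).
Qed.

Section Smooth.
Variables (V : set pt) (F : pt -> R).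
Hypotheses (oV : open V) (sF : smooth_on V F).

(** Moves a new derivative to its place in the sorted list [multi], so that it increments one entry
    of the multiindex. *)
Lemma smooth_swap (s t : seq 'I_4) i y : V y ->
  foldr (@pd R) F (i :: s ++ t) y = foldr (@pd R) F (s ++ i :: t) y.
Proof.
elim: s y => [//|j s IH] y Vy /=.
rewrite (schwarz_open oV Vy).
- by apply: (pd_near _ oV Vy) => z Vz; exact: (IH z Vz).
- by move=> z Vz; exact: sF.
- exact: (sF (i :: s ++ t)).
- exact: (sF (j :: s ++ t)).
Qed.

Definition multi a b c d : seq 'I_4 := nseq a 0 ++ nseq b 1 ++ nseq c 2%:R ++ nseq d 3%:R.

Definition dmulti a b c d : pt -> R := foldr (@pd R) F (multi a b c d).

Lemma has_pd_dmulti a b c d y : V y -> has_pd (dmulti a b c d) y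
  (row4 (dmulti a.+1 b c d y) (dmulti a b.+1 c d y) (dmulti a b c.+1 d y) (dmulti a b c d.+1 y)).
Proof.
move=> Vy; split; first exact: sF.
have S1 k i (s t : seq 'I_4) : foldr (@pd R) F (i :: s ++ t) y = foldr (@pd R) F (s ++ i :: t) y.
  exact: smooth_swap.
move=> i; rewrite -[pd i _ _]/(foldr (@pd R) F (i :: multi a b c d) y).
case: i => -[|[|[|[|//]]]] Hi.
- rewrite [row4 _ _ _ _ _]/(dmulti a.+1 b c d y) /dmulti /multi.
  by congr (foldr _ _ (_ :: _) _); exact/val_inj.
- rewrite [row4 _ _ _ _ _]/(dmulti a b.+1 c d y) /dmulti /multi smooth_swap//.
  by congr (foldr _ _ (_ ++ _ :: _) _); exact/val_inj.
- rewrite [row4 _ _ _ _ _]/(dmulti a b c.+1 d y) /dmulti /multi catA smooth_swap// -!catA.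
  by congr (foldr _ _ (_ ++ _ ++ _ :: _) _); exact/val_inj.
- rewrite [row4 _ _ _ _ _]/(dmulti a b c d.+1 y) /dmulti /multi 2!catA smooth_swap// -!catA.
  by congr (foldr _ _ (_ ++ _ ++ _ ++ _ :: _) _); exact/val_inj.
Qed.

End Smooth.

Section Environment.
Variables (U : set C2) (f : C2 -> R[i]^o) (V : set pt) (sg : pt -> R).
Hypotheses (oU : open U) (hf : holomorphic_on U f) (oV : open V).
Hypotheses (VU : V `<=` @wz R @^-1` U) (ssg : smooth_on V sg).
Hypothesis sg0 : forall y, V y -> sg y != 0.

Definition jE y := expR (2 * Re_at f y).

Definition jev y v := match v with
  | JR a b => Re_at (jet f a b) y
  | JI a b => Im_at (jet f a b) y
  | JS a b c d => dmulti sg a b c d y end.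

(** [sg] is instantiated by the constant 1 for [g] and by [Om] for its conformal multiples. *)
Definition jp (p : dpoly) y := evalp (jE y) (sg y) (jev y) p.

Lemma jE_neq0 y : jE y != 0. Proof. by rewrite gt_eqF// expR_gt0. Qed.

Lemma has_pd_jev v y : V y -> has_pd (jev^~ v) y (fun i => qr R (jder i v).1 * jev y (jder i v).2).
Proof.
move=> Vy; have Uy := VU Vy.
case: v => [a b|a b|a b c d].
- have H : has_pd (jev^~ (JR a b)) y _ := has_pd_Re (@jet_holomorphic U f a b oU hf) Uy.
  apply: (has_pd_ext H); rewrite {H}/Re_at /Im_at (@d_dz_jet U f a b (wz y) oU hf Uy) => i.
  by case: i => -[|[|[|[|//]]]] Hi; rewrite /row4 [LHS]/= ?qr_q1 ?qrN1 ?mul1r ?mulN1r.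
- have H : has_pd (jev^~ (JI a b)) y _ := has_pd_Im (@jet_holomorphic U f a b oU hf) Uy.
  apply: (has_pd_ext H); rewrite {H}/Re_at /Im_at (@d_dz_jet U f a b (wz y) oU hf Uy) => i.
  by case: i => -[|[|[|[|//]]]] Hi; rewrite /row4 [LHS]/= ?qr_q1 ?qrN1 ?mul1r ?mulN1r.
- apply: has_pd_ext (has_pd_dmulti oV ssg a b c d Vy) _ => i.
  by case: i => -[|[|[|[|//]]]] Hi; rewrite /row4 /= ?qr_q1 ?mul1r.
Qed.

Lemma has_pd_jp p y : V y -> has_pd (jp p) y (fun i => jp (pder i p) y).
Proof.
move=> Vy; apply: has_pd_evalp; [exact: jE_neq0|exact: sg0| | |by move=> v; exact: has_pd_jev].
  apply: has_pd_ext (has_pd_expR (has_pdZ 2 (has_pd_jev (JR 0 0) Vy))) _ => i.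
  by rewrite /jE /=; ring.
by apply: has_pd_ext (has_pd_jev (JS 0 0 0 0) Vy) _.
Qed.

(** Every iterated partial derivative of [jp p] coincides on [V] with some [jp q], which is
    differentiable. *)
Lemma smooth_jp p : smooth_on V (jp p).
Proof.
have E s : exists q, forall y, V y -> foldr (@pd R) (jp p) s y = jp q y.
  elim: s => [|i s [q IH]]; first by exists p.
  exists (pder i q) => y Vy /=; rewrite (pd_near i oV Vy IH).
  exact: (has_pd_jp q Vy).2.
move=> s y Vy; have [q Hq] := E s.
by apply: (differentiable_near oV Vy) (has_pd_jp q Vy).1 => z Vz; rewrite Hq.
Qed.

End Environment.
End Jets.

(** * Curvature as differential polynomials *)

Definition psum (F : nat -> dpoly) := padd (F 0%N) (padd (F 1%N) (padd (F 2%N) (F 3%N))).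

(** Tables memoize: under call by value, a partial application such as [get3 (tab3 F)] carries the
    evaluated table, and later uses of a component are lookups. *)
Definition tab1 (F : nat -> dpoly) := [:: F 0; F 1; F 2; F 3]%N.
Definition get1 t i : dpoly := nth [::] t i.
Definition tab2 (F : nat -> nat -> dpoly) := let t i := tab1 (F i) in [:: t 0; t 1; t 2; t 3]%N.
Definition get2 t i j := get1 (nth [::] t i) j.
Definition tab3 (F : nat -> nat -> nat -> dpoly) :=
  let t i := tab2 (F i) in [:: t 0; t 1; t 2; t 3]%N.
Definition get3 t i j k := get2 (nth [::] t i) j k.
Definition tab4 (F : nat -> nat -> nat -> nat -> dpoly) :=
  let t i := tab3 (F i) in [:: t 0; t 1; t 2; t 3]%N.
Definition get4 t i j k l := get3 (nth [::] t i) j k l.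

Lemma get1_tab F (i : 'I_4) : get1 (tab1 F) i = F i.
Proof. by case: i => -[|[|[|[|//]]]]. Qed.
Lemma get2_tab F (i j : 'I_4) : get2 (tab2 F) i j = F i j.
Proof. by rewrite -[RHS](get1_tab (F i)); case: i => -[|[|[|[|//]]]]. Qed.
Lemma get3_tab F (i j k : 'I_4) : get3 (tab3 F) i j k = F i j k.
Proof. by rewrite -[RHS](get2_tab (F i)); case: i => -[|[|[|[|//]]]]. Qed.
Lemma get4_tab F (i j k l : 'I_4) : get4 (tab4 F) i j k l = F i j k l.
Proof. by rewrite -[RHS](get3_tab (F i)); case: i => -[|[|[|[|//]]]]. Qed.

Section TensorPolys.
Variables Gp Ip : nat -> nat -> dpoly.

Definition chrP k i j := pscal (qfrac 1 2) (psum (fun l =>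
   pmul (Ip k l) (psub (padd (pder i (Gp j l)) (pder j (Gp i l))) (pder l (Gp i j))))).
Definition rupP (ch : nat -> nat -> nat -> dpoly) a b c d : dpoly :=
  padd (psub (pder c (ch a d b)) (pder d (ch a c b)))
   (psum (fun e => psub (pmul (ch a c e) (ch e d b)) (pmul (ch a d e) (ch e c b)))).
Definition ricP (ru : nat -> nat -> nat -> nat -> dpoly) a b := psum (fun c => ru c a c b).
Definition scalP (ri : nat -> nat -> dpoly) :=
  psum (fun a => psum (fun b => pmul (Ip a b) (ri a b))).
Definition schP (ri : nat -> nat -> dpoly) sc a b :=
  psub (pscal (qfrac 1 2) (ri a b)) (pmul (pscal (qfrac 1 12) sc) (Gp a b)).
Definition rieP (ru : nat -> nat -> nat -> nat -> dpoly) a b c d :=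
  psum (fun e => pmul (Gp a e) (ru e b c d)).
Definition weyP (rm : nat -> nat -> nat -> nat -> dpoly) (P : nat -> nat -> dpoly) a b c d :=
  psub (padd (psub (padd (rm a b c d) (pmul (Gp a d) (P c b))) (pmul (Gp a c) (P d b)))
    (pmul (Gp b c) (P d a))) (pmul (Gp b d) (P c a)).
Definition nab2P (ch : nat -> nat -> nat -> dpoly) (T : nat -> nat -> dpoly) c a b :=
  psub (pder c (T a b)) (psum (fun e => padd (pmul (ch e c a) (T e b)) (pmul (ch e c b) (T a e)))).
Definition nab3P (ch : nat -> nat -> nat -> dpoly) (T : nat -> nat -> nat -> dpoly) d a b c :=
  psub (pder d (T a b c)) (psum (fun e => padd (padd (pmul (ch e d a) (T e b c))
    (pmul (ch e d b) (T a e c))) (pmul (ch e d c) (T a b e)))).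
Definition cotP ch sh a b c := psub (nab2P ch sh b c a) (nab2P ch sh c b a).
Definition bacP ch (sh : nat -> nat -> dpoly) co (we : nat -> nat -> nat -> nat -> dpoly) a b :=
  padd (psum (fun c => psum (fun d => pmul (Ip c d) (nab3P ch co d a c b))))
   (psum (fun c => psum (fun d => pmul
      (psum (fun e => psum (fun h => pmul (pmul (Ip d e) (Ip c h)) (sh e h)))) (we d a c b)))).

Definition chT := get3 (tab3 chrP).
Definition ruT := get4 (tab4 (rupP chT)).
Definition riT := get2 (tab2 (ricP ruT)).
Definition shT := get2 (tab2 (schP riT (scalP riT))).
Definition rmT := get4 (tab4 (rieP ruT)).
Definition weT := get4 (tab4 (weyP rmT shT)).
Definition coT := get3 (tab3 (cotP chT shT)).
End TensorPolys.

(** * The curvature polynomials evaluate to the curvature tensors *)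

Section TensorEvaluation.
Variable R : realType.
Local Notation C2 := (R[i]^o * R[i]^o)%type.
Local Notation pt := 'rV[R]_4.
Variables (U : set C2) (f : C2 -> R[i]^o) (V : set pt) (sg : pt -> R).
Hypotheses (oU : open U) (hf : holomorphic_on U f) (oV : open V).
Hypotheses (VU : V `<=` @wz R @^-1` U) (ssg : smooth_on V sg).
Hypothesis sg0 : forall y, V y -> sg y != 0.
Local Notation jp := (jp f sg).
Variables (G : pt -> 'M[R]_4) (Gp Ip : nat -> nat -> dpoly).
Hypothesis hG : forall (i j : 'I_4) y, V y -> G y i j = jp (Gp i j) y.
Hypothesis hI : forall (i j : 'I_4) y, V y -> ginv G i j y = jp (Ip i j) y.

Lemma jpD p q y : jp (padd p q) y = jp p y + jp q y.
Proof. exact: evalp_padd. Qed.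
Lemma jpB p q y : jp (psub p q) y = jp p y - jp q y.
Proof. exact: evalp_psub. Qed.
Lemma jpM p q y : V y -> jp (pmul p q) y = jp p y * jp q y.
Proof. by move=> Vy; apply: evalp_pmul; [exact: jE_neq0|exact: sg0]. Qed.
Lemma jpZ c p y : jp (pscal c p) y = qr R c * jp p y.
Proof. exact: evalp_pscal. Qed.

Lemma jp_sum (F : 'I_4 -> R) (FP : nat -> dpoly) y : (forall l : 'I_4, F l = jp (FP l) y) ->
  \sum_l F l = jp (psum FP) y.
Proof. by move=> H; rewrite sum4 /psum !jpD !H !addrA. Qed.

Lemma jp_pd (F : pt -> R) p (i : 'I_4) y : V y -> (forall z, V z -> F z = jp p z) ->
  pd i F y = jp (pder i p) y.
Proof.
by move=> Vy H; rewrite (pd_near i oV Vy H); exact: (has_pd_jp oU hf oV VU ssg sg0 p Vy).2.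
Qed.

Lemma christoffelE (k i j : 'I_4) y : V y -> christoffel G k i j y = jp (chT Gp Ip k i j) y.
Proof.
move=> Vy; rewrite /chT get3_tab /christoffel /chrP jpZ qr_qfrac mul1r; congr (_ * _).
apply: jp_sum => l; rewrite jpM// jpB jpD hI//.
by congr (_ * (_ + _ - _)); apply: jp_pd => // z Vz; exact: hG.
Qed.

Lemma riemann_upE (a b c d : 'I_4) y : V y -> riemann_up G a b c d y = jp (ruT Gp Ip a b c d) y.
Proof.
move=> Vy; rewrite /ruT get4_tab /riemann_up /rupP jpD jpB; congr (_ - _ + _).
- by apply: jp_pd => // z Vz; exact: christoffelE.
- by apply: jp_pd => // z Vz; exact: christoffelE.
- by apply: jp_sum => e; rewrite jpB !jpM// !christoffelE.
Qed.

Lemma ricciE (a b : 'I_4) y : V y -> ricci G a b y = jp (riT Gp Ip a b) y.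
Proof. by move=> Vy; rewrite /riT get2_tab; apply: jp_sum => c; exact: riemann_upE. Qed.

Lemma scalarE y : V y -> scalar_curvature G y = jp (scalP Ip (riT Gp Ip)) y.
Proof.
by move=> Vy; apply: jp_sum => a; apply: jp_sum => b; rewrite jpM// hI// ricciE.
Qed.

Lemma schoutenE (a b : 'I_4) y : V y -> schouten G a b y = jp (shT Gp Ip a b) y.
Proof.
move=> Vy; rewrite /shT get2_tab /schouten /schP jpB jpM// !jpZ !qr_qfrac !mul1r.
by rewrite ricciE// scalarE// hG.
Qed.

Lemma riemannE (a b c d : 'I_4) y : V y -> riemann G a b c d y = jp (rmT Gp Ip a b c d) y.
Proof.
by move=> Vy; rewrite /rmT get4_tab; apply: jp_sum => e; rewrite jpM// hG// riemann_upE.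
Qed.

Lemma weylE (a b c d : 'I_4) y : V y -> weyl G a b c d y = jp (weT Gp Ip a b c d) y.
Proof.
move=> Vy; rewrite /weT get4_tab /weyl /weyP jpB jpD jpB jpD !jpM//.
by rewrite riemannE// !hG// !schoutenE.
Qed.

Lemma cottonE (a b c : 'I_4) y : V y -> cotton G a b c y = jp (coT Gp Ip a b c) y.
Proof.
move=> Vy; rewrite /coT get3_tab /cotton /cotP jpB /nabla2 /nab2P !jpB.
congr ((_ - _) - (_ - _)).
- by apply: jp_pd => // z Vz; exact: schoutenE.
- by apply: jp_sum => e; rewrite jpD !jpM// !christoffelE// !schoutenE.
- by apply: jp_pd => // z Vz; exact: schoutenE.
- by apply: jp_sum => e; rewrite jpD !jpM// !christoffelE// !schoutenE.
Qed.

Lemma bachE (a b : 'I_4) y : V y ->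
  bach G a b y = jp (bacP Ip (chT Gp Ip) (shT Gp Ip) (coT Gp Ip) (weT Gp Ip) a b) y.
Proof.
move=> Vy; rewrite /bach /bacP jpD; congr (_ + _); apply: jp_sum => c; apply: jp_sum => d;
  rewrite jpM//; congr (_ * _); rewrite ?hI// ?weylE//.
- rewrite /nabla3 /nab3P jpB; congr (_ - _).
    by apply: jp_pd => // z Vz; exact: cottonE.
  by apply: jp_sum => e; rewrite !jpD !jpM// !christoffelE// !cottonE.
- by apply: jp_sum => e; apply: jp_sum => h; rewrite !jpM// !hI// schoutenE.
Qed.

End TensorEvaluation.

(** * Four by four determinants *)

Section Det4.
Variable K : comPzRingType.

Lemma ord4P (P : 'I_4 -> Prop) : P 0 -> P 1 -> P 2%:R -> P 3%:R -> forall i, P i.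
Proof.
move=> p0 p1 p2 p3 [[|[|[|[|//]]]] Hi].
- by rewrite (_ : Ordinal Hi = 0)//; exact: val_inj.
- by rewrite (_ : Ordinal Hi = 1)//; exact: val_inj.
- by rewrite (_ : Ordinal Hi = 2%:R)//; exact: val_inj.
- by rewrite (_ : Ordinal Hi = 3%:R)//; exact: val_inj.
Qed.

(** Indices are natural numbers and a minor is a reindexed function, so the expansion computes down
    to entries. *)
Fixpoint laplace n (B : nat -> nat -> K) : K := match n with
  | 0%N => 1
  | n.+1 => \sum_(j < n.+1) (-1) ^+ j * B 0%N j * laplace n (fun i l => B i.+1 (bump j l))
  end.

Lemma laplaceE n (B : nat -> nat -> K) : \det (\matrix_(i < n, j < n) B i j) = laplace n B.
Proof.
elim: n B => [|n IH] B; first by rewrite det_mx00.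
rewrite (expand_det_row _ ord0) /=; apply: eq_bigr => j _.
rewrite /cofactor add0n mxE mulrA (mulrC (B _ _)) -IH; congr (_ * \det _).
by apply/matrixP => i l; rewrite !mxE.
Qed.

(** Laplace expansion along the first two rows: products of complementary two by two minors. *)
Definition det4 (A : nat -> nat -> K) : K :=
  let d2 i j k l := A i k * A j l - A i l * A j k in
  d2 0 1 0 1 * d2 2 3 2 3 - d2 0 1 0 2 * d2 2 3 1 3 + d2 0 1 0 3 * d2 2 3 1 2 +
  d2 0 1 1 2 * d2 2 3 0 3 - d2 0 1 1 3 * d2 2 3 0 2 + d2 0 1 2 3 * d2 2 3 0 1.

Lemma det4E (A : nat -> nat -> K) : \det (\matrix_(i < 4, j < 4) A i j) = det4 A.
Proof.
rewrite laplaceE /det4 /laplace !big_ord_recl !big_ord0 /bump /= /bump /=.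
rewrite !addn0 !addn1 /=; ring.
Qed.

End Det4.

Lemma det4_map (K L : comPzRingType) (phi : {rmorphism K -> L}) (A : nat -> nat -> K) :
  det4 (fun i j => phi (A i j)) = phi (det4 A).
Proof. by rewrite /det4 !(rmorphD, rmorphN, rmorphM). Qed.

(** * The metric and its conformal multiples in coordinates *)

Section ConcreteMetric.
Variable R : realType.
Local Notation C2 := (R[i]^o * R[i]^o)%type.
Local Notation pt := 'rV[R]_4.
Local Notation cvec := 'rV[R[i]]_4.
Local Notation Re := (@complex.Re R).
Local Notation Im := (@complex.Im R).

Lemma cexpD (a b : R[i]) : cexp (a + b) = cexp a * cexp b.
Proof.
case: a b => [a1 a2] [b1 b2]; rewrite /cexp /= expRD cosD sinD.
by apply: eqC; rewrite !ReImE /=; ring.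
Qed.

Lemma cexp0 : cexp (0 : R[i]) = 1.
Proof. by rewrite /cexp /= expR0 cos0 sin0 mul1r. Qed.

Lemma cexp_conjc (a : R[i]) : conjc (cexp a) = cexp (conjc a).
Proof. by case: a => a b; rewrite /cexp /= cosN sinN; apply: eqC => /=; ring. Qed.

Lemma cexpDconj (a : R[i]) : cexp (a + conjc a) = (expR (2 * Re a))%:C.
Proof.
case: a => a b; rewrite /cexp /= subrr cos0 sin0.
by apply: eqC; rewrite !ReImE /= ?mulr0 ?mulr1 ?mul0r ?subr0 ?addr0// mulr_natl mulr2n.
Qed.

Lemma mulii : 'i * 'i = -1 :> R[i].
Proof. by rewrite -expr2 sqr_i. Qed.

Lemma gform_coord f y (X Y : cvec) : gform f y X Y =
  2 * (X 0 0 * Y 0 0 + X 0 1 * Y 0 1) +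
  2 * (jE f y)%:C * (X 0 2%:R * Y 0 2%:R + X 0 3%:R * Y 0 3%:R).
Proof.
rewrite /gform cexpDconj -/(jE f y) /symprod /dw /dwb /dz /dzb.
move: (X 0 0) (X 0 1) (X 0 2%:R) (X 0 3%:R) (Y 0 0) (Y 0 1) (Y 0 2%:R) (Y 0 3%:R).
move=> a b c d a' b' c' d'; move: (jE f y)%:C mulii => e I2.
by field: I2.
Qed.

Definition gdiag (f : C2 -> R[i]^o) y (i : nat) : R := if (i < 2)%N then 2 else 2 * jE f y.

Lemma basis_entry (K : pzRingType) (i k : 'I_4) : ('e_i : 'rV[K]_4) 0 k = ((k : nat) == i)%:R.
Proof. by rewrite mxE. Qed.

Lemma g_ofE f y (i j : 'I_4) : g_of f y i j = if (i : nat) == j then gdiag f y i else 0.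
Proof.
rewrite mxE gform_coord !basis_entry.
have H2 : Re (2 * (1 * 1 + 0 * 0) + 2 * (jE f y)%:C * (0 * 0 + 0 * 0)) = 2.
  by rewrite !(mulr1, mulr0, addr0).
case: i => -[|[|[|[|//]]]] Hi; case: j => -[|[|[|[|//]]]] Hj;
  rewrite /gdiag /= ?(mulr0, mulr1, addr0, add0r) ?ReImE /= ?mul0r ?subr0 ?addr0 //.
all: try ring.
Qed.

Lemma g_of_diag f y : g_of f y = diag_mx (\row_i gdiag f y i).
Proof.
apply/matrixP => i j; rewrite g_ofE !mxE -(inj_eq val_inj) /=.
by case: eqP => // _; rewrite mulr1n.
Qed.

End ConcreteMetric.

(* Components of S^s g and of its inverse: g is diagonal with entries 2, 2, 2E, 2E. *)
Definition gP (s : int) (i j : nat) : dpoly := if i == j then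
  [:: (qfrac 2 1, (if (i < 2)%N then BinNums.Z0 else Z_of_int 1, Z_of_int s, [::]))] else [::].
Definition iP (s : int) (i j : nat) : dpoly := if i == j then
  [:: (qfrac 1 2, (if (i < 2)%N then BinNums.Z0 else Z_of_int (- 1), Z_of_int (- s), [::]))]
  else [::].

Section ConformalMetric.
Variable R : realType.
Local Notation C2 := (R[i]^o * R[i]^o)%type.
Local Notation pt := 'rV[R]_4.
Variables (f : C2 -> R[i]^o) (sg : pt -> R) (s : int).

Definition scaled_metric (y : pt) : 'M[R]_4 := sg y ^ s *: g_of f y.

Lemma jp0 y : jp f sg [::] y = 0.
Proof. by rewrite /jp /evalp big_nil. Qed.

Lemma jp1 c m y : jp f sg [:: (c, m)] y = qr R c * evalm (jE f y) (sg y) (jev f sg y) m.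
Proof. by rewrite /jp /evalp big_seq1. Qed.

Lemma scaled_metricE (i j : 'I_4) y : scaled_metric y i j = jp f sg (gP s i j) y.
Proof.
rewrite mxE g_ofE /gP; case: ifP => _; last by rewrite mulr0 jp0.
rewrite jp1 qr_qfrac divr1 /evalm /evall big_nil mulr1 [_.1.2]/= Z_of_intK /gdiag.
by case: ifP => _ /=; rewrite ?expr0z ?expr1z ?mul1r; ring.
Qed.

Lemma gdiag_gt0 y i : 0 < gdiag f y i.
Proof. by rewrite /gdiag; case: ifP => _ //; rewrite mulr_gt0// expR_gt0. Qed.

Lemma invmx_diag n (d : 'rV[R]_n) : (forall i, d 0 i != 0) ->
  invmx (diag_mx d) = diag_mx (\row_i (d 0 i)^-1).
Proof.
move=> d0; have E : diag_mx d *m diag_mx (\row_i (d 0 i)^-1) = 1%:M.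
  rewrite mulmx_diag; apply/matrixP => i j; rewrite !mxE.
  by rewrite divff.
have [U _] := mulmx1_unit E.
by rewrite -[LHS]mulmx1 -E mulmxA mulVmx// mul1mx.
Qed.

Lemma ginv_scaledE (i j : 'I_4) y : sg y != 0 -> ginv scaled_metric i j y = jp f sg (iP s i j) y.
Proof.
move=> s0; have d0 k : gdiag f y k != 0 by rewrite gt_eqF// gdiag_gt0.
have -> : ginv scaled_metric i j y = if (i : nat) == j then (sg y ^ s * gdiag f y i)^-1 else 0.
  rewrite /ginv (_ : scaled_metric y = diag_mx (\row_k (sg y ^ s * gdiag f y k))).
    rewrite invmx_diag; last by move=> k; rewrite mxE mulf_neq0// expfz_neq0.
    by rewrite !mxE -(inj_eq val_inj) /=; case: eqP => //.
  apply/matrixP => a b; rewrite mxE g_ofE !mxE -(inj_eq val_inj) /=.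
  by case: eqP => _; rewrite ?mulr0n ?mulr0 ?mulr1n.
rewrite /iP; case: ifP => _; last by rewrite jp0.
rewrite jp1 qr_qfrac /evalm /evall big_nil mulr1 [_.1.2]/= Z_of_intK -invr_expz /gdiag.
have sz := @expfz_neq0 _ _ s s0; have e0 := jE_neq0 f y.
by case: ifP => _ /=; rewrite ?expr0z ?expr1z ?mul1r -?[jE f y ^ _]/((jE f y)^-1); field;
  rewrite ?sz ?e0.
Qed.

End ConformalMetric.

Section BaseMetric.
Variable R : realType.
Local Notation C2 := (R[i]^o * R[i]^o)%type.
Local Notation pt := 'rV[R]_4.
Variables (U : set C2) (f : C2 -> R[i]^o).
Hypotheses (oU : open U) (hf : holomorphic_on U f).
Let M := @wz R @^-1` U.
Let one : pt -> R := cst 1.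

Lemma smooth_cst (V : set pt) (c : R) : smooth_on V (cst c).
Proof.
move=> s y _; suff [d ->] : exists d, foldr (@pd R) (cst c) s = cst d.
  exact: differentiable_cst.
elim: s => [|i s [d IH]]; first by exists c.
by exists 0; rewrite /= IH; apply/funext => z; exact: derive_cst.
Qed.

Lemma smooth_on_ext (V : set pt) (F G : pt -> R) : open V -> (forall y, V y -> F y = G y) ->
  smooth_on V F -> smooth_on V G.
Proof.
move=> oV FG sF s y Vy.
have E : forall z, V z -> foldr (@pd R) F s z = foldr (@pd R) G s z.
  by elim: s => [//|i s IH] z Vz /=; exact: (pd_near i oV Vz IH).
exact: (differentiable_near oV Vy E (sF s y Vy)).
Qed.

(** Taking weight 0 as well as factor 1 keeps powers of [S] out of the polynomials for [g]. *)
Lemma scaled_one : scaled_metric f one 0 = g_of f.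
Proof. by apply/funext => y; rewrite /scaled_metric expr0z scale1r. Qed.

Let oM : open M. Proof. exact: wz_open. Qed.
Let sone : smooth_on M one. Proof. exact: smooth_cst. Qed.
Let one0 (y : pt) : M y -> one y != 0. Proof. by move=> _; exact: oner_neq0. Qed.

Lemma g_of_jp (i j : 'I_4) y : M y -> g_of f y i j = jp f one (gP 0 i j) y.
Proof. by move=> _; rewrite -scaled_metricE scaled_one. Qed.

Lemma ginv_jp (i j : 'I_4) y : M y -> ginv (g_of f) i j y = jp f one (iP 0 i j) y.
Proof. by move=> My; rewrite -ginv_scaledE ?scaled_one//; exact: one0. Qed.

Lemma riemannian_g_of : riemannian_metric_on (g_of f) M.
Proof.
split=> [i j|y _].
  apply: smooth_on_ext oM _ (smooth_jp oU hf oM (fun _ => id) sone one0 (gP 0 i j)).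
  by move=> y My; rewrite g_of_jp.
split; first by rewrite g_of_diag tr_diag_mx.
move=> v v0; rewrite g_of_diag mul_mx_diag mxE sum4 !mxE.
have P i : 0 <= v 0 i * gdiag f y i * v 0 i.
  by rewrite mulrAC -expr2 mulr_ge0 ?sqr_ge0// ltW// gdiag_gt0.
have [i vi] : exists i, v 0 i != 0.
  apply/existsP; apply: contraNT v0; rewrite negb_exists => /forallP H.
  by apply/eqP/rowP => i; rewrite mxE; apply/eqP; have := H i; rewrite negbK.
have Q : 0 < v 0 i * gdiag f y i * v 0 i.
  by rewrite mulrAC -expr2 mulr_gt0 ?gdiag_gt0// exprn_even_gt0.
have p0 := P 0; have p1 := P 1; have p2 := P 2%:R; have p3 := P 3%:R.
move: i vi Q; apply: ord4P => _ Q; move: p0 p1 p2 p3 Q;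
  move: (_ * v 0 0) (_ * v 0 1) (_ * v 0 2%:R) (_ * v 0 3%:R) => a b c d; lra.
Qed.

End BaseMetric.

Definition chG := chT (gP 0) (iP 0).
Definition shG := shT (gP 0) (iP 0).
Definition weG := weT (gP 0) (iP 0).
Definition coG := coT (gP 0) (iP 0).

Definition weG4 := tab4 (weyP (gP 0) (rmT (gP 0) (iP 0)) (shT (gP 0) (iP 0))).
(** The evaluated table is stored as a literal, so that later case analyses on indices reduce by
    lookup. *)
Definition weL := Eval vm_compute in weG4.

Lemma weG4E : weG4 = weL. Proof. by vm_compute. Qed.

Lemma weGE : weG = get4 weL. Proof. by rewrite -weG4E. Qed.

(** Bach flatness is checked by direct expansion instead of being deduced from selfduality: every
    component cancels to the empty list. *)
Lemma bach_vanishes : tab2 (bacP (iP 0) chG shG coG (get4 weL)) = tab2 (fun _ _ => [::]).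
Proof. by vm_compute. Qed.

(** The Levi-Civita symbol, as an integer determinant that [vm_compute] can evaluate. *)
Definition eps4 (a b c d : nat) : int :=
  det4 (fun i j => (nth 0%N [:: a; b; c; d] i == j)%:R).

(* 4 E is the square root of the determinant of g. *)
Definition volP (a b c d : nat) : dpoly :=
  if eps4 a b c d == 0 then [::] else [:: (qfrac (4 * eps4 a b c d) 1, (Z_of_int 1, BinNums.Z0, [::]))].

(** The inverse metric is diagonal, so the four sums of [weyl_dual] collapse to two. *)
Definition dualP (we : nat -> nat -> nat -> nat -> dpoly) a b c d : dpoly :=
  pscal (qfrac 1 2) (psum (fun e => psum (fun h =>
    pmul (pmul (pmul (volP a b e h) (iP 0 e e)) (iP 0 h h)) (we e h c d)))).

Lemma weyl_selfdual_table : tab4 (fun a b c d => psub (get4 weL a b c d) (dualP (get4 weL) a b c d))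
  = tab4 (fun _ _ _ _ => [::]).
Proof. by vm_compute. Qed.

(** * Selfduality and the components of the Weyl tensor *)

Section WeylComponents.
Variable R : realType.
Local Notation C2 := (R[i]^o * R[i]^o)%type.
Local Notation pt := 'rV[R]_4.
Local Notation cvec := 'rV[R[i]]_4.
Local Notation Re := (@complex.Re R).
Local Notation Im := (@complex.Im R).
Variables (U : set C2) (f : C2 -> R[i]^o).
Hypotheses (oU : open U) (hf : holomorphic_on U f).
Let M := @wz R @^-1` U.
Let one : pt -> R := cst 1.
Let oM : open M. Proof. exact: wz_open. Qed.
Let sone : smooth_on M one. Proof. exact: smooth_cst. Qed.
Let one0 (y : pt) : M y -> one y != 0. Proof. by move=> _; exact: oner_neq0. Qed.
Local Notation jp := (jp f one).

Lemma weyl_jp (a b c d : 'I_4) y : M y -> weyl (g_of f) a b c d y = jp (get4 weL a b c d) y.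
Proof.
move=> My; rewrite -weGE.
exact: (weylE oU hf oM (fun _ => id) sone one0 (@g_of_jp R U f) (@ginv_jp R U f) a b c d My).
Qed.

Lemma bach_g_of (a b : 'I_4) y : M y -> bach (g_of f) a b y = 0.
Proof.
move=> My.
rewrite (bachE oU hf oM (fun _ => id) sone one0 (@g_of_jp R U f) (@ginv_jp R U f) a b My).
rewrite -/weG weGE -/chG -/shG -/coG.
by rewrite -(get2_tab (bacP (iP 0) chG shG coG (get4 weL))) bach_vanishes get2_tab jp0.
Qed.

Lemma det_g_of y : \det (g_of f y) = (4 * jE f y) ^+ 2.
Proof.
rewrite g_of_diag det_diag !big_ord_recl big_ord0 !mxE /gdiag /=; ring.
Qed.

Lemma volume_g_of (a b c d : 'I_4) y :
  volume_form (g_of f) false a b c d y = 4 * jE f y * (eps4 a b c d)%:~R.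
Proof.
rewrite /volume_form expr0 mul1r det_g_of sqrtr_sqr ger0_norm; last first.
  by rewrite mulr_ge0// ltW// expR_gt0.
congr (_ * _).
pose A (i j : nat) : R :=
  ((nth 0%N [:: (a : nat); (b : nat); (c : nat); (d : nat)] i == j)%:R : int)%:~R.
rewrite (_ : \matrix_(i, j) _ = \matrix_(i < 4, j < 4) A i j).
  rewrite det4E /eps4.
  exact: (det4_map (intr : {rmorphism int -> R})).
apply/matrixP => i j; rewrite !mxE (tnth_nth a) /A rmorph_nat -(inj_eq val_inj).
by congr (_ == _)%:R; case: i => -[|[|[|[|//]]]].
Qed.

Lemma volume_jp (a b c d : 'I_4) y :
  volume_form (g_of f) false a b c d y = jp (volP a b c d) y.
Proof.
rewrite volume_g_of /volP; case: eqP => [->|_]; first by rewrite mulr0 jp0.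
by rewrite jp1 qr_qfrac /evalm /evall big_nil expr0z expr1z !mulr1 divr1 rmorphM/=; ring.
Qed.

Lemma ginv_offdiag (i j : 'I_4) y : M y -> i != j -> ginv (g_of f) i j y = 0.
Proof.
by move=> My ij; rewrite (@ginv_jp R U f)// /iP (inj_eq val_inj) (negPf ij) jp0.
Qed.

Lemma sum_ginv (F : 'I_4 -> R) i y : M y ->
  \sum_(j < 4) ginv (g_of f) i j y * F j = ginv (g_of f) i i y * F i.
Proof.
move=> My; rewrite (bigD1 i)//= big1 ?addr0// => j ji.
by rewrite ginv_offdiag ?mul0r// eq_sym.
Qed.

Lemma weyl_dual_g_of (a b c d : 'I_4) y : M y ->
  weyl_dual (g_of f) false a b c d y = weyl (g_of f) a b c d y.
Proof.
move=> My.
have -> : weyl_dual (g_of f) false a b c d y = jp (dualP (get4 weL) a b c d) y.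
  rewrite /weyl_dual /dualP jpZ qr_qfrac mul1r; congr (_ * _).
  apply: jp_sum => e; apply: jp_sum => h.
  have jM p q : jp (pmul p q) y = jp p y * jp q y by exact: (jpM f one0).
  rewrite !jM.
  rewrite -volume_jp -!(@ginv_jp R U f)// -weyl_jp//.
  rewrite -[RHS]mulrA -[RHS]mulrA.
  transitivity (volume_form (g_of f) false a b e h y * (\sum_(e' < 4) ginv (g_of f) e e' y *
     (\sum_(h' < 4) ginv (g_of f) h h' y * weyl (g_of f) e' h' c d y))).
    rewrite mulr_sumr; apply: eq_bigr => e' _; rewrite !mulr_sumr; apply: eq_bigr => h' _.
    by rewrite !mulrA.
  by rewrite !sum_ginv.
rewrite weyl_jp//; apply/eqP; rewrite eq_sym -subr_eq0 -jpB.
by rewrite -(get4_tab (fun a b c d => psub (get4 weL a b c d) (dualP (get4 weL) a b c d)))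
  weyl_selfdual_table get4_tab jp0.
Qed.

Lemma weyl_asd_g_of (a b c d : 'I_4) y : M y -> weyl_asd (g_of f) false a b c d y = 0.
Proof. by move=> My; rewrite /weyl_asd weyl_dual_g_of// subrr mulr0. Qed.

Lemma weyl_sd_g_of (a b c d : 'I_4) y : M y ->
  weyl_sd (g_of f) false a b c d y = weyl (g_of f) a b c d y.
Proof. by move=> My; rewrite /weyl_sd weyl_dual_g_of//; field. Qed.

Definition mixed_re y := Re (d_dw (d_dz f) (wz y)).
Definition mixed_im y := Im (d_dw (d_dz f) (wz y)).

(** Each entry of [weL] is empty or a single term: a rational times a power of [E] times the real or
    imaginary part of [f_wz]. The power of [S] is dropped because [S = 1]. *)
Definition weyl_entry (p : dpoly) (E p11 q11 : R) : R := match p with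
  | [::] => 0
  | (c, (e, _, [:: JR _ _])) :: _ => qr R c * E ^ int_of_Z e * p11
  | (c, (e, _, _)) :: _ => qr R c * E ^ int_of_Z e * q11
  end.

Lemma weyl_entryE (a b c d : 'I_4) y : M y -> weyl (g_of f) a b c d y =
  weyl_entry (get4 weL a b c d) (jE f y) (mixed_re y) (mixed_im y).
Proof.
move=> My; rewrite weyl_jp//.
case: a => -[|[|[|[|//]]]] Ha; case: b => -[|[|[|[|//]]]] Hb;
case: c => -[|[|[|[|//]]]] Hc; case: d => -[|[|[|[|//]]]] Hd;
 rewrite ?jp0 //= jp1 /evalm /evall big_seq1 /one exp1rz mulr1 mulrA //.
Qed.

End WeylComponents.

(** * Null planes and the Petrov type *)

Section PsiComponents.
Variable R : realType.
Local Notation C := R[i].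
Local Notation C2 := (R[i]^o * R[i]^o)%type.
Local Notation pt := 'rV[R]_4.
Local Notation cvec := 'rV[R[i]]_4.

(** Nesting allows one slot at a time to be contracted with a frame vector, which has only two
    nonzero coordinates. *)
Lemma cweyl_nested (G : pt -> 'M[R]_4) x (X Y Z W : cvec) : cweyl G x X Y Z W =
  \sum_a X 0 a * (\sum_b Y 0 b * (\sum_c Z 0 c * (\sum_d W 0 d * (weyl G a b c d x)%:C))).
Proof.
rewrite /cweyl; apply: eq_bigr => a _; rewrite mulr_sumr; apply: eq_bigr => b _.
rewrite !mulr_sumr; apply: eq_bigr => c _; rewrite !mulr_sumr; apply: eq_bigr => d _.
ring.
Qed.

Lemma entries_vw : [/\ vw R 0 0 = 2^-1, vw R 0 1 = - (2^-1 * 'i), vw R 0 2%:R = 0 & vw R 0 3%:R = 0].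
Proof. by split; rewrite !mxE /=; ring. Qed.
Lemma entries_vwb : [/\ vwb R 0 0 = 2^-1, vwb R 0 1 = 2^-1 * 'i, vwb R 0 2%:R = 0 & vwb R 0 3%:R = 0].
Proof. by split; rewrite !mxE /=; ring. Qed.
Lemma entries_vz : [/\ vz R 0 0 = 0, vz R 0 1 = 0, vz R 0 2%:R = 2^-1 & vz R 0 3%:R = - (2^-1 * 'i)].
Proof. by split; rewrite !mxE /=; ring. Qed.
Lemma entries_vzb : [/\ vzb R 0 0 = 0, vzb R 0 1 = 0, vzb R 0 2%:R = 2^-1 & vzb R 0 3%:R = 2^-1 * 'i].
Proof. by split; rewrite !mxE /=; ring. Qed.

Lemma contract4 (X : cvec) (F : 'I_4 -> C) a b c d :
  [/\ X 0 0 = a, X 0 1 = b, X 0 2%:R = c & X 0 3%:R = d] ->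
  \sum_i X 0 i * F i = a * F 0 + b * F 1 + c * F 2%:R + d * F 3%:R.
Proof. by move=> [<- <- <- <-]; rewrite sum4. Qed.

Lemma contract_vw (F : 'I_4 -> C) : \sum_a vw R 0 a * F a = 2^-1 * (F 0 - 'i * F 1).
Proof. by rewrite (contract4 F entries_vw); ring. Qed.
Lemma contract_vwb (F : 'I_4 -> C) : \sum_a vwb R 0 a * F a = 2^-1 * (F 0 + 'i * F 1).
Proof. by rewrite (contract4 F entries_vwb); ring. Qed.

Lemma contract_scale s (X : cvec) (F : 'I_4 -> C) :
  \sum_a (s *: X) 0 a * F a = s * \sum_a X 0 a * F a.
Proof. by rewrite mulr_sumr; apply: eq_bigr => a _; rewrite mxE mulrA. Qed.

Lemma contract_vz (F : 'I_4 -> C) : \sum_a vz R 0 a * F a = 2^-1 * (F 2%:R - 'i * F 3%:R).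
Proof. by rewrite (contract4 F entries_vz); ring. Qed.
Lemma contract_vzb (F : 'I_4 -> C) : \sum_a vzb R 0 a * F a = 2^-1 * (F 2%:R + 'i * F 3%:R).
Proof. by rewrite (contract4 F entries_vzb); ring. Qed.

Lemma contract_svz s (F : 'I_4 -> C) :
  \sum_a (s *: vz R) 0 a * F a = s * (2^-1 * (F 2%:R - 'i * F 3%:R)).
Proof. by rewrite contract_scale contract_vz. Qed.
Lemma contract_svzb s (F : 'I_4 -> C) :
  \sum_a (s *: vzb R) 0 a * F a = s * (2^-1 * (F 2%:R + 'i * F 3%:R)).
Proof. by rewrite contract_scale contract_vzb. Qed.

#[local] Opaque vw vwb vz vzb weyl.

Variables (U : set C2) (f : C2 -> R[i]^o).
Hypotheses (oU : open U) (hf : holomorphic_on U f).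
Let M := @wz R @^-1` U.
Local Notation g := (g_of f).

(** This kills [Psi0], [Psi2] and [Psi4], whose arguments alternate between the [w]-directions and
    the [z]-directions. *)
Lemma weyl_mixed (a b c d : 'I_4) y : M y -> (a < 2)%N -> (1 < b)%N -> (c < 2)%N -> (1 < d)%N ->
  weyl g a b c d y = 0.
Proof.
move=> My; rewrite (weyl_entryE oU hf)//.
by case: a => -[|[|[|[|//]]]] Ha //; case: b => -[|[|[|[|//]]]] Hb //;
 case: c => -[|[|[|[|//]]]] Hc //; case: d => -[|[|[|[|//]]]] Hd.
Qed.

(** The coefficients of the real part of ['i * f_wz dw dz], with [dw] in the slot [a] and [dz] in
    the slot [b]. *)
Definition hmix (a b : nat) y : R :=
  if a == 0%N then (if b == 2%N then - mixed_im f y else - mixed_re f y)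
  else (if b == 2%N then - mixed_re f y else mixed_im f y).

Lemma weyl_hmix (a b c d : 'I_4) y : M y -> (a < 2)%N -> (1 < b)%N -> (c < 2)%N = (d < 2)%N ->
  weyl g a b c d y = (if (c < 2)%N then 1 else jE f y) * (if c == d then 0 else
    if (c < d)%N then hmix a b y else - hmix a b y).
Proof.
move=> My; rewrite (weyl_entryE oU hf)// /hmix.
have e1 : qr R (QArith_base.Qmake (BinNums.Zpos BinNums.xH) BinNums.xH) = 1 by rewrite /qr /zr /= divr1.
have eN : qr R (QArith_base.Qmake (BinNums.Zneg BinNums.xH) BinNums.xH) = -1 by rewrite /qr /zr /= divr1.
have x0 : jE f y ^ int_of_Z BinNums.Z0 = 1 by [].
have x1 : jE f y ^ int_of_Z (BinNums.Zpos BinNums.xH) = jE f y by [].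
case: a => -[|[|[|[|//]]]] Ha //; case: b => -[|[|[|[|//]]]] Hb //;
 case: c => -[|[|[|[|//]]]] Hc //; case: d => -[|[|[|[|//]]]] Hd //= _ _ _;
 rewrite ?mulr0 // ?e1 ?eN ?x0 ?x1; ring.
Qed.

Lemma oppC_real (x : R) : (- x)%:C = - x%:C :> C. Proof. by rewrite rmorphN. Qed.
Lemma mulC_real (x z : R) : (x * z)%:C = x%:C * z%:C :> C. Proof. by rewrite rmorphM. Qed.

Lemma mixed_C y : d_dw (d_dz f) (wz y) = mixed_re f y +i* mixed_im f y.
Proof. by rewrite /mixed_re /mixed_im; case: (d_dw _ _). Qed.

Lemma contract_mixed (Y W X Z : cvec) y s t : M y ->
  (X = vw R \/ X = vwb R) -> (Z = vw R \/ Z = vwb R) ->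
  (Y = vz R \/ Y = vzb R) -> (W = vz R \/ W = vzb R) ->
  cweyl g y X (s *: Y) Z (t *: W) = 0.
Proof.
move=> My hX hZ hY hW; rewrite cweyl_nested.
have z01 (x : cvec) (F : 'I_4 -> C) : x = vw R \/ x = vwb R ->
    F 0 = 0 -> F 1 = 0 -> \sum_a x 0 a * F a = 0.
  by move=> [] -> F0 F1; [rewrite contract_vw|rewrite contract_vwb]; rewrite F0 F1; ring.
have z23 (x : cvec) c (F : 'I_4 -> C) : x = vz R \/ x = vzb R ->
    F 2%:R = 0 -> F 3%:R = 0 -> \sum_a (c *: x) 0 a * F a = 0.
  by move=> [] -> F2 F3; [rewrite contract_svz|rewrite contract_svzb];
      rewrite F2 F3; ring.
have zz (a b c d : 'I_4) : (a < 2)%N -> (1 < b)%N -> (c < 2)%N -> (1 < d)%N ->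
   (weyl g a b c d y)%:C = 0 by move=> *; rewrite weyl_mixed.
by apply: (z01 X) => //; apply: (z23 Y) => //; apply: (z01 Z) => //; apply: (z23 W) => //; exact: zz.
Qed.

Lemma contract_Psi3 (w : 'I_4 -> 'I_4 -> 'I_4 -> 'I_4 -> C) s :
  (forall a b, w a b 0 0 = 0) -> (forall a b, w a b 1 1 = 0) ->
  (forall a b, w a b 1 0 = - w a b 0 1) ->
  \sum_a vw R 0 a * (\sum_b (s *: vz R) 0 b * (\sum_c vwb R 0 c * (\sum_d vw R 0 d * w a b c d))) =
  - (8^-1 * 'i * s * (w 0 2%:R 0 1 - 'i * w 0 3%:R 0 1 - 'i * (w 1 2%:R 0 1 - 'i * w 1 3%:R 0 1))).
Proof.
move=> w0 w1 w10.
have E a b : \sum_c vwb R 0 c * (\sum_d vw R 0 d * w a b c d) = - (2^-1 * 'i * w a b 0 1).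
  by rewrite contract_vwb !contract_vw w0 w1 w10; field.
have E2 a : \sum_b (s *: vz R) 0 b * (\sum_c vwb R 0 c * (\sum_d vw R 0 d * w a b c d)) =
    - (4^-1 * 'i * s * (w a 2%:R 0 1 - 'i * w a 3%:R 0 1)).
  by rewrite contract_svz !E; field.
by rewrite contract_vw !E2; field.
Qed.

Lemma contract_Psi1 (w : 'I_4 -> 'I_4 -> 'I_4 -> 'I_4 -> C) s t :
  (forall a b, w a b 2%:R 2%:R = 0) -> (forall a b, w a b 3%:R 3%:R = 0) ->
  (forall a b, w a b 3%:R 2%:R = - w a b 2%:R 3%:R) ->
  \sum_a vwb R 0 a * (\sum_b (t *: vzb R) 0 b * (\sum_c (s *: vz R) 0 c *
    (\sum_d (t *: vzb R) 0 d * w a b c d))) =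
  8^-1 * 'i * s * t ^+ 2 * (w 0 2%:R 2%:R 3%:R + 'i * w 0 3%:R 2%:R 3%:R +
    'i * (w 1 2%:R 2%:R 3%:R + 'i * w 1 3%:R 2%:R 3%:R)).
Proof.
move=> w2 w3 w32.
have E a b : \sum_c (s *: vz R) 0 c * (\sum_d (t *: vzb R) 0 d * w a b c d) =
    2^-1 * 'i * s * t * w a b 2%:R 3%:R.
  by rewrite contract_svz 2!contract_svzb w2 w3 w32; field.
have E2 a : \sum_b (t *: vzb R) 0 b * (\sum_c (s *: vz R) 0 c * (\sum_d (t *: vzb R) 0 d * w a b c d)) =
    4^-1 * 'i * s * t ^+ 2 * (w a 2%:R 2%:R 3%:R + 'i * w a 3%:R 2%:R 3%:R).
  by rewrite contract_svzb !E; field.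
by rewrite contract_vwb !E2; field.
Qed.

Lemma weyl_last_swap (a b c d : 'I_4) y : M y -> weyl g a b d c y = - weyl g a b c d y.
Proof.
move=> My; rewrite !(weyl_entryE oU hf)//.
have e1 : qr R (QArith_base.Qmake (BinNums.Zpos BinNums.xH) BinNums.xH) = 1 by rewrite /qr /zr /= divr1.
have eN : qr R (QArith_base.Qmake (BinNums.Zneg BinNums.xH) BinNums.xH) = -1 by rewrite /qr /zr /= divr1.
by case: a => -[|[|[|[|//]]]] Ha //; case: b => -[|[|[|[|//]]]] Hb //;
 case: c => -[|[|[|[|//]]]] Hc //; case: d => -[|[|[|[|//]]]] Hd //=;
 rewrite ?oppr0// ?e1 ?eN ?mul1r ?mulN1r ?mulNr ?opprK.
Qed.

Lemma weyl_last_diag (a b c : 'I_4) y : M y -> weyl g a b c c y = 0.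
Proof.
move=> My; have /eqP := weyl_last_swap a b c c My.
by rewrite -subr_eq0 opprK -mulr2n mulrn_eq0 => /eqP.
Qed.

Lemma Psi3_value y : M y -> Psi3 g y (m_of y) (p_of y) (n_of f y) =
  4^-1 * cexp (- f (wz y)) * d_dw (d_dz f) (wz y).
Proof.
move=> My; rewrite /Psi3 cweyl_nested.
rewrite (contract_Psi3 (w := fun a b c d => (weyl g a b c d y)%:C)); first last.
- by move=> a b; rewrite (weyl_last_swap a b 0 1)// rmorphN.
- by move=> a b; rewrite weyl_last_diag.
- by move=> a b; rewrite weyl_last_diag.
rewrite !weyl_hmix// mixed_C.
have -> : mixed_re f y +i* mixed_im f y = (mixed_re f y)%:C + 'i * (mixed_im f y)%:C.
  by apply: eqC; rewrite !ReImE /=; ring.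
rewrite /hmix /= !mul1r !oppC_real.
move: (cexp _) (mixed_re f y)%:C (mixed_im f y)%:C (mulii R) => s p q.
by move=> I2; field: I2.
Qed.

Lemma cexp_metric y : cexp (- f (wz y)) * cexp (- conjc (f (wz y))) * (jE f y)%:C = 1.
Proof. by rewrite /jE /Re_at -cexpDconj -!cexpD -opprD addNr cexp0. Qed.

Lemma Psi1_value y : M y -> Psi1 g y (m_of y) (n_of f y) (k_of f y) =
  4^-1 * cexp (- conjc (f (wz y))) * conjc (d_dw (d_dz f) (wz y)).
Proof.
move=> My; rewrite /Psi1 cweyl_nested.
rewrite (contract_Psi1 (w := fun a b c d => (weyl g a b c d y)%:C)); first last.
- by move=> a b; rewrite (weyl_last_swap a b 2%:R 3%:R)// rmorphN.
- by move=> a b; rewrite weyl_last_diag.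
- by move=> a b; rewrite weyl_last_diag.
rewrite !weyl_hmix// mixed_C.
have -> : conjc (mixed_re f y +i* mixed_im f y) = (mixed_re f y)%:C - 'i * (mixed_im f y)%:C.
  by apply: eqC; rewrite !ReImE /=; ring.
have := cexp_metric y.
rewrite /hmix /= !mulC_real !oppC_real.
move: (cexp (- f _)) (cexp (- conjc _)) (jE f y)%:C => s t e ste.
move: (mixed_re f y)%:C (mixed_im f y)%:C (mulii R) => p q I2.
(* The factor [E] of the components with last pair (2, 3) is absorbed by one [e^-f] and one
   [e^-conj(f)] of the frame vectors [n] and [k]. *)
transitivity (s * t * e * (4^-1 * t * (p - 'i * q))); last by rewrite ste mul1r.
by field: I2.
Qed.

End PsiComponents.

(** * The null plane [N] and its selfduality *)

Section Planes.
Variable R : realType.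
Local Notation C := R[i].
Local Notation C2 := (R[i]^o * R[i]^o)%type.
Local Notation pt := 'rV[R]_4.
Local Notation cvec := 'rV[R[i]]_4.
Implicit Types (u v X Y : cvec).

(** The common kernel of [dw] and [dz], that is, the span of d/d(conj w) and d/d(conj z). It depends
    neither on the point nor on [f], and all statements about [N] reduce to it. *)
Definition antiholomorphic v := (v 0 1 == 'i * v 0 0) && (v 0 3%:R == 'i * v 0 2%:R).

Lemma sub_col_mx_row X Y v : reflect (exists a b, v = a *: X + b *: Y) (v <= col_mx X Y)%MS.
Proof.
rewrite -addsmxE; apply: (iffP sub_addsmxP) => [[[a b] ->]|[a [b ->]]].
  by exists (a 0 0), (b 0 0); rewrite /= -!mul_scalar_mx -!mx11_scalar.
by exists (a%:M, b%:M); rewrite /= !mul_scalar_mx.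
Qed.

Lemma row4P u v : u 0 0 = v 0 0 -> u 0 1 = v 0 1 -> u 0 2%:R = v 0 2%:R -> u 0 3%:R = v 0 3%:R -> u = v.
Proof. by move=> h0 h1 h2 h3; apply/rowP; apply: ord4P. Qed.

Lemma cexp_neq0 (z : C) : cexp z != 0.
Proof.
apply/eqP => E; have := cexpD z (- z); rewrite subrr cexp0 E mul0r => /eqP.
by rewrite oner_eq0.
Qed.

Lemma halfC_neq0 : (2^-1 : C) != 0. Proof. by rewrite invr_eq0 pnatr_eq0. Qed.

Section Span.
Variables (X Y : cvec) (c : C).
Hypothesis c0 : c != 0.
Hypothesis eX : [/\ X 0 0 = 2^-1, X 0 1 = 2^-1 * 'i, X 0 2%:R = 0 & X 0 3%:R = 0].
Hypothesis eY : [/\ Y 0 0 = 0, Y 0 1 = 0, Y 0 2%:R = 2^-1 & Y 0 3%:R = 2^-1 * 'i].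

Lemma entry_comb a b i : (a *: X + b *: (c *: Y)) 0 i = a * X 0 i + b * c * Y 0 i.
Proof. by rewrite !mxE mulrA. Qed.

Lemma sub_span v : (v <= col_mx X (c *: Y))%MS = antiholomorphic v.
Proof.
have [m0 m1 m2 m3] := eX; have [z0 z1 z2 z3] := eY; have I2 := mulii R.
apply/sub_col_mx_row/andP => [[a [b ->]]|[/eqP v1 /eqP v3]].
  by rewrite !entry_comb m0 m1 m2 m3 z0 z1 z2 z3; split; apply/eqP; ring.
exists (2 * v 0 0), (2 * c^-1 * v 0 2%:R).
by apply: row4P; rewrite entry_comb ?m0 ?m1 ?m2 ?m3 ?z0 ?z1 ?z2 ?z3 ?v1 ?v3; field.
Qed.

Lemma rank_span : \rank (col_mx X (c *: Y)) = 2%N.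
Proof.
have [m0 m1 m2 m3] := eX; have [z0 z1 z2 z3] := eY.
apply/eqP; rewrite -[2%N]/(1 + 1)%N; apply: inj_row_free => v.
rewrite -[v]hsubmxK mul_row_col [lsubmx v]mx11_scalar [rsubmx v]mx11_scalar.
set a := lsubmx v 0 0; set b := rsubmx v 0 0.
rewrite !mul_scalar_mx => /rowP E.
have := E 0; have := E 2%:R; rewrite !entry_comb m0 m2 z0 z2 !mxE.
rewrite !mulr0 addr0 add0r => /eqP + /eqP; rewrite !mulf_eq0 (negPf halfC_neq0).
by rewrite (negPf c0) !orbF => /eqP -> /eqP ->; rewrite !raddf0 row_mx0.
Qed.

End Span.

Lemma sub_N_of (f : C2 -> R[i]^o) x v : (v <= N_of f x)%MS = antiholomorphic v.
Proof. exact: (sub_span (cexp_neq0 _) (entries_vwb R) (entries_vzb R)). Qed.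

Lemma rank_N_of (f : C2 -> R[i]^o) x : \rank (N_of f x) = 2%N.
Proof. exact: (rank_span (cexp_neq0 _) (entries_vwb R) (entries_vzb R)). Qed.

Lemma cmetric_g_of f x u v : cmetric (g_of f) x u v =
  2 * (u 0 0 * v 0 0 + u 0 1 * v 0 1) +
  2 * (jE f x)%:C * (u 0 2%:R * v 0 2%:R + u 0 3%:R * v 0 3%:R).
Proof.
have E a : \sum_b (g_of f x a b)%:C * u 0 a * v 0 b = (gdiag f x a)%:C * u 0 a * v 0 a.
  rewrite (bigD1 a)//= big1 ?addr0 ?g_ofE ?eqxx// => b ba.
  by rewrite g_ofE (inj_eq val_inj) eq_sym (negPf ba) !mul0r.
rewrite /cmetric; under eq_bigr do rewrite E.
rewrite sum4 /gdiag /= rmorphM rmorph_nat; ring.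
Qed.

Lemma totally_null_N_of (f : C2 -> R[i]^o) x : totally_null_plane (g_of f) x (N_of f x).
Proof.
split=> [|u v]; first exact: rank_N_of.
rewrite !sub_N_of cmetric_g_of => /andP[/eqP -> /eqP ->] /andP[/eqP -> /eqP ->].
by have I2 := mulii R; ring: I2.
Qed.

End Planes.

Section SelfDual.
Variable R : realType.
Local Notation C := R[i].
Local Notation C2 := (R[i]^o * R[i]^o)%type.
Local Notation pt := 'rV[R]_4.
Variables (U : set C2) (f : C2 -> R[i]^o).
Let M := @wz R @^-1` U.

Lemma sum4n (V : nmodType) (F : nat -> V) : \sum_(c < 4) F c = F 0%N + F 1%N + F 2%N + F 3%N.
Proof. by rewrite !big_ord_recl big_ord0 addr0 !addrA. Qed.

(** With a diagonal inverse metric only [e = a], [h = b] survive. The [2 * jE] combines the [2^-1]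
    of the star with the density [4 * jE]. *)
Lemma hodge_g_of (x : pt) (beta : 'M[C]_4) (a b : 'I_4) : M x ->
  hodge (g_of f) false x beta a b = (2 * jE f x / (gdiag f x a * gdiag f x b))%:C *
    \sum_(c < 4) \sum_(d < 4) (eps4 a b c d)%:~R * beta c d.
Proof.
move=> Mx; rewrite mxE.
have gi i : ginv (g_of f) i i x = (gdiag f x i)^-1.
  rewrite /ginv g_of_diag invmx_diag => [|j]; first by rewrite !mxE eqxx.
  by rewrite mxE gt_eqF// gdiag_gt0.
have E1 e : e != a -> \sum_h \sum_c \sum_d (ginv (g_of f) a e x * ginv (g_of f) b h x *
      volume_form (g_of f) false e h c d x)%:C * beta c d = 0.
  move=> ea; rewrite big1// => h _; rewrite big1// => c _; rewrite big1// => d _.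
  have -> : ginv (g_of f) a e x = 0 by apply: (@ginv_offdiag R U f) => //; rewrite eq_sym.
  by rewrite !mul0r.
have E2 h : h != b -> \sum_c \sum_d (ginv (g_of f) a a x * ginv (g_of f) b h x *
      volume_form (g_of f) false a h c d x)%:C * beta c d = 0.
  move=> hb; rewrite big1// => c _; rewrite big1// => d _.
  have -> : ginv (g_of f) b h x = 0 by apply: (@ginv_offdiag R U f) => //; rewrite eq_sym.
  by rewrite mulr0 !mul0r.
rewrite (bigD1 a)//= [X in _ + X]big1 ?addr0; last exact: E1.
rewrite (bigD1 b)//= [X in _ + X]big1 ?addr0; last exact: E2.
rewrite mulr_sumr [RHS]mulr_sumr; apply: eq_bigr => c _.
rewrite mulr_sumr [RHS]mulr_sumr; apply: eq_bigr => d _.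
rewrite !gi volume_g_of !mulrA; congr (_ * _).
rewrite !rmorphM /= !fmorphV rmorphM /= !rmorph_nat rmorph_int.
have n0 i : (gdiag f x i)%:C != 0 :> C.
  by rewrite -(rmorph0 (real_complex R)) (inj_eq (@complexI R)) gt_eqF// gdiag_gt0.
by move: (n0 a) (n0 b) (_%:~R) => na nb k; field; rewrite na nb.
Qed.

Lemma selfdual_N_of x : M x -> selfdual_plane (g_of f) false x (N_of f x).
Proof.
move=> Mx u v; rewrite !sub_N_of => /andP[/eqP u1 /eqP u3] /andP[/eqP v1 /eqP v3].
apply/matrixP => a b; rewrite hodge_g_of//.
pose un (k : nat) : C := nth 0 [:: u 0 0; 'i * u 0 0; u 0 2%:R; 'i * u 0 2%:R] k.
pose vn (k : nat) : C := nth 0 [:: v 0 0; 'i * v 0 0; v 0 2%:R; 'i * v 0 2%:R] k.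
have uE : forall i : 'I_4, u 0 i = un i by apply: ord4P; rewrite /un //=.
have vE : forall i : 'I_4, v 0 i = vn i by apply: ord4P; rewrite /vn //=.
pose B (c d : nat) := un c * vn d - un d * vn c.
have BE (c d : 'I_4) : wedge u v c d = B c d by rewrite mxE !uE !vE.
have -> : \sum_(c < 4) \sum_(d < 4) (eps4 a b c d)%:~R * wedge u v c d =
  \sum_(c < 4) \sum_(d < 4) (eps4 a b c d)%:~R * B c d.
  by apply: eq_bigr => c _; apply: eq_bigr => d _; rewrite BE.
pose S (F : nat -> C) := F 0%N + F 1%N + F 2%N + F 3%N.
have -> : \sum_(c < 4) \sum_(d < 4) (eps4 a b c d)%:~R * B c d =
  S (fun c => S (fun d => (eps4 a b c d)%:~R * B c d)).
  rewrite (sum4n (fun c => \sum_(d < 4) (eps4 a b c d)%:~R * B c d)) /S.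
  by congr (_ + _ + _ + _); exact: (sum4n (fun d => (eps4 a b _ d)%:~R * B _ d)).
rewrite BE /S.
have e0 : jE f x != 0 by exact: jE_neq0.
have e0C : (jE f x)%:C != 0 :> C by rewrite -(rmorph0 (real_complex R)) (inj_eq (@complexI R)).
have I2 := mulii R.
have r1 : (Posz 1)%:~R = 1 :> C by [].
have rN : (Negz 0)%:~R = -1 :> C by [].
have r0 : (Posz 0)%:~R = 0 :> C by [].
(* In each of the 16 cases the Levi-Civita symbols are replaced by their computed values, leaving a
   field identity modulo ['i * 'i = -1]. *)
case: a => -[|[|[|[|//]]]] Ha; case: b => -[|[|[|[|//]]]] Hb; rewrite [nat_of_ord _]/= [nat_of_ord _]/=;
 repeat match goal with |- context [eps4 ?a ?b ?c ?d] =>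
   let v := eval vm_compute in (eps4 a b c d) in change (eps4 a b c d) with v end;
 rewrite !(r0, r1, rN) /B /un /vn /gdiag /= !(rmorphM, fmorphV, rmorph_nat) /=.
all: by field: I2; rewrite ?e0C.
Qed.

End SelfDual.

(** * Integrability and the hermitian structure *)

Section HermitianStructure.
Variable R : realType.
Local Notation C := R[i].
Local Notation C2 := (R[i]^o * R[i]^o)%type.
Local Notation pt := 'rV[R]_4.
Local Notation cvec := 'rV[R[i]]_4.

Lemma cpd_muli (V : set pt) (F G : pt -> C) i x : open V -> V x ->
  csmooth_on V F -> (forall y, V y -> G y = 'i * F y) -> cpd i G x = 'i * cpd i F x.
Proof.
move=> oV Vx [sR sI] GF.
have dR : differentiable (fun y => complex.Re (F y)) x := sR [::] x Vx.
have dI : differentiable (fun y => complex.Im (F y)) x := sI [::] x Vx.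
have -> : cpd i G x = (- pd i (fun y => complex.Im (F y)) x) +i* pd i (fun y => complex.Re (F y)) x.
  rewrite /cpd; congr (_ +i* _).
    rewrite (@pd_near _ V _ (fun y => - complex.Im (F y)) x i oV Vx) => [|y Vy].
      by rewrite /pd (@deriveN _ _ _ (fun y => complex.Im (F y)))//; exact: diff_derivable.
    by rewrite GF// !ReImE /= mul0r sub0r mul1r.
  rewrite (@pd_near _ V _ (fun y => complex.Re (F y)) x i oV Vx) => [//|y Vy].
  by rewrite GF// !ReImE /= mul0r add0r mul1r.
by rewrite /cpd; apply: eqC; rewrite !ReImE /=; ring.
Qed.

(** The field is cut out by linear equations with constant coefficients. A vector extends as a
    constant section, and differentiating the equations shows that brackets satisfy them. *)
Lemma integrable_antiholomorphic (M : set pt) r (N : pt -> 'M[C]_(r, 4)) : open M ->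
  (forall x, M x -> forall v : cvec, (v <= N x)%MS = antiholomorphic v) -> integrable_field M N.
Proof.
move=> oM HN; split=> [x v Mx|V X Y oV VM [sX hX] [sY hY] x Vx].
  rewrite HN// => hv; exists M, (fun=> v); split => //.
  split; last by move=> y My; rewrite HN.
  by move=> i; split; exact: smooth_cst.
have Mx := VM _ Vx; rewrite HN//.
have P (Z : pt -> cvec) : (forall y, V y -> (Z y <= N y)%MS) -> smooth_cfield V Z ->
    [/\ forall i, cpd i (fun y => Z y 0 1) x = 'i * cpd i (fun y => Z y 0 0) x &
        forall i, cpd i (fun y => Z y 0 3%:R) x = 'i * cpd i (fun y => Z y 0 2%:R) x].
  move=> hZ sZ; split=> i; apply: (cpd_muli i oV Vx (sZ _)) => y Vy;
  by have := hZ y Vy; rewrite HN; [move=> /andP[/eqP ? /eqP ?]|exact: VM].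
have [X1 X3] := P X hX sX; have [Y1 Y3] := P Y hY sY.
rewrite /antiholomorphic !mxE; apply/andP; split; apply/eqP; rewrite mulr_sumr; apply: eq_bigr => i _.
  by rewrite X1 Y1; ring.
by rewrite X3 Y3; ring.
Qed.

(** Minus the standard complex structure (d_0 goes to - d_1, d_2 to - d_3), since its (1,0) space
    has to be spanned by d/d(conj w) and d/d(conj z). Reversing both pairs preserves the
    orientation. *)
Definition Jmx : 'M[R]_4 := \matrix_(i < 4, j < 4)
  nth 0 (nth [::] [:: [:: 0; -1; 0; 0]; [:: 1; 0; 0; 0]; [:: 0; 0; 0; -1]; [:: 0; 0; 1; 0]] i) j.

Lemma mulJmx (K : comPzRingType) (phi : {rmorphism R -> K}) (v : 'rV[K]_4) :
  [/\ (v *m map_mx phi Jmx) 0 0 = v 0 1, (v *m map_mx phi Jmx) 0 1 = - v 0 0,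
      (v *m map_mx phi Jmx) 0 2%:R = v 0 3%:R & (v *m map_mx phi Jmx) 0 3%:R = - v 0 2%:R].
Proof. by split; rewrite mxE sum4 !mxE /= ?(rmorph0, rmorph1, rmorphN); ring. Qed.

Lemma mulJmxR (v : 'rV[R]_4) :
  [/\ (v *m Jmx) 0 0 = v 0 1, (v *m Jmx) 0 1 = - v 0 0,
      (v *m Jmx) 0 2%:R = v 0 3%:R & (v *m Jmx) 0 3%:R = - v 0 2%:R].
Proof. by split; rewrite mxE sum4 !mxE /=; ring. Qed.

Lemma metric_form f x (u v : 'rV[R]_4) : (u *m g_of f x *m v^T) 0 0 =
  2 * (u 0 0 * v 0 0 + u 0 1 * v 0 1) + 2 * jE f x * (u 0 2%:R * v 0 2%:R + u 0 3%:R * v 0 3%:R).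
Proof.
rewrite g_of_diag mul_mx_diag mxE sum4 !mxE /gdiag /=; ring.
Qed.

Lemma hermitian_Jmx (f : C2 -> R[i]^o) (M : set pt) : hermitian_structure_on (g_of f) M (fun=> Jmx).
Proof.
split=> [i j|x _]; first exact: smooth_cst.
split=> [|u v].
  apply/row_matrixP => i; rewrite row_mul; set v := row i Jmx.
  apply/rowP; have [h0 h1 h2 h3] := mulJmxR v.
  have [k0 k1 k2 k3] := mulJmxR (delta_mx 0 i).
  have vE : v = delta_mx 0 i *m Jmx by rewrite /v rowE.
  have rE j : row i (- 1%:M : 'M[R]_4) 0 j = - (delta_mx 0 i : 'rV[R]_4) 0 j.
    by rewrite !mxE eqxx /= eq_sym.
  by apply: ord4P; rewrite rE ?h0 ?h1 ?h2 ?h3 vE ?k0 ?k1 ?k2 ?k3.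
have [u0 u1 u2 u3] := mulJmxR u; have [v0 v1 v2 v3] := mulJmxR v.
by rewrite !metric_form u0 u1 u2 u3 v0 v1 v2 v3; ring.
Qed.

Lemma sub_T10 (v : cvec) : (v <= T10 Jmx)%MS = antiholomorphic v.
Proof.
have [h0 h1 h2 h3] := mulJmx (real_complex R) v; have I2 := mulii R.
apply/eigenspaceP/andP => [E|[/eqP v1 /eqP v3]].
  have E0 := congr1 (fun w : cvec => w 0 0) E; have E2 := congr1 (fun w : cvec => w 0 2%:R) E.
  by rewrite /= h0 mxE in E0; rewrite /= h2 mxE in E2; rewrite E0 E2.
by apply: row4P; [rewrite h0|rewrite h1|rewrite h2|rewrite h3]; rewrite mxE ?v1 ?v3; ring: I2.
Qed.

Lemma T10_eq_N (f : C2 -> R[i]^o) x : (T10 Jmx == N_of f x)%MS.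
Proof. by apply/andP; split; apply/rV_subP => v; rewrite sub_T10 sub_N_of. Qed.

Lemma agrees_Jmx : agrees_with_orientation false Jmx.
Proof.
move=> u v d d0; rewrite expr0 mul1r.
have [u0 u1 u2 u3] := mulJmxR u; have [v0 v1 v2 v3] := mulJmxR v.
(* The squared modulus of the complex determinant [dw u * dz v - dz u * dw v], by real and imaginary
   parts. *)
have dE : d = (u 0 0 * v 0 2%:R - u 0 1 * v 0 3%:R - u 0 2%:R * v 0 0 + u 0 3%:R * v 0 1) ^+ 2
   + (u 0 0 * v 0 3%:R + u 0 1 * v 0 2%:R - u 0 2%:R * v 0 1 - u 0 3%:R * v 0 0) ^+ 2.
  pose A (i j : nat) : R := nth 0 (nth [::]
    [:: [:: u 0 0; u 0 1; u 0 2%:R; u 0 3%:R]; [:: u 0 1; - u 0 0; u 0 3%:R; - u 0 2%:R];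
        [:: v 0 0; v 0 1; v 0 2%:R; v 0 3%:R]; [:: v 0 1; - v 0 0; v 0 3%:R; - v 0 2%:R]] i) j.
  rewrite /d (_ : \matrix_i _ = \matrix_(i < 4, j < 4) A i j).
    by rewrite det4E /det4 /A /=; ring.
  apply/matrixP => i j; rewrite !mxE (tnth_nth 0) /A; move: j.
  by case: i => -[|[|[|[|//]]]] Hi /=; apply: ord4P => /=; rewrite ?u0 ?u1 ?u2 ?u3 ?v0 ?v1 ?v2 ?v3.
by rewrite lt_neqAle eq_sym d0 dE addr_ge0 ?sqr_ge0.
Qed.

End HermitianStructure.

(** * The quartic, its roots and the position of [N] *)

Section PetrovType.
Variable R : realType.
Local Notation C := R[i].
Local Notation C2 := (R[i]^o * R[i]^o)%type.
Local Notation pt := 'rV[R]_4.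
Local Notation cvec := 'rV[R[i]]_4.
Implicit Types (G : pt -> 'M[R]_4) (x : pt) (m p n k : cvec).

Section Quartic.
Variables (G : pt -> 'M[R]_4) (x : pt) (m p n k : cvec).
Hypotheses (P0 : Psi0 G x m k = 0) (P2 : Psi2 G x m p n k = 0) (P4 : Psi4 G x p n = 0).
Hypotheses (P1 : Psi1 G x m n k != 0) (P3 : Psi3 G x m p n != 0).

Local Notation q := (weyl_quartic G x m p n k).
Local Notation c1 := (4 * Psi1 G x m n k).
Local Notation c3 := (4 * Psi3 G x m p n).

Lemma quarticE : q = c1 *: 'X - c3 *: 'X^3.
Proof.
by rewrite /weyl_quartic P0 P2 P4 mulr0 !scale0r polyC0 sub0r !addr0 addrC.
Qed.

Lemma natr4_neq0 : (4 : C) != 0. Proof. by rewrite pnatr_eq0. Qed.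

Lemma quartic_coef1 : q`_1 != 0.
Proof. by rewrite quarticE coefB !coefZ coefX coefXn /= mulr0 subr0 mulr1 mulf_neq0// natr4_neq0. Qed.

Lemma quartic_rootE a : root q a = (a == 0) || (a ^+ 2 == Psi1 G x m n k / Psi3 G x m p n).
Proof.
rewrite /root quarticE hornerD hornerN !hornerZ hornerX hornerXn.
have -> : c1 * a - c3 * a ^+ 3 = (- c3) * (a * (a ^+ 2 - Psi1 G x m n k / Psi3 G x m p n)) by field.
by rewrite !mulf_eq0 oppr_eq0 mulf_eq0 (negPf natr4_neq0) (negPf P3) /= subr_eq0.
Qed.

Lemma quartic_type_G : type_G G x m p n k.
Proof.
pose r := sqrtc (Psi1 G x m n k / Psi3 G x m p n).
have r2 : r ^+ 2 = Psi1 G x m n k / Psi3 G x m p n by exact: sqr_sqrtc.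
have r0 : r != 0 by rewrite sqrtc_eq0 mulf_neq0// invr_neq0.
exists [:: None; Some 0; Some r; Some (- r)]; split=> //.
  rewrite /= !inE /= negb_or andbT.
  have -> : (Some (0 : C) == Some r) = (0 == r) by [].
  have -> : (Some (0 : C) == Some (- r)) = (0 == - r) by [].
  have -> : (Some r == Some (- r)) = (r == - r) by [].
  rewrite eq_sym r0 eq_sym oppr_eq0 r0 /= -addr_eq0 -mulr2n mulrn_eq0 /=.
  exact: r0.
case=> [a|].
  rewrite /= quartic_rootE -r2 eqf_sqr !inE.
  by [].
rewrite /= !inE /=; apply/leq_sizeP => j hj.
by rewrite quarticE coefB !coefZ coefX coefXn; case: j hj => [|[|[|[|j]]]]//= _; rewrite !mulr0 subr0.
Qed.

(** A double root at 0 would kill the linear coefficient [4 * Psi1]. *)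
Lemma quartic_not_multiple0 : ~~ quartic_multiple_root G x m p n k (Some 0).
Proof.
rewrite /= polyC0 subr0; apply/negP => /dvdpP[s E].
by have := quartic_coef1; rewrite E coefMXn /= eqxx.
Qed.

End Quartic.

Variables (U : set C2) (f : C2 -> R[i]^o).
Hypotheses (oU : open U) (hf : holomorphic_on U f).
Let M := @wz R @^-1` U.
Local Notation g := (g_of f).

Lemma Psi_vanishing y : M y ->
  [/\ Psi0 g y (m_of y) (k_of f y) = 0, Psi2 g y (m_of y) (p_of y) (n_of f y) (k_of f y) = 0 &
      Psi4 g y (p_of y) (n_of f y) = 0].
Proof.
move=> My; split.
- by apply: (contract_mixed oU hf _ _ My); [right|right|right|right].
- rewrite /Psi2.
  have := @contract_mixed R U f oU hf (vzb R) (vz R) (vwb R) (vw R) y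
    (cexp (- conjc (f (wz y)))) (cexp (- f (wz y))) My.
  by apply; [right|left|right|left].
- by apply: (contract_mixed oU hf _ _ My); [left|left|left|left].
Qed.

Section Generic.
Variable y : pt.
Hypotheses (My : M y) (fy : d_dw (d_dz f) (wz y) != 0).

Lemma Psi3_neq0 : Psi3 g y (m_of y) (p_of y) (n_of f y) != 0.
Proof.
rewrite (Psi3_value oU hf My); apply: mulf_neq0; last exact: fy.
by apply: mulf_neq0; [rewrite invr_eq0 pnatr_eq0|exact: cexp_neq0].
Qed.

Lemma Psi1_neq0 : Psi1 g y (m_of y) (n_of f y) (k_of f y) != 0.
Proof.
rewrite (Psi1_value oU hf My); apply: mulf_neq0; last by rewrite conjc_eq0.
by apply: mulf_neq0; [rewrite invr_eq0 pnatr_eq0|exact: cexp_neq0].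
Qed.

Lemma type_G_g_of : type_G g y (m_of y) (p_of y) (n_of f y) (k_of f y).
Proof.
have [P0 P2 P4] := Psi_vanishing My.
exact: quartic_type_G P0 P2 P4 Psi1_neq0 Psi3_neq0.
Qed.

Lemma plane_at0 : plane_at (m_of y) (p_of y) (n_of f y) (k_of f y) (Some 0) = N_of f y.
Proof. by rewrite /plane_at !scale0r addr0 subr0. Qed.

Lemma principal_N_of : principal_plane g y (m_of y) (p_of y) (n_of f y) (k_of f y) (N_of f y).
Proof.
have [P0 P2 P4] := Psi_vanishing My.
exists (Some 0); last by rewrite plane_at0; apply/andP; split; exact: submx_refl.
by rewrite /= (quartic_rootE P0 P2 P4 Psi3_neq0) eqxx.
Qed.

(** [multiple_principal_plane] allows any parameter whose plane is [N]. This shows that 0 is the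
    only finite candidate, and the next lemma excludes infinity. *)
Lemma not_antiholomorphic_comb (X Y : cvec) a c : c != 0 ->
  [/\ X 0 0 = 2^-1, X 0 1 = 2^-1 * 'i, X 0 2%:R = 0 & X 0 3%:R = 0] ->
  [/\ Y 0 0 = 0, Y 0 1 = 0, Y 0 2%:R = 2^-1 & Y 0 3%:R = - (2^-1 * 'i)] ->
  antiholomorphic (X + a *: (c *: Y)) -> a = 0.
Proof.
move=> c0 [m0 m1 m2 m3] [z0 z1 z2 z3]; rewrite /antiholomorphic.
have E i : (X + a *: (c *: Y)) 0 i = X 0 i + a * c * Y 0 i by rewrite !mxE mulrA.
rewrite !E m2 m3 z2 z3 => /andP[_ /eqP H].
have : a * c * 'i = 0.
  have -> : a * c * 'i = 'i * (0 + a * c * 2^-1) - (0 + a * c * - (2^-1 * 'i)) by field.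
  by rewrite H subrr.
move/eqP; rewrite !mulf_eq0 (negPf c0) orbF => /orP[/eqP //|].
by rewrite eq_complex /= oner_eq0 andbF.
Qed.

Lemma not_antiholomorphic_vw (Y : cvec) c : c != 0 ->
  [/\ Y 0 0 = 0, Y 0 1 = 0, Y 0 2%:R = 2^-1 & Y 0 3%:R = - (2^-1 * 'i)] ->
  antiholomorphic (c *: Y) -> False.
Proof.
move=> c0 [z0 z1 z2 z3]; rewrite /antiholomorphic.
have E i : (c *: Y) 0 i = c * Y 0 i by rewrite mxE.
rewrite !E z2 z3 => /andP[_ /eqP H].
have : c * 'i = 0.
  have -> : c * 'i = 'i * (c * 2^-1) - (c * - (2^-1 * 'i)) by field.
  by rewrite H subrr.
move/eqP; rewrite !mulf_eq0 (negPf c0) /=.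
by rewrite eq_complex /= oner_eq0 andbF.
Qed.

Lemma not_multiple_principal_N_of :
  ~ multiple_principal_plane g y (m_of y) (p_of y) (n_of f y) (k_of f y) (N_of f y).
Proof.
have [P0 P2 P4] := Psi_vanishing My.
case=> -[a|] mult /andP[_ /rV_subP sub].
  suff a0 : a = 0 by move: mult; rewrite a0 (negPf (quartic_not_multiple0 P0 P2 P4 Psi1_neq0)).
  have : ((m_of y + a *: n_of f y)%R <= N_of f y)%MS.
    by apply: sub; apply/sub_col_mx_row; exists 1, 0; rewrite scale1r scale0r addr0.
  rewrite sub_N_of.
  exact: (not_antiholomorphic_comb (cexp_neq0 _) (entries_vwb R) (entries_vz R)).
have : (n_of f y <= N_of f y)%MS.
  by apply: sub; apply/sub_col_mx_row; exists 1, 0; rewrite scale1r scale0r addr0.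
rewrite sub_N_of.
exact: (not_antiholomorphic_vw (cexp_neq0 _) (entries_vz R)).
Qed.

Lemma weyl_sd_neq0 : exists a b c d, weyl_sd g false a b c d y != 0.
Proof.
(* Up to sign, the components (0,2,0,1) and (0,3,0,1) are the imaginary and the real part of
   [f_wz]. *)
have [p0|p0] := eqVneq (mixed_re f y) 0.
  exists 0, 2%:R, 0, 1; rewrite (weyl_sd_g_of oU hf)// (weyl_hmix oU hf)// /hmix /= mul1r oppr_eq0.
  apply: contraNneq fy => q0; rewrite mixed_C p0 q0; apply/eqP; exact: eqC.
exists 0, 3%:R, 0, 1; rewrite (weyl_sd_g_of oU hf)// (weyl_hmix oU hf)// /hmix /= mul1r oppr_eq0.
exact: p0.
Qed.

End Generic.
End PetrovType.

(** * The obstruction to conformally Einstein metrics *)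

(** Real and imaginary parts of a complex differential polynomial, because all variables in [jvar]
    are real. *)
Definition cpoly := (dpoly * dpoly)%type.
Definition cadd (P Q : cpoly) : cpoly := (padd P.1 Q.1, padd P.2 Q.2).
Definition csub (P Q : cpoly) : cpoly := (psub P.1 Q.1, psub P.2 Q.2).
Definition cmul (P Q : cpoly) : cpoly :=
  (psub (pmul P.1 Q.1) (pmul P.2 Q.2), padd (pmul P.1 Q.2) (pmul P.2 Q.1)).
Definition cscal (c : Q) (P : cpoly) : cpoly := (pscal c P.1, pscal c P.2).
(* The derivations 2^-1 (d_i + sqrt(-1) d_j), that is, d/d(conj w) for (i, j) = (0, 1)
   and d/d(conj z) for (i, j) = (2, 3). *)
Definition cder_bar (i j : nat) (P : cpoly) : cpoly :=
  cscal (qfrac 1 2) (psub (pder i P.1) (pder j P.2), padd (pder i P.2) (pder j P.1)).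
Definition dX := cder_bar 0 1.
Definition dY := cder_bar 2 3.

(** The conjugate of d_w^a d_z^b f. [dX] and [dY] raise its indices and annihilate the unconjugated
    jets, so the elimination takes its coefficients among these. *)
Definition conj_jet (a b : nat) : cpoly :=
  ([:: (q1, mono0 [:: JR a b])], [:: (qN1, mono0 [:: JI a b])]).
(* The inverse of the conformal factor. *)
Definition sigmaP : cpoly := ([:: (q1, (BinNums.Z0, Z_of_int (- 1), [::]))], [::]).

Definition ricO := tab2 (riT (gP 2) (iP 2)).
(* 4 Ric(X, X), 4 Ric(X, Y) and 4 Ric(Y, Y) for the metric S^2 g, with X = d/d(conj w)
   and Y = d/d(conj z). *)
Definition ricO_XX : cpoly := let r := get2 ricO in (psub (r 0 0) (r 1 1), padd (r 0 1) (r 0 1))%N.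
Definition ricO_XY : cpoly := let r := get2 ricO in (psub (r 0 2) (r 1 3), padd (r 0 3) (r 1 2))%N.
Definition ricO_YY : cpoly := let r := get2 ricO in (psub (r 2 2) (r 3 3), padd (r 2 3) (r 2 3))%N.

(* With [Lsigma] of the Ricci components for L1, L2, L3, third derivatives of sigma cancel
   in Y L1 - X L2 and Y L2 - X L3, and the lower-order terms of A and B remove the second
   ones.  The final combination removes the first derivatives. *)
Definition obstruction (L1 L2 L3 : cpoly) : cpoly :=
  let hX := conj_jet 1 0 in let hY := conj_jet 0 1 in let q := conj_jet 1 1 in
  let qX := conj_jet 2 1 in let qY := conj_jet 1 2 in
  let A := cscal (qfrac 4 1) (csub (csub (dY L1) (dX L2)) (cscal (qfrac 1 2) (cmul hX L2))) in
  let B := cscal (qfrac 4 1) (csub (cadd (csub (dY L2) (dX L3)) (cscal (qfrac 1 2) (cmul hX L3)))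
             (cmul hY L2)) in
  cadd (csub (cmul q (csub (dY A) (dX B)))
             (cmul (csub (cscal (qfrac 2 1) qY) (cmul hY q)) A))
       (cmul (cadd (cscal (qfrac 2 1) qX) (cscal (qfrac 3 2) (cmul hX q))) B).

(* By the conformal change of the Ricci tensor, this turns the components 4 Ric(X, Y) of
   S^2 g into nabla_X nabla_Y sigma + sigma Ric_g(X, Y) / 2. *)
Definition Lsigma (ric : cpoly) := cscal (qfrac 1 8) (cmul sigmaP ric).

(** What the elimination leaves: [-5/2 * q ^ 3 * sigma], with no derivative of [sigma]. *)
Definition obstruction_value : cpoly :=
  let q := conj_jet 1 1 in cscal (qfrac (- 5) 2) (cmul (cmul q (cmul q q)) sigmaP).

(** A formal identity, valid for any conformal factor; the Einstein equation enters only later, to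
    make the three inputs vanish. *)
Lemma obstruction_identity :
  csub (obstruction (Lsigma ricO_XX) (Lsigma ricO_XY) (Lsigma ricO_YY)) obstruction_value = ([::], [::]).
Proof. by vm_compute. Qed.

(** * No conformal multiple is Einstein *)

Section EinsteinObstruction.
Variable R : realType.
Local Notation C2 := (R[i]^o * R[i]^o)%type.
Local Notation pt := 'rV[R]_4.
Variables (U : set C2) (f : C2 -> R[i]^o) (V : set pt) (Om : pt -> R).
Hypotheses (oU : open U) (hf : holomorphic_on U f) (oV : open V).
Hypotheses (VU : V `<=` @wz R @^-1` U) (sOm : smooth_on V Om).
Hypothesis Om0 : forall y, V y -> Om y != 0.
Local Notation jp := (jp f Om).

(** Vanishing on a whole open set, not at a point, so that it is inherited by derivatives: these
    polynomials form a differential ideal. *)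
Definition vanishes (p : dpoly) := forall y, V y -> jp p y = 0.
Definition cvanishes (P : cpoly) := vanishes P.1 /\ vanishes P.2.

Lemma vanishesD p q : vanishes p -> vanishes q -> vanishes (padd p q).
Proof. by move=> hp hq y Vy; rewrite jpD hp// hq// addr0. Qed.

Lemma vanishesB p q : vanishes p -> vanishes q -> vanishes (psub p q).
Proof. by move=> hp hq y Vy; rewrite jpB hp// hq// subr0. Qed.

Lemma vanishesZ c p : vanishes p -> vanishes (pscal c p).
Proof. by move=> hp y Vy; rewrite jpZ hp// mulr0. Qed.

Lemma vanishesM p q : vanishes q -> vanishes (pmul p q).
Proof. by move=> hq y Vy; rewrite (jpM f Om0)// hq// mulr0. Qed.

Lemma vanishes_pder (i : 'I_4) p : vanishes p -> vanishes (pder i p).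
Proof.
move=> hp y Vy; rewrite -((has_pd_jp oU hf oV VU sOm Om0 p Vy).2 i).
have H0 : forall z, V z -> jp p z = cst 0 z by move=> z Vz; rewrite hp.
by rewrite (pd_near i oV Vy H0) /pd derive_cst.
Qed.

Lemma cvanishesD P S : cvanishes P -> cvanishes S -> cvanishes (cadd P S).
Proof. by move=> [? ?] [? ?]; split; exact: vanishesD. Qed.

Lemma cvanishesB P S : cvanishes P -> cvanishes S -> cvanishes (csub P S).
Proof. by move=> [? ?] [? ?]; split; exact: vanishesB. Qed.

Lemma cvanishesZ c P : cvanishes P -> cvanishes (cscal c P).
Proof. by move=> [? ?]; split; exact: vanishesZ. Qed.

Lemma cvanishesM P S : cvanishes S -> cvanishes (cmul P S).
Proof.
by move=> [? ?]; split; [apply: vanishesB|apply: vanishesD]; exact: vanishesM.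
Qed.

Lemma cvanishes_der_bar (i j : 'I_4) P : cvanishes P -> cvanishes (cder_bar i j P).
Proof.
move=> [? ?]; apply: cvanishesZ; split; [apply: vanishesB|apply: vanishesD];
  exact: vanishes_pder.
Qed.

Lemma cvanishes_dX P : cvanishes P -> cvanishes (dX P).
Proof. exact: (@cvanishes_der_bar (@Ordinal 4 0 isT) (@Ordinal 4 1 isT)). Qed.

Lemma cvanishes_dY P : cvanishes P -> cvanishes (dY P).
Proof. exact: (@cvanishes_der_bar (@Ordinal 4 2 isT) (@Ordinal 4 3 isT)). Qed.

Lemma obstruction_vanishes L1 L2 L3 : cvanishes L1 -> cvanishes L2 -> cvanishes L3 ->
  cvanishes (obstruction L1 L2 L3).
Proof.
move=> h1 h2 h3; rewrite /obstruction.
set A := cscal _ (csub (csub (dY L1) _) _).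
set B := cscal _ (csub (cadd _ _) _).
have hA : cvanishes A.
  apply: cvanishesZ; apply: cvanishesB; last by apply: cvanishesZ; exact: cvanishesM.
  by apply: cvanishesB; [exact: cvanishes_dY|exact: cvanishes_dX].
have hB : cvanishes B.
  apply: cvanishesZ; apply: cvanishesB; last exact: cvanishesM.
  apply: cvanishesD; last by apply: cvanishesZ; exact: cvanishesM.
  by apply: cvanishesB; [exact: cvanishes_dY|exact: cvanishes_dX].
apply: cvanishesD; last exact: cvanishesM.
apply: cvanishesB; last exact: cvanishesM.
by apply: cvanishesM; apply: cvanishesB; [exact: cvanishes_dY|exact: cvanishes_dX].
Qed.

Definition ceval (P : cpoly) y : R[i] := jp P.1 y +i* jp P.2 y.

Lemma cevalM P S y : V y -> ceval (cmul P S) y = ceval P y * ceval S y.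
Proof. by move=> Vy; rewrite /ceval /cmul jpB jpD !(jpM f Om0 _ _ Vy). Qed.

Lemma cevalZ c P y : ceval (cscal c P) y = (qr R c)%:C * ceval P y.
Proof.
rewrite /ceval /cscal !jpZ; apply: eqC => /=; first by rewrite mul0r subr0.
by rewrite mul0r addr0.
Qed.

Lemma ceval_conj_jet11 y : ceval (conj_jet 1 1) y = conjc (d_dw (d_dz f) (wz y)).
Proof.
rewrite /ceval /conj_jet !jp1 qr_q1 qrN1 mul1r mulN1r.
rewrite /evalm /mono0 /evall !big_seq1 /= !expr0z !mul1r.
by rewrite /Re_at /Im_at; case: (d_dw _ _).
Qed.

Lemma ceval_sigma y : ceval sigmaP y = ((Om y)^-1)%:C.
Proof.
rewrite /ceval /sigmaP jp1 jp0 qr_q1 mul1r /evalm /evall big_nil mulr1 /= expr0z mul1r.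
by [].
Qed.

Lemma not_einstein_scaled : (forall q, U q -> d_dw (d_dz f) q != 0) -> V !=set0 ->
  ~ einstein_on (scaled_metric f Om 2) V.
Proof.
move=> fwz [y Vy] [lam ein].
pose G := scaled_metric f Om 2.
have hG (i j : 'I_4) z : V z -> G z i j = jp (gP 2 i j) z by move=> _; exact: scaled_metricE.
have hI (i j : 'I_4) z : V z -> ginv G i j z = jp (iP 2 i j) z.
  by move=> Vz; apply: ginv_scaledE; exact: Om0.
have ric i j z : (i < 4)%N -> (j < 4)%N -> V z -> jp (get2 ricO i j) z = lam * jp (gP 2 i j) z.
  move=> hi hj Vz.
  have := ricciE oU hf oV VU sOm Om0 hG hI (Ordinal hi) (Ordinal hj) Vz.
  by rewrite (ein z Vz) hG.
(* The metric is diagonal with equal entries within each pair, so [lam] cancels in differences of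
   diagonal components and is absent off the diagonal. The three complex combinations are built from
   exactly these. *)
have dif i j : (i < 4)%N -> (j < 4)%N -> gP 2 i i = gP 2 j j ->
    vanishes (psub (get2 ricO i i) (get2 ricO j j)).
  by move=> hi hj E z Vz; rewrite jpB !ric// E subrr.
have off i j : (i < 4)%N -> (j < 4)%N -> (i == j) = false -> vanishes (get2 ricO i j).
  by move=> hi hj E z Vz; rewrite ric// /gP E jp0 mulr0.
have hXX : cvanishes ricO_XX.
  split; first exact: (dif 0%N 1%N).
  by apply: (@vanishesD (get2 ricO 0 1) (get2 ricO 0 1)); exact: off.
have hXY : cvanishes ricO_XY.
  split; first by apply: (@vanishesB (get2 ricO 0 2) (get2 ricO 1 3)); exact: off.
  by apply: (@vanishesD (get2 ricO 0 3) (get2 ricO 1 2)); exact: off.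
have hYY : cvanishes ricO_YY.
  split; first exact: (dif 2%N 3%N).
  by apply: (@vanishesD (get2 ricO 2 3) (get2 ricO 2 3)); exact: off.
have L P : cvanishes P -> cvanishes (Lsigma P).
  by move=> hP; apply: cvanishesZ; exact: cvanishesM.
have [nX nY] := obstruction_vanishes (L _ hXX) (L _ hXY) (L _ hYY).
(* The negated value is written as [0 - value]; replacing that 0 by the vanishing obstruction gives
   the left side of [obstruction_identity]. *)
have [E1 E2] : jp obstruction_value.1 y = 0 /\ jp obstruction_value.2 y = 0.
  have id1 := congr1 fst obstruction_identity; have id2 := congr1 snd obstruction_identity.
  split; apply/eqP; rewrite -oppr_eq0 -[X in X == _]add0r; apply/eqP.
    rewrite -[X in X - _](nX y Vy) -jpB.
    by rewrite [psub _ _]id1 jp0.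
  rewrite -[X in X - _](nY y Vy) -jpB.
  by rewrite [psub _ _]id2 jp0.
have : ceval obstruction_value y = 0 by apply: eqC.
rewrite /obstruction_value cevalZ !(cevalM _ _ Vy) ceval_conj_jet11 ceval_sigma.
move/eqP; apply/negP.
have q0 : conjc (d_dw (d_dz f) (wz y)) != 0 by rewrite conjc_eq0; apply: fwz; exact: VU.
move: q0; move: (conjc _) => q q0.
have c0 (c : R) : c != 0 -> c%:C != 0.
  by move=> h; apply: contraNneq h => -[->].
apply: mulf_neq0.
  apply: c0; rewrite qr_qfrac; apply: mulf_neq0; last by rewrite invr_eq0 pnatr_eq0.
  by rewrite intr_eq0.
apply: mulf_neq0; first by apply: mulf_neq0 => //; exact: mulf_neq0.
by apply: c0; rewrite invr_eq0; exact: Om0.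
Qed.

End EinsteinObstruction.

Lemma conjc_Psi1_value (R : realType) (a d : R[i]) :
  conjc (4^-1 * cexp (- conjc a) * conjc d) = 4^-1 * cexp (- a) * d.
Proof.
have cM (x y : R[i]) : conjc (x * y) = conjc x * conjc y by exact: rmorphM.
have ce : conjc (cexp (- conjc a)) = cexp (- a).
  by rewrite cexp_conjc rmorphN /= conjcK.
have c4 : conjc 4^-1 = 4^-1 :> R[i] by rewrite (fmorphV (@conjc R)) (rmorph_nat (@conjc R) 4).
by rewrite (cM _ (conjc d)) (cM _ (cexp _)) ce c4 conjcK.
Qed.

Theorem mainTheorem13 (R : realType) (U : set (R[i]^o * R[i]^o))
    (f : R[i]^o * R[i]^o -> R[i]^o) (Uopen : open U) (fhol : holomorphic_on U f) :
  let M : set 'rV[R]_4 := @wz R @^-1` U in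
  let g := g_of f in
  let N := N_of f in
  let m := @m_of R in let p := @p_of R in let n := n_of f in let k := k_of f in
  exists o : bool,
    [/\ riemannian_metric_on g M,
        forall x, M x ->
          totally_null_plane g x (N x) /\ selfdual_plane g o x (N x)
      & integrable_field M N] /\
    [/\ forall x, M x -> forall a b c d, weyl_asd g o a b c d x = 0,
        forall x, M x -> forall a b, bach g a b x = 0
      & forall x, M x ->
          [/\ Psi0 g x (m x) (k x) = 0,
              Psi2 g x (m x) (p x) (n x) (k x) = 0,
              Psi4 g x (p x) (n x) = 0,
              Psi3 g x (m x) (p x) (n x) = conjc (Psi1 g x (m x) (n x) (k x))
            & Psi3 g x (m x) (p x) (n x)
              = 4^-1 * cexp (- f (wz x)) * d_dw (d_dz f) (wz x)]] /\
    ((forall q, U q -> d_dw (d_dz f) q != 0) ->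
       [/\ forall x, M x -> exists a b c d, weyl_sd g o a b c d x != 0,
           forall x, M x -> type_G g x (m x) (p x) (n x) (k x),
           exists J : 'rV[R]_4 -> 'M[R]_4,
             [/\ hermitian_structure_on g M J,
                 integrable_field M (fun x => T10 (J x)),
                 forall x, M x -> agrees_with_orientation o (J x)
               & forall x, M x ->
                 [/\ (T10 (J x) == N x)%MS,
                     principal_plane g x (m x) (p x) (n x) (k x) (N x)
                   & ~ multiple_principal_plane g x (m x) (p x) (n x) (k x)
                         (N x)]]
         & forall V : set 'rV[R]_4, open V -> V !=set0 -> V `<=` M ->
             ~ conformally_einstein_on V g]).
Proof.
move=> M g N m p n k; have oM : open M := wz_open Uopen.
(* The coordinate orientation is the one for which [N] is selfdual. *)
exists false; split; [split|split; [split|move=> fwz; split]].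
- exact: riemannian_g_of.
- by move=> x Mx; split; [exact: totally_null_N_of|exact: (selfdual_N_of Mx)].
- by apply: (integrable_antiholomorphic oM) => x _ v; exact: sub_N_of.
- by move=> x Mx a b c d; exact: (weyl_asd_g_of Uopen fhol).
- by move=> x Mx a b; exact: (bach_g_of Uopen fhol).
- move=> x Mx; have [P0 P2 P4] := Psi_vanishing Uopen fhol Mx.
  have P3 := Psi3_value Uopen fhol Mx; have P1 := Psi1_value Uopen fhol Mx.
  split; [exact: P0|exact: P2|exact: P4| |exact: P3].
  by apply: (eq_trans P3); apply: (eq_trans (esym (conjc_Psi1_value _ _))); congr conjc; exact: esym P1.
- by move=> x Mx; exact: (weyl_sd_neq0 Uopen fhol Mx (fwz _ Mx)).
- by move=> x Mx; exact: (type_G_g_of Uopen fhol Mx (fwz _ Mx)).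
- exists (fun=> Jmx R); split.
  + exact: hermitian_Jmx.
  + by apply: (integrable_antiholomorphic oM) => x _ v; exact: sub_T10.
  + by move=> x _; exact: agrees_Jmx.
  + move=> x Mx; split; first exact: T10_eq_N.
      exact: (principal_N_of Uopen fhol Mx (fwz _ Mx)).
    exact: (not_multiple_principal_N_of Uopen fhol Mx (fwz _ Mx)).
- move=> V oV V0 VM [Om [sOm Om_gt0 ein]].
  apply: (not_einstein_scaled Uopen fhol oV VM sOm _ fwz V0 ein) => y Vy.
  by rewrite gt_eqF// Om_gt0.
Qed.
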